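(* Let $n\ge2$, let $B$ be the open unit ball of $\mathbb{R}^n$ centered at $0$, let $\psi\in C_0^\infty(\mathbb{R}^n)$ with $\operatorname{supp}\psi\subseteq B$ and $\int_{\mathbb{R}^n}\psi=1$, and let $\Omega\subset\mathbb{R}^n$ be a bounded open set star-shaped with respect to every point of $\overline B$. Let $F\in C_D(\Omega)$, extended by $0$ outside $\Omega$, and let $B_R$ be an open ball with $\overline\Omega\subset B_R$, with outward unit normal $\nu$ on $\partial B_R$. For $x\ne y$ let $N_i(x,y)=(x_i-y_i)\int_1^\infty\psi(y+\alpha(x-y))\alpha^{n-1}d\alpha$ and $v_i(x)=\int_\Omega F(y)N_i(x,y)\,dy$. Let $\eta\in C^\infty(\mathbb{R}^+)$ with $\eta\equiv0$ on $[0,1]$, $\eta(t)=1$ for $t\ge2$, $|\eta'|\le2$, and $v^\epsilon_i(x)=\int_\Omega F(y)N_i(x,y)\eta(|x-y|/\epsilon)\,dy$. For $x\in\Omega$ define $$u^i_j(x)=\int_{B_R}[F(y)-F(x)]\,\partial_{x_j}N_i(x,y)\,dy+F(x)\int_{B_R}(x_i-y_i)\int_1^\infty\partial_j\psi(y+\alpha(x-y))\alpha^{n-1}d\alpha\,dy-F(x)\int_{\partial B_R}N_i(x,y)\nu_j(y)\,d\sigma_y.$$ Then: (i) $u^i_j(x)$ is well defined for every $x\in\Omega$; (ii) $\partial_{x_j}v^\epsilon_i\to u^i_j$ uniformly on every open $\Omega'$ with $\overline{\Omega'}\subset\Omega$, as $\epsilon\to0$; (iii) $\partial_{x_j}v_i=u^i_j$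 on $\Omega$; (iv) $v=(v_1,\dots,v_n)\in C^1(\Omega)$.
   Context: For a function $F$ on $\Omega$, $\omega(F,\rho)=\sup_{x,y\in\Omega,\ |x-y|<\rho}|F(x)-F(y)|$; $C_D(\Omega)$ is the space of functions $F$ on $\Omega$ with $\omega(F,\rho)/\rho$ integrable near $0^+$ (uniformly Dini-continuous). $\Omega$ is star-shaped with respect to a point $p$ if $p\in\Omega$ and for every $y\in\Omega$ the segment joining $p$ and $y$ lies in $\Omega$. $\partial_j\psi$ is the partial derivative of $\psi$ in its $j$-th argument. *)

(* Defs.v *)
From HB Require Import structures.
From mathcomp Require Import all_boot all_order all_algebra.
From mathcomp Require Import all_classical all_reals all_analysis.

Set Implicit Arguments.
Unset Strict Implicit.
Unset Printing Implicit Defensive.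

Import Order.TTheory GRing.Theory Num.Theory.
Import numFieldNormedType.Exports.
Local Open Scope classical_set_scope.
Local Open Scope ring_scope.

Section Defs.
Variables (R : realType) (n : nat).
Local Notation V := 'rV[R]_n.

(* Euclidean norm (the library norm on 'rV is the sup norm). *)
Definition enorm (x : V) : R := Num.sqrt (\sum_(i < n) x ord0 i ^+ 2).

Definition eball (c : V) (r : R) : set V := [set x | enorm (x - c) < r].

Definition evec (j : 'I_n) : V := delta_mx ord0 j.
Definition pderivable (f : V -> R) (j : 'I_n) (x : V) := derivable f x (evec j).
Definition pderiv (f : V -> R) (j : 'I_n) (x : V) : R := derive f x (evec j).

Fixpoint Ck (k : nat) (f : V -> R) : Prop :=
  continuous f /\
  match k with
  | 0 => True
  | k'.+1 => forall j : 'I_n, (forall x, pderivable f j x) /\ Ck k' (pderiv f j)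
  end.
Definition smooth (f : V -> R) := forall k, Ck k f.

Definition ext0 (A : set V) (f : V -> R) (x : V) : R :=
  if x \in A then f x else 0.

Definition borelV : set (set V) := smallest (sigma_algebra setT) [set U | open U].
Definition measurable_onV (A : set V) (f : V -> R) :=
  forall B : set R, open B -> borelV (A `&` f @^-1` B).

(* n-dimensional Lebesgue integral of a nonnegative function, as the iterated
   one-dimensional Lebesgue integral (Tonelli) *)
Fixpoint lint (k : nat) : ('rV[R]_k -> \bar R) -> \bar R :=
  match k return ('rV[R]_k -> \bar R) -> \bar R with
  | 0 => fun f => f 0
  | k'.+1 => fun f =>
      (\int[@lebesgue_measure R]_t lint (fun y : 'rV[R]_k' => f (row_mx (\row_(_ < 1) t) y)))%E
  end.

Definition Lint (A : set V) (f : V -> R) : R :=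
  fine (lint (fun x => (Num.max (ext0 A f x) 0)%:E)
        - lint (fun x => (Num.max (- ext0 A f x) 0)%:E))%E.
Definition Lintegrable (A : set V) (f : V -> R) :=
  measurable_onV A f /\ (lint (fun x => `|ext0 A f x|%:E) < +oo)%E.

(* surface integral over the sphere of center c and radius r > 0 (surface measure
   defined by the cone formula  \int_{S_r(c)} g dsigma
   = n r^(n-1) \int_{B_1(0)} g(c + r z/|z|) dz ) *)
Definition sphere_pull (c : V) (r : R) (g : V -> R) (z : V) : R :=
  g (c + (r / enorm z) *: z).
Definition sphere_int (c : V) (r : R) (g : V -> R) : R :=
  n%:R * r ^+ n.-1 * Lint (eball 0 1) (sphere_pull c r g).
Definition sphere_integrable (c : V) (r : R) (g : V -> R) :=
  Lintegrable (eball 0 1) (sphere_pull c r g).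

Definition star_shaped (Om : set V) (p : V) :=
  Om p /\ forall y, Om y -> forall t : R, 0 <= t <= 1 -> Om (p + t *: (y - p)).

Definition bounded_setV (Om : set V) := exists M : R, forall x, Om x -> enorm x <= M.

Definition modcont (Om : set V) (F : V -> R) (rho : R) : \bar R :=
  ereal_sup [set z | exists x y, [/\ Om x, Om y, enorm (x - y) < rho
                                    & z = (`|F x - F y|)%:E]].
Definition Dini (Om : set V) (F : V -> R) :=
  exists delta : R, 0 < delta /\
    (\int[@lebesgue_measure R]_(rho in [set rho : R | (0 < rho < delta)%R])
       (modcont Om F rho * (rho^-1)%:E)
      < +oo)%E.

Definition Nker (psi : V -> R) (i : 'I_n) (x y : V) : R :=
  (x ord0 i - y ord0 i) *
  Rintegral (@lebesgue_measure R) `[1, +oo[%classic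
    (fun a => psi (y + a *: (x - y)) * a ^+ n.-1).

Definition vfun (Om : set V) (F psi : V -> R) (i : 'I_n) (x : V) : R :=
  Lint Om (fun y => F y * Nker psi i x y).

Definition veps (Om : set V) (F psi : V -> R) (eta : R -> R) (eps : R)
  (i : 'I_n) (x : V) : R :=
  Lint Om (fun y => F y * Nker psi i x y * eta (enorm (x - y) / eps)).

Definition u_int1 (F psi : V -> R) (i j : 'I_n) (x : V) (y : V) : R :=
  (F y - F x) * pderiv (fun x' => Nker psi i x' y) j x.
Definition u_int2 (psi : V -> R) (i j : 'I_n) (x : V) (y : V) : R :=
  (x ord0 i - y ord0 i) *
  Rintegral (@lebesgue_measure R) `[1, +oo[%classic
    (fun a => pderiv psi j (y + a *: (x - y)) * a ^+ n.-1).
Definition u_int3 (psi : V -> R) (c : V) (r : R) (i j : 'I_n) (x : V) (y : V) : R :=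
  Nker psi i x y * ((y ord0 j - c ord0 j) / r).

Definition ufun (Om : set V) (F psi : V -> R) (c : V) (r : R) (i j : 'I_n) (x : V) : R :=
  let Fe := ext0 Om F in
  Lint (eball c r) (u_int1 Fe psi i j x)
  + Fe x * Lint (eball c r) (u_int2 psi i j x)
  - Fe x * sphere_int c r (u_int3 psi c r i j x).

End Defs.

Fixpoint Ck_pos (R : realType) (k : nat) (g : R -> R) : Prop :=
  (forall t : R, 0 < t -> {for t, continuous g}) /\
  match k with
  | 0 => True
  | k'.+1 => (forall t : R, 0 < t -> derivable g t 1) /\ Ck_pos k' (derive1 g)
  end.
Definition smooth_pos (R : realType) (g : R -> R) := forall k, Ck_pos k g.

(* Main.v *)
(** The kernel satisfies |N_i| <= C |x-y|^(1-n), |d_j N_i| <= C |x-y|^(-n), and the sum of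
    its x_j- and y_j-derivatives is the kernel built from d_j psi, of order |x-y|^(1-n).
    Cutting N_i off near the diagonal by eta(|x-y|/eps) makes it C^1, so v^eps may be
    differentiated under the integral. Writing F(y) = (F(y) - F(x)) + F(x) and trading d_(x_j)
    for - d_(y_j) in the second term, the divergence theorem on B_R produces the boundary
    integral of u, which does not see the cut-off. Hence d_j v^eps - u is an integral over
    |x-y| < 3 eps only; in polar form it is at most C (int_0^(6 eps) omega(F,s)/s ds + eps).
    Since v^eps -> v uniformly, the mean value inequality for v^eps passes to the limit and
    gives d_j v = u. The divergence theorem on a ball is obtained from the cone formula for
    the surface measure by integrating d_j G against the weights (rho^2 - |x-c|^2)_+ and
    varying rho. *)
Require Import Defs.
From HB Require Import structures.
From mathcomp Require Import all_boot all_order all_algebra.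
From mathcomp Require Import all_classical all_reals all_analysis.
From mathcomp Require Import measurable_realfun.
From mathcomp Require Import ring lra.
Import Order.TTheory GRing.Theory Num.Theory.
Import numFieldNormedType.Exports.
Local Open Scope classical_set_scope.
Local Open Scope ring_scope.

Set Implicit Arguments.
Unset Strict Implicit.
Unset Printing Implicit Defensive.

(** * Lebesgue measure on row vectors *)

(** The integrals of the statement are iterated one-dimensional ones, while Tonelli, dominated
    convergence and differentiation under the integral sign need a measure; [muV] therefore follows
    the recursion of [lint], so that both notions agree. The obstacle is that the bound |x-y|^(-n)
    for the derivative of the kernel just fails to be integrable, so v cannot be differentiated
    directly. The difference F(y) - F(x) supplies the missing factor omega(F,|x-y|), but only inside
    [Om]: across its boundary the extension by 0 may jump. Hence the estimates ask that a small ball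
    around x lie in [Om], and the convergence is uniform only at a positive distance from the
    boundary. The radius doubles, from 3 eps to 6 eps, because polar coordinates are replaced by an
    average over radii s with |x-y| < s < 2|x-y|. In the divergence theorem, the weights vanish on
    the sphere, so no boundary term has to be known beforehand; comparing two nearby radii and
    dividing by their difference makes the surface term appear, with factor n r^(n-1) as the
    derivative of r^n. *)

Section BorelRV.
Variables (R : realType) (k : nat).

HB.instance Definition _ := Measurable.copy 'rV[R]_k
  (g_sigma_algebraType (@open 'rV[R]_k)).

Lemma open_measurableV (U : set 'rV[R]_k) : open U -> measurable U.
Proof. by move=> oU; apply: sub_sigma_algebra. Qed.

Lemma closed_measurableV (U : set 'rV[R]_k) : closed U -> measurable U.
Proof.
by move=> cU; rewrite -[U]setCK; apply: measurableC; apply: open_measurableV; rewrite openC.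
Qed.

(** Open intervals generate the Borel sets of the line, so testing preimages of open sets is
    enough. *)
Lemma measurable_onVP (A : set 'rV[R]_k) (f : 'rV[R]_k -> R) :
  measurable A -> measurable_onV A f <-> measurable_fun A f.
Proof.
move=> mA; split => [h|mf B oB]; last exact: mf mA _ (open_measurable oB).
move=> _; apply: (measurability _ (RGenOpens.measurableE R)) => //.
move=> _ [_ [a [b ->]] <-].
by apply: h; exact: interval_open.
Qed.

Lemma continuous_measurableV (f : 'rV[R]_k -> R) (A : set 'rV[R]_k) :
  open A -> {in A, continuous f} -> measurable_fun A f.
Proof.
move=> oA cf; apply/(measurable_onVP _ (open_measurableV oA)) => B oB.
apply: open_measurableV; rewrite openE => x [Ax Bfx].
rewrite /interior; apply: filterI; first exact: open_nbhs_nbhs.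
by apply: cf; [rewrite inE|exact: open_nbhs_nbhs].
Qed.

(** Second countability made explicit: the boxes have rational centres and radii 1/(m+1), so there
    are countably many. *)
Lemma open_bigcup_box (U : set 'rV[R]_k) : open U ->
  exists P : set (nat * 'rV[rat]_k),
  U = \bigcup_(p in P) [set x : 'rV[R]_k | forall i,
        `|x ord0 i - ratr (p.2 ord0 i)| < p.1.+1%:R^-1].
Proof.
move=> oU.
pose box (p : nat * 'rV[rat]_k) := [set x : 'rV[R]_k | forall i,
        `|x ord0 i - ratr (p.2 ord0 i)| < p.1.+1%:R^-1].
exists [set p | box p `<=` U]; rewrite -/box; apply/seteqP; split; last first.
  by move=> x [p pU xp]; exact: pU.
move=> x Ux.
have : nbhs x U by exact: open_nbhs_nbhs.
move=> /nbhs_ballP[e /= e0 xeU].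
have [m me] : exists m : nat, m.+1%:R^-1 < e / 2.
  have e20 : 0 < e / 2 by rewrite divr_gt0.
  have [m _ hm] := near_infty_natSinv_lt (PosNum e20).
  by exists m; exact: (hm m (leqnn m)).
have xq i : exists q : rat, `|x ord0 i - ratr q| < (m.+1%:R^-1 : R).
  have [|q /itvP hq] := @rat_in_itvoo R (x ord0 i - m.+1%:R^-1) (x ord0 i + m.+1%:R^-1).
    by rewrite ltrBlDr -addrA ltrDl addr_gt0.
  by exists q; rewrite distrC ltr_distl !hq.
have [q hq] := choice xq.
exists (m, \row_i q i) => /=; last by move=> i; rewrite mxE.
move=> y yb; apply: xeU; split => // i j; rewrite ord1 /ball/=.
have := yb j; rewrite /= mxE => yj.
have := hq j => xj.
apply: (@le_lt_trans _ _ (`|x ord0 j - ratr (q j)| + `|y ord0 j - ratr (q j)|)).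
  by rewrite (distrC (y _ _)) (le_trans _ (ler_normD _ _))// addrA subrK.
by rewrite (splitr e) ltrD// (lt_trans _ me).
Qed.

(** The preimage of a rational box is a finite intersection of coordinate conditions, and an open
    set is a countable union of boxes. *)
Lemma measurable_fun_rV d (T : measurableType d) (h : T -> 'rV[R]_k) :
  (forall i, measurable_fun setT (fun t => h t ord0 i)) -> measurable_fun setT h.
Proof.
move=> mh.
have ME : @measurable _ 'rV[R]_k = <<s @open 'rV[R]_k >> by [].
move=> _; apply: (measurability _ ME) => //.
move=> _ [U oU <-]; rewrite setTI.
have [P ->] := open_bigcup_box oU.
rewrite preimage_bigcup bigcup_mkcond; apply: countable_bigcupT_measurable => //.
move=> [m q] /=; case: ifPn => // _.
rewrite [X in measurable X](_ : _ = \big[setI/setT]_(i < k)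
   ((fun t => h t ord0 i) @^-1` [set x | `|x - ratr (q ord0 i)| < m.+1%:R^-1])).
  apply: bigsetI_measurable => i _.
  rewrite -[X in measurable X]setTI; apply: mh => //.
  have -> : [set x : R | `|x - ratr (q ord0 i)| < m.+1%:R^-1] = ball (ratr (q ord0 i) : R) (m.+1%:R^-1).
    by apply/seteqP; split => x; rewrite /ball/= distrC.
  exact: measurable_ball.
rewrite -bigcap_seq; apply/seteqP; split => t /=.
  by move=> ht i _; exact: ht.
by move=> ht i; apply: ht; rewrite /= mem_index_enum.
Qed.

End BorelRV.

Section MuRV.
Variable R : realType.

Lemma coord_measurable k (i : 'I_k) :
  measurable_fun setT (fun x : 'rV[R]_k => x ord0 i).
Proof.
by apply: continuous_measurableV; [exact: openT|move=> x _; exact: coord_continuous].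
Qed.

(** The map through which [lint] splits off the first coordinate. *)
Definition consV k (p : R * 'rV[R]_k) : 'rV[R]_k.+1 :=
  row_mx (\row_(_ < 1) p.1) p.2.

Lemma consV0 k (p : R * 'rV[R]_k) : consV p ord0 ord0 = p.1.
Proof.
transitivity (row_mx (\row_(_ < 1) p.1) p.2 ord0 (lshift k ord0)).
  by congr (row_mx _ _ _ _); apply: val_inj.
by rewrite row_mxEl mxE.
Qed.

Lemma consVS k (p : R * 'rV[R]_k) i : consV p ord0 (lift ord0 i) = p.2 ord0 i.
Proof.
transitivity (row_mx (\row_(_ < 1) p.1) p.2 ord0 (rshift 1 i)).
  by congr (row_mx _ _ _ _); apply: val_inj.
by rewrite row_mxEr.
Qed.

Lemma consV_measurable k :
  measurable_fun [set: measurableTypeR R * 'rV[R]_k] (@consV k).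
Proof.
apply: measurable_fun_rV => i; have [j ->|->] := unliftP ord0 i.
  under eq_fun do rewrite consVS.
  exact: (measurableT_comp (@coord_measurable k j) (@measurable_snd _ _ _ _)).
under eq_fun do rewrite consV0.
exact: measurable_fst.
Qed.

Definition unconsV k (x : 'rV[R]_k.+1) : R * 'rV[R]_k :=
  (x ord0 ord0, \row_i x ord0 (lift ord0 i)).

Lemma consVK k : cancel (@consV k) (@unconsV k).
Proof.
move=> [t y]; rewrite /unconsV consV0; congr pair.
by apply/rowP => i; rewrite mxE consVS.
Qed.

Lemma unconsV_measurable k : measurable_fun setT (@unconsV k).
Proof.
apply/measurable_fun_pair; first exact: (@coord_measurable k.+1 ord0).
apply: measurable_fun_rV => i.
by under eq_fun do rewrite mxE; exact: (@coord_measurable k.+1 _).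
Qed.

Section consV_measure.
Variables (k : nat) (mu : {sigma_finite_measure set 'rV[R]_k -> \bar R}).

Definition cons_measure : set 'rV[R]_k.+1 -> \bar R :=
  pushforward (lebesgue_measure \x mu)%E (@consV k).

Let cons_measure0 : cons_measure set0 = 0%E.
Proof. by rewrite /cons_measure /pushforward preimage_set0 measure0. Qed.

Let cons_measure_ge0 A : (0 <= cons_measure A)%E.
Proof. exact: (measure_ge0 (lebesgue_measure \x mu)%E). Qed.

Let cons_measure_additive : semi_sigma_additive cons_measure.
Proof.
move=> F; unshelve apply: (@measure_semi_sigma_additive _ _ _
  (pushforward (lebesgue_measure \x mu)%E (@consV k))).
exact: consV_measurable.
Qed.

HB.instance Definition _ := isMeasure.Build _ _ _ cons_measure
  cons_measure0 cons_measure_ge0 cons_measure_additive.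

(** Sigma-finiteness is what lets Tonelli be applied again in the next dimension; rectangles
    exhausting the product are carried over by [unconsV]. *)
Let cons_measure_sigma_finite : sigma_finite setT cons_measure.
Proof.
have /sigma_finiteP[F [FT ndF Foo]] :=
  (sigma_finiteT (@lebesgue_measure R : {sigma_finite_measure set (measurableTypeR R) -> \bar R})).
have /sigma_finiteP[G [GT ndG Goo]] := sigma_finiteT mu.
exists (fun n => @unconsV k @^-1` (F n `*` G n)).
  rewrite -preimage_bigcup (_ : \bigcup_n _ = setT) ?preimage_setT//.
  apply/seteqP; split => // -[t y] _.
  have : [set: R] t by []. rewrite FT => -[m _ Fmt].
  have : [set: 'rV[R]_k] y by []. rewrite GT => -[p _ Gpy].
  exists (maxn m p) => //; split => /=.
    by move: t Fmt; exact/subsetPset/ndF/leq_maxl.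
  by move: y Gpy; exact/subsetPset/ndG/leq_maxr.
move=> n; have [mF Fy] := Foo n; have [mG Gy] := Goo n.
have mFG : measurable (F n `*` G n) by exact: measurableX.
split.
  by rewrite -[X in measurable X]setTI; apply: unconsV_measurable.
rewrite /cons_measure /pushforward (_ : _ @^-1` _ = F n `*` G n).
  by rewrite product_measure1E// lte_mul_pinfty// ge0_fin_numE.
by apply/seteqP; split => x; rewrite /preimage /mkset consVK.
Qed.

HB.instance Definition _ := Measure_isSigmaFinite.Build _ _ _ cons_measure
  cons_measure_sigma_finite.

Lemma integral_cons_measure (f : 'rV[R]_k.+1 -> \bar R) :
  measurable_fun setT f -> (forall x, 0 <= f x)%E ->
  (\int[cons_measure]_x f x =
   \int[lebesgue_measure]_t \int[mu]_y f (consV (t, y)))%E.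
Proof.
move=> mf f0.
rewrite [LHS](@ge0_integral_pushforward _ _ _ _ _ _ (@consV_measurable k)
    (lebesgue_measure \x mu)%E setT f)//.
rewrite preimage_setT fubini_tonelli1//.
  exact: measurableT_comp mf (@consV_measurable k).
by move=> x; exact: f0.
Qed.

End consV_measure.

(** Lebesgue measure by the recursion of [lint]. In dimension 0 there is a single vector, and
    evaluation at it is integration against a Dirac mass. *)
Fixpoint muV k : {sigma_finite_measure set 'rV[R]_k -> \bar R} :=
  match k with
  | 0 => [the {sigma_finite_measure set 'rV[R]_0 -> \bar R} of dirac (0 : 'rV[R]_0)]
  | k'.+1 => [the {sigma_finite_measure set 'rV[R]_k'.+1 -> \bar R} of cons_measure (muV k')]
  end.

Lemma consV2_measurable k (t : R) : measurable_fun setT (fun y : 'rV[R]_k => consV (t, y)).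
Proof.
apply: measurable_fun_rV => i; have [j ->|->] := unliftP ord0 i.
  by under eq_fun do rewrite consVS; exact: coord_measurable.
by under eq_fun do rewrite consV0; exact: measurable_cst.
Qed.

Lemma lintE k (f : 'rV[R]_k -> \bar R) :
  measurable_fun setT f -> (forall x, 0 <= f x)%E ->
  lint f = (\int[muV k]_x f x)%E.
Proof.
elim: k f => [|k IH] f mf f0 /=.
  by rewrite integral_dirac// diracE in_setT mul1e.
rewrite integral_cons_measure//; apply: eq_integral => t _.
rewrite IH//.
exact: (measurableT_comp mf (consV2_measurable t)).
Qed.

Lemma ext0_patch k (A : set 'rV[R]_k) (f : 'rV[R]_k -> R) : ext0 A f = f \_ A.
Proof. by apply/funext => x; rewrite /ext0 patchE. Qed.

(** No integrability is asked: both sides are [fine] of the integral of the positive part minus that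
    of the negative part, so they agree even when this is a default value. *)
Lemma LintE k (A : set 'rV[R]_k) (f : 'rV[R]_k -> R) :
  measurable A -> measurable_fun A f ->
  Lint A f = \int[muV k]_(x in A) f x.
Proof.
move=> mA mf; rewrite Rintegral_mkcond /Lint /Rintegral integralE ext0_patch.
have mfA : measurable_fun setT (f \_ A) by exact/(measurable_restrictT _ mA).
congr (fine (_ - _)%E); rewrite lintE//.
- by apply: eq_integral => x _; rewrite funeposE EFin_max.
- by have /measurable_EFinP := measurable_funrpos mfA.
- by move=> x; rewrite lee_fin le_max lexx orbT.
- by apply: eq_integral => x _; rewrite funenegE EFin_max EFinN.
- by have /measurable_EFinP := measurable_funrneg mfA.
- by move=> x; rewrite lee_fin le_max lexx orbT.
Qed.

Lemma LintegrableE k (A : set 'rV[R]_k) (f : 'rV[R]_k -> R) :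
  measurable A -> (muV k).-integrable A (EFin \o f) -> Lintegrable A f.
Proof.
move=> mA fi; move: (fi) => /integrableP[/measurable_EFinP mf foo]; split; first exact/measurable_onVP.
have mfA : measurable_fun setT (f \_ A) by exact/(measurable_restrictT _ mA).
rewrite lintE//; last first.
  rewrite ext0_patch.
  have /measurable_EFinP : measurable_fun setT (Num.Def.normr \o (f \_ A)).
    exact: measurableT_comp.
  by [].
move: foo; rewrite integral_mkcond; apply: le_lt_trans.
rewrite le_eqVlt; apply/orP; left; apply/eqP; apply: eq_integral => x _.
by rewrite ext0_patch !patchE; case: ifPn => // _; rewrite normr0.
Qed.

(** The pushforward under the affine map, multiplied by s, agrees with Lebesgue measure on half-open
    intervals, hence everywhere by uniqueness. *)
Lemma lebesgue_affine (s a : R) (A : set (measurableTypeR R)) : 0 < s -> measurable A ->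
  lebesgue_measure ((fun t : measurableTypeR R => s * t + a : measurableTypeR R) @^-1` A) = (s^-1%:E * lebesgue_measure A)%E.
Proof.
move=> s0 mA.
have mphi : measurable_fun setT (fun t : measurableTypeR R => s * t + a : measurableTypeR R).
  by apply: measurable_funD => //; exact: measurable_funM.
pose k := NngNum (ltW s0).
have [nu nuE] : exists nu : {measure set (measurableTypeR R) -> \bar R},
    forall B, nu B = (s%:E * lebesgue_measure ((fun t : measurableTypeR R => (s * t + a)%R : measurableTypeR R) @^-1` B))%E.
  by unshelve eexists (mscale k (pushforward lebesgue_measure
    (fun t : measurableTypeR R => s * t + a : measurableTypeR R))).
suff nuA : lebesgue_measure A = nu A.
  by rewrite nuA nuE muleA -EFinM mulVf ?gt_eqF// mul1e.
apply: (@lebesgue_measure_unique _ nu) => // _ [[x y] _ <-] /=; rewrite nuE.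
rewrite (_ : _ @^-1` _ = `](x - a) / s, (y - a) / s]%classic); last first.
    apply/seteqP; split => t /=; rewrite !in_itv/= ltr_pdivrMr// ler_pdivlMr//;
    by rewrite ltrBlDr lerBrDr (mulrC t).
  rewrite !lebesgue_measure_itv/= !lte_fin ltr_pM2r ?invr_gt0// ltrD2r.
  case: ifPn => _; last by rewrite mule0.
  rewrite -!EFinB -EFinM -mulrBl opprB addrA subrK mulrC divfK ?gt_eqF//.
Qed.

Lemma ge0_integral_affineR (s a : R) (f : measurableTypeR R -> \bar R) : 0 < s ->
  measurable_fun setT f -> (forall x, 0 <= f x)%E ->
  (\int[lebesgue_measure]_t f (s * t + a)%R = s^-1%:E * \int[lebesgue_measure]_t f t)%E.
Proof.
move=> s0 mf f0.
have mphi : measurable_fun setT (fun t : measurableTypeR R => s * t + a : measurableTypeR R).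
  by apply: measurable_funD => //; exact: measurable_funM.
have k0 : 0 <= s^-1 by rewrite invr_ge0 ltW.
rewrite -(@ge0_integral_mscale _ _ _ lebesgue_measure _ measurableT (NngNum k0))//.
transitivity (\int[pushforward lebesgue_measure (fun t : measurableTypeR R => (s * t + a)%R : measurableTypeR R)]_t f t)%E.
  by rewrite (ge0_integral_pushforward mphi)//.
by apply: eq_measure_integral => A mA _; exact: lebesgue_affine.
Qed.

Lemma consV_affine k (s t : R) (y : 'rV[R]_k) (a : 'rV[R]_k.+1) :
  s *: consV (t, y) + a =
  consV (s * t + a ord0 ord0, s *: y + \row_i a ord0 (lift ord0 i)).
Proof.
apply/rowP => i; have [j ->|->] := unliftP ord0 i.
  by rewrite consVS mxE [X in X + _]mxE consVS !mxE.
by rewrite consV0 mxE [X in X + _]mxE consV0.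
Qed.

Lemma measurable_affineV k (s : R) (a : 'rV[R]_k) :
  measurable_fun setT (fun x : 'rV[R]_k => s *: x + a).
Proof.
apply: measurable_fun_rV => i.
under eq_fun do rewrite !mxE.
by apply: measurable_funD => //; apply: measurable_funM => //; exact: coord_measurable.
Qed.

(** Tonelli reduces this to the line, each coordinate contributing one factor 1/s. *)
Lemma ge0_integral_affineV k (s : R) (a : 'rV[R]_k) (f : 'rV[R]_k -> \bar R) : 0 < s ->
  measurable_fun setT f -> (forall x, 0 <= f x)%E ->
  (\int[muV k]_t f (s *: t + a)%R = (s ^- k)%:E * \int[muV k]_t f t)%E.
Proof.
move=> s0; elim: k a f => [|k IH] a f mf f0.
  rewrite !integral_dirac// ?diracE ?in_setT ?mul1e.
    by rewrite expr0 invr1 mul1e; congr f; apply/rowP => -[].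
  exact: measurableT_comp mf (measurable_affineV _ _).
rewrite /= !integral_cons_measure//; last first.
  exact: measurableT_comp mf (measurable_affineV _ _).
under eq_integral => t _ do (under eq_integral => y _ do rewrite consV_affine).
have mff t : measurable_fun setT (fun y => f (consV (t, y))).
  exact: measurableT_comp mf (consV2_measurable t).
under eq_integral => t _ do rewrite (IH _ (fun y => f (consV (_, y))))//.
have mF : measurable_fun setT (fun t : measurableTypeR R => \int[muV k]_y f (consV (t, y)))%E.
  apply: (measurable_fun_fubini_tonelli_F (m2 := muV k) (f \o @consV k)).
    exact: measurableT_comp mf (@consV_measurable k).
  by move=> x; exact: f0.
have F0 t : (0 <= \int[muV k]_y f (consV (t, y)))%E by apply: integral_ge0.
rewrite ge0_integralZl//; last 2 first.
- have ma : measurable_fun setT (fun t : measurableTypeR R => s * t + a ord0 ord0 : measurableTypeR R).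
    by apply: measurable_funD => //; exact: measurable_funM.
  exact: (measurableT_comp mF ma).
- by rewrite lee_fin invr_ge0 exprn_ge0// ltW.
rewrite (@ge0_integral_affineR s _ (fun t => \int[muV k]_y f (consV (t, y)))%E)//.
by rewrite muleA -EFinM -invfM -exprSr.
Qed.

End MuRV.

(** * Euclidean balls *)

Section Enorm.
Variables (R : realType) (n : nat).
Local Notation V := 'rV[R]_n.
Implicit Types x y : V.

Lemma enorm_ge0 x : 0 <= enorm x.
Proof. exact: sqrtr_ge0. Qed.

Lemma sqr_enorm x : enorm x ^+ 2 = \sum_(i < n) x ord0 i ^+ 2.
Proof. by rewrite sqr_sqrtr// sumr_ge0// => i _; rewrite sqr_ge0. Qed.

Lemma enormZ (t : R) x : enorm (t *: x) = `|t| * enorm x.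
Proof.
rewrite /enorm -sqrtr_sqr -sqrtrM ?sqr_ge0// mulr_sumr.
by congr Num.sqrt; apply: eq_bigr => i _; rewrite mxE exprMn.
Qed.

Lemma enorm0 : enorm (0 : V) = 0.
Proof. by rewrite -(scale0r (0 : V)) enormZ normr0 mul0r. Qed.

Lemma enormN x : enorm (- x) = enorm x.
Proof. by rewrite -scaleN1r enormZ normrN1 mul1r. Qed.

Lemma enormB x y : enorm (x - y) = enorm (y - x).
Proof. by rewrite -enormN opprB. Qed.

Lemma coord_le_enorm x i : `|x ord0 i| <= enorm x.
Proof.
rewrite /enorm -sqrtr_sqr ler_wsqrtr// (bigD1 i)//= lerDl sumr_ge0// => j _.
exact: sqr_ge0.
Qed.

Lemma coord_le_norm x i : `|x ord0 i| <= `|x|.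
Proof.
rewrite [leRHS]/Num.Def.normr/= mx_normrE; apply/bigmax_geP; right => /=.
by exists (ord0, i).
Qed.

Lemma norm_le_coord x (e : R) : 0 <= e -> (forall i, `|x ord0 i| <= e) -> `|x| <= e.
Proof.
move=> e0 h; rewrite [leLHS]/Num.Def.normr/= mx_normrE; apply/bigmax_leP; split => //=.
by move=> [i j] _; rewrite /= ord1.
Qed.

Lemma norm_le_enorm x : `|x| <= enorm x.
Proof. by apply: norm_le_coord; [exact: enorm_ge0|exact: coord_le_enorm]. Qed.

Lemma enorm_eq0 x : (enorm x == 0) = (x == 0).
Proof.
apply/idP/idP => [/eqP x0|/eqP ->]; last by rewrite enorm0.
by rewrite -normr_eq0 eq_le normr_ge0 andbT -x0 norm_le_enorm.
Qed.

Lemma enorm_gt0 x : (0 < enorm x) = (x != 0).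
Proof. by rewrite lt0r enorm_ge0 andbT enorm_eq0. Qed.

Lemma enorm_le_norm x : enorm x <= n%:R * `|x|.
Proof.
have h : 0 <= n%:R * `|x| by rewrite mulr_ge0.
rewrite -(ger0_norm h) -sqrtr_sqr ler_wsqrtr// exprMn.
apply: (@le_trans _ _ (\sum_(i < n) `|x| ^+ 2)).
  apply: ler_sum => i _; rewrite -real_normK ?num_real// lerXn2r ?nnegrE//.
  exact: coord_le_norm.
rewrite sumr_const card_ord -[leLHS]mulr_natl ler_wpM2r ?sqr_ge0//.
by rewrite -natrX ler_nat; case: (n) => // m; rewrite expnS expn1 leq_pmulr.
Qed.

(** Cauchy-Schwarz from a weighted arithmetic-geometric inequality in each coordinate; the weights
    |y|/|x| and |x|/|y| make the bounds add up to |x||y|. *)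
Lemma enorm_dot x y : \sum_(i < n) x ord0 i * y ord0 i <= enorm x * enorm y.
Proof.
have [->|x0] := eqVneq x 0.
  by rewrite enorm0 mul0r big1// => i _; rewrite mxE mul0r.
have [->|y0] := eqVneq y 0.
  by rewrite enorm0 mulr0 big1// => i _; rewrite mxE mulr0.
rewrite -enorm_gt0 in x0; rewrite -enorm_gt0 in y0.
set a := enorm x in x0 *; set b := enorm y in y0 *.
have -> : a * b = (b / a * a ^+ 2 + a / b * b ^+ 2) / 2.
  by field; rewrite !gt_eqF.
rewrite !sqr_enorm !mulr_sumr -big_split/= mulr_suml; apply: ler_sum => i _.
rewrite -subr_ge0.
have -> : (b / a * x ord0 i ^+ 2 + a / b * y ord0 i ^+ 2) / 2 - x ord0 i * y ord0 i =
   (b * x ord0 i - a * y ord0 i) ^+ 2 / (2 * a * b).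
  by field; rewrite !gt_eqF.
by rewrite divr_ge0 ?sqr_ge0// !mulr_ge0// ltW.
Qed.

Lemma enormD x y : enorm (x + y) <= enorm x + enorm y.
Proof.
rewrite -(@ler_pXn2r _ 2)// ?nnegrE ?addr_ge0 ?enorm_ge0//.
rewrite sqrrD !sqr_enorm.
have h : (\sum_(i < n) x ord0 i * y ord0 i) * 2 <= enorm x * enorm y * 2.
  by rewrite ler_wpM2r// enorm_dot.
apply: (@le_trans _ _ (\sum_(i < n) x ord0 i ^+ 2 +
  (\sum_(i < n) x ord0 i * y ord0 i) * 2 + \sum_(i < n) y ord0 i ^+ 2)).
  rewrite mulr_suml -!big_split/=; apply: ler_sum => i _; rewrite mxE.
  by rewrite le_eqVlt; apply/orP; left; apply/eqP; ring.
by rewrite lerD2r lerD2l -[leRHS]mulr_natr.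
Qed.

Lemma enorm_tri x y z : enorm (x - z) <= enorm (x - y) + enorm (y - z).
Proof. by rewrite (le_trans _ (enormD _ _))// addrA subrK. Qed.

Lemma ler_dist_enorm x y : `|enorm x - enorm y| <= enorm (x - y).
Proof.
rewrite ler_norml.
have := enormD (x - y) y; have := enormD (y - x) x; rewrite !subrK (enormB y).
by move=> h1 h2; apply/andP; split; lra.
Qed.

Lemma nbhs_eball x (A : set V) : nbhs x A <-> exists2 r : R, 0 < r & eball x r `<=` A.
Proof.
split => [/nbhs_ballP[r /= r0 xrA]|[r r0 xrA]].
  exists r => // y yr; apply: xrA.
  rewrite mx_norm_ball /ball_ /= distrC; exact: le_lt_trans (norm_le_enorm _) yr.
(* Neighbourhoods are those of the sup norm, and the Euclidean norm is at most n times it; n+1 keeps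
   the divisor nonzero in dimension 0. *)
apply/nbhs_ballP; exists (n.+1%:R^-1 * r) => /= [|y].
  by rewrite mulr_gt0// invr_gt0.
rewrite mx_norm_ball /ball_/= distrC => xy; apply: xrA.
apply: (le_lt_trans (enorm_le_norm _)).
apply: (@le_lt_trans _ _ (n.+1%:R * `|y - x|)); first by rewrite ler_wpM2r// ler_nat.
by rewrite -ltr_pdivlMl.
Qed.

Lemma continuousVP (f : V -> R) x : {for x, continuous f} <->
  forall e : R, 0 < e -> exists2 d : R, 0 < d & forall y, enorm (y - x) < d -> `|f x - f y| < e.
Proof.
apply: (iff_trans (@cvgrPdist_lt R R V (nbhs x) (nbhs_filter x) f (f x))).
by split => h e e0; [apply/(nbhs_eball x)|apply/(nbhs_eball x)]; exact: h.
Qed.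

Lemma continuous_enormB c : continuous (fun x : V => enorm (x - c)).
Proof.
move=> x; apply/continuousVP => e e0; exists e => // y yx.
apply: (le_lt_trans (ler_dist_enorm _ _)).
by rewrite opprB addrA subrK enormB.
Qed.

Lemma open_eball c (r : R) : open (@eball R n c r).
Proof.
have -> : eball c r = (fun x => enorm (x - c)) @^-1` [set t | t < r] by [].
by apply: open_comp; [move=> x _; exact: continuous_enormB|exact: open_lt].
Qed.

Definition ceball (c : V) (r : R) : set V := [set x | enorm (x - c) <= r].

Lemma closed_ceball c (r : R) : closed (ceball c r).
Proof.
have -> : ceball c r = (fun x => enorm (x - c)) @^-1` [set t | t <= r] by [].
by apply: closed_comp; [move=> x _; exact: continuous_enormB|exact: closed_le].
Qed.

Lemma compact_ceball c (r : R) : compact (ceball c r).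
Proof.
apply: bounded_closed_compact; last exact: closed_ceball.
exists (r + enorm c); split; first exact: num_real.
move=> M rM x; rewrite /ceball /= => xr; apply: (le_trans (norm_le_enorm _)).
by apply: (le_trans _ (ltW rM)); have := enormD (x - c) c; rewrite subrK; lra.
Qed.

Lemma eball_nbhs x (r : R) : 0 < r -> nbhs x (eball x r).
Proof.
by move=> r0; apply: open_nbhs_nbhs; split; [exact: open_eball|rewrite /eball/= subrr enorm0].
Qed.

Lemma measurable_eball c (r : R) : measurable (@eball R n c r).
Proof. by apply: open_measurableV; exact: open_eball. Qed.

Lemma measurable_ceball c (r : R) : measurable (ceball c r).
Proof. by apply: closed_measurableV; exact: closed_ceball. Qed.

End Enorm.

(** * Volumes of balls and spheres *)

Section Volume.
Variable R : realType.

(** Cubes are products, so their measure follows the recursion of [muV]; through them balls are seen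
    to have finite measure. *)
Definition cube k (m : nat) : set 'rV[R]_k := [set x | forall i, - m%:R <= x ord0 i <= m%:R].

Lemma measurable_cube k m : measurable (@cube k m).
Proof.
rewrite (_ : cube _ = \big[setI/setT]_(i < k)
   ((fun x : 'rV[R]_k => x ord0 i) @^-1` `[- m%:R, m%:R])).
  apply: bigsetI_measurable => i _.
  by rewrite -[X in measurable X]setTI; exact: coord_measurable.
rewrite -bigcap_seq; apply/seteqP; split => t /=.
  by move=> ht i _; rewrite /= in_itv; exact: ht.
by move=> ht i; have := ht i; rewrite /= mem_index_enum in_itv; exact.
Qed.

Lemma muV_cube k m : (muV R k (@cube k m) < +oo)%E.
Proof.
elim: k => [|k IH] /=.
  by rewrite diracE; case: (_ \in _); rewrite ltry.
rewrite /cons_measure /pushforward.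
rewrite (_ : _ @^-1` _ = `[- m%:R, m%:R] `*` @cube k m); last first.
  apply/seteqP; split => -[t y]; rewrite /cube /=.
    move=> h; split; first by have := h ord0; rewrite consV0 in_itv.
    by move=> i; have := h (lift ord0 i); rewrite consVS.
  move=> [h1 h2] i; have [j ->|->] := unliftP ord0 i; first by rewrite consVS; exact: h2.
  by rewrite consV0; move: h1; rewrite in_itv.
rewrite product_measure1E//; last exact: measurable_cube.
have lf : (lebesgue_measure (`[(- m%:R)%R, m%:R%R]%classic : set R) < +oo)%E.
  by rewrite lebesgue_measure_itv/=; case: ifP => // _; rewrite -EFinB ltry.
by rewrite lte_mul_pinfty// ge0_fin_numE.
Qed.

Lemma eball_sub_cube k (r : R) c : exists m, @ceball R k c r `<=` @cube k m.
Proof.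
exists (Num.truncn (r + enorm c)).+1 => x xr i; rewrite -ler_norml.
apply: (le_trans (coord_le_enorm _ _)).
apply: (@le_trans _ _ (r + enorm c)); last by apply/ltW; exact: truncnS_gt.
by have := enormD (x - c) c; rewrite subrK; move: xr; rewrite /ceball/=; lra.
Qed.

Lemma muV_ceball_fin k (c : 'rV[R]_k) r : (muV R k (ceball c r) < +oo)%E.
Proof.
have [m hm] := eball_sub_cube r c.
apply: le_lt_trans (muV_cube k m); apply: le_measure => //; rewrite inE.
  exact: measurable_ceball.
exact: measurable_cube.
Qed.

Lemma muV_affine k (s : R) (a : 'rV[R]_k) (A : set 'rV[R]_k) : 0 < s -> measurable A ->
  muV R k ((fun x => s *: x + a) @^-1` A) = ((s ^- k)%:E * muV R k A)%E.
Proof.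
move=> s0 mA.
have mI : measurable_fun setT (fun x : 'rV[R]_k => (\1_A x)%:E : \bar R).
  by apply/measurable_EFinP; exact: measurable_indic.
have I0 x : (0 <= (\1_A x)%:E :> \bar R)%E by rewrite lee_fin.
have := ge0_integral_affineV a s0 mI I0.
rewrite [X in (_ * X)%E](_ : _ = muV R k A); last first.
  by rewrite (integral_indic (muV R k) measurableT mA) setIT.
move=> <-.
have mA' : measurable ((fun x : 'rV[R]_k => s *: x + a) @^-1` A).
  by rewrite -[X in measurable X]setTI; exact: measurable_affineV.
by have := integral_indic (muV R k) measurableT mA'; rewrite setIT.
Qed.

Lemma muV_eball_scale k (c : 'rV[R]_k) r : 0 < r ->
  muV R k (eball c r) = ((r ^+ k)%:E * muV R k (eball 0 1))%E.
Proof.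
move=> r0.
have -> : eball 0 1 = (fun x : 'rV[R]_k => r *: x + c) @^-1` eball c r.
  apply/seteqP; split => x; rewrite /eball /= subr0 addrK enormZ gtr0_norm//;
  by rewrite gtr_pMr.
rewrite muV_affine//; last exact: measurable_eball.
by rewrite muleA -EFinM mulfV ?mul1e// expf_neq0// gt_eqF.
Qed.

Lemma muV_ceball_scale k (c : 'rV[R]_k) r : 0 < r ->
  muV R k (ceball c r) = ((r ^+ k)%:E * muV R k (ceball 0 1))%E.
Proof.
move=> r0.
have -> : ceball 0 1 = (fun x : 'rV[R]_k => r *: x + c) @^-1` ceball c r.
  apply/seteqP; split => x; rewrite /ceball /= subr0 addrK enormZ gtr0_norm//;
  by rewrite ger_pMr.
rewrite muV_affine//; last exact: measurable_ceball.
by rewrite muleA -EFinM mulfV ?mul1e// expf_neq0// gt_eqF.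
Qed.

Definition uvol k : R := fine (muV R k (ceball 0 1)).

Lemma uvol_ge0 k : 0 <= uvol k.
Proof. exact: fine_ge0. Qed.

Lemma muV_ceball k (c : 'rV[R]_k) r : 0 < r -> muV R k (ceball c r) = (r ^+ k * uvol k)%:E.
Proof.
by move=> r0; rewrite muV_ceball_scale// EFinM /uvol fineK// ge0_fin_numE// muV_ceball_fin.
Qed.

(* The open unit ball contains all smaller closed balls, so both unit balls have the same volume. *)
Lemma muV_eball k (c : 'rV[R]_k) r : 0 < r -> muV R k (eball c r) = (r ^+ k * uvol k)%:E.
Proof.
move=> r0; rewrite muV_eball_scale// EFinM; congr (_ * _)%E.
have le1 : (muV R k (eball 0 1) <= (uvol k)%:E)%E.
  have <- : muV R k (ceball 0 1) = (uvol k)%:E by rewrite muV_ceball// expr1n mul1r.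
  apply: le_measure => //; rewrite ?inE; [exact: measurable_eball|exact: measurable_ceball|].
  by move=> x; exact: ltW.
apply/eqP; rewrite eq_le le1/=.
have fin1 : muV R k (eball 0 1) \is a fin_num.
  by rewrite ge0_fin_numE//; apply: (le_lt_trans le1); rewrite ltry.
rewrite -(fineK fin1) lee_fin.
have h (m : nat) : (1 - m.+2%:R^-1) ^+ k * uvol k <= fine (muV R k (eball 0 1)).
  have m0 : 0 < 1 - m.+2%:R^-1 :> R by rewrite subr_gt0 invf_lt1// ltr1n.
  rewrite -lee_fin fineK// -(muV_ceball 0 m0).
  apply: le_measure => //; rewrite ?inE; [exact: measurable_ceball|exact: measurable_eball|].
  move=> x; rewrite /eball/ceball/= => /le_lt_trans; apply.
  by rewrite ltrBlDr ltrDl invr_gt0.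
have lim1 : (1 - m.+2%:R^-1) ^+ k * uvol k @[m --> \oo] --> (1 - 0) ^+ k * uvol k.
  apply: cvgM; last exact: cvg_cst.
  apply: (@cvg_comp _ _ _ (fun m : nat => 1 - m.+2%:R^-1 : R) (@GRing.exp R ^~ k));
    last exact: exprn_continuous.
  apply: cvgB; first exact: cvg_cst.
  have := @cvg_harmonic R; rewrite -(cvg_shiftn 1).
  by under eq_fun do rewrite /harmonic/= addn1.
rewrite subr0 expr1n mul1r in lim1.
rewrite -(cvg_lim _ lim1)//; apply: limr_le; first by apply/cvg_ex; exists (uvol k).
by apply: nearW.
Qed.

(** The open and the closed ball have the same finite volume. *)
Lemma muV_sphere k (c : 'rV[R]_k) r : 0 < r ->
  muV R k [set x | enorm (x - c) = r] = 0.
Proof.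
move=> r0.
have mS : measurable [set x : 'rV[R]_k | enorm (x - c) = r].
  rewrite (_ : [set _ | _] = ceball c r `\` eball c r).
    by apply: measurableD; [exact: measurable_ceball|exact: measurable_eball].
  apply/seteqP; split => x; rewrite /ceball/eball/=.
    by move=> ->; rewrite lexx ltxx.
  by move=> [h1 /negP]; rewrite -leNgt => h2; apply/eqP; rewrite eq_le h1.
have : muV R k (ceball c r) = (muV R k (eball c r) + muV R k [set x | enorm (x - c) = r])%E.
  rewrite -measureU//; first last.
  - by apply/seteqP; split => // x; rewrite /eball/= => -[/[swap] ->]; rewrite ltxx.
  - exact: measurable_eball.
  congr (muV R k _); apply/seteqP; split => x; rewrite /ceball/eball/=.
    by rewrite le_eqVlt => /orP[/eqP|]; [right|left].
  by move=> [/ltW|->].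
rewrite muV_ceball// muV_eball//; case: (muV R k _) => [y| |]//.
by rewrite -EFinD => -[] /eqP; rewrite addrC -subr_eq subrr => /eqP <-.
Qed.

End Volume.

(** * A substitute for integration in polar coordinates *)

Section Radial.
Variable R : realType.
Local Notation leb := (@lebesgue_measure R).

Lemma measurable_enormB k (c : 'rV[R]_k) : measurable_fun setT (fun x : 'rV[R]_k => enorm (x - c)).
Proof.
by apply: continuous_measurableV; [exact: openT|move=> x _; exact: continuous_enormB].
Qed.

(* Averaging [f x] over radii between |x - c| and 2|x - c| and exchanging the integrals
   replaces polar coordinates. *)
Lemma radial_bound k (c : 'rV[R]_k) (d : R) (f : 'rV[R]_k -> \bar R) (w : measurableTypeR R -> \bar R) :
  0 < d -> measurable_fun (eball c d) f -> (forall x, 0 <= f x)%E -> f c = 0%E ->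
  measurable_fun (`]0, 2 * d[%classic : set (measurableTypeR R)) w -> (forall s : R, 0 < s < 2 * d -> (0 <= w s)%E) ->
  (forall x (s : R), 0 < enorm (x - c) < d -> enorm (x - c) < s < 2 * enorm (x - c) ->
     (f x <= w s * (enorm (x - c) ^- k)%:E)%E) ->
  (\int[muV R k]_(x in eball c d) f x <=
   (2 ^+ k.+1 * uvol R k)%:E * \int[leb]_(s in `]0%R, (2 * d)%R[%classic) (w s * (s^-1)%:E))%E.
Proof.
move=> d0 mf f0 fc mw w0 hf.
pose D : set (measurableTypeR R) := `]0%R, (2 * d)%R[%classic.
have mD : measurable D by exact: measurable_itv.
have DE s : D s <-> 0 < s < 2 * d by rewrite /D/= in_itv.
(* For s < 2|x-c| one has |x-c|^(-k-1) <= 2^(k+1) s^(-k-1): this removes x from the bound and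
   produces the power of 2. *)
pose g : measurableTypeR R -> \bar R := (fun s => w s * (2 ^+ k.+1 * s ^- k.+1)%:E)%E \_ D.
have g0 s : (0 <= g s)%E.
  rewrite /g patchE; case: ifPn => // /set_mem/DE sD.
  have s0 : 0 < s by case/andP: sD.
  by rewrite mule_ge0// ?w0// lee_fin mulr_ge0// invr_ge0 exprn_ge0// ltW.
have minv m : measurable_fun D (fun s : measurableTypeR R => s ^- m).
  apply: (@measurable_funS _ _ _ _ [set~ (0 : measurableTypeR R)]).
  - by apply: measurableC; exact: measurable_set1.
  - by move=> s /DE/andP[s0 _] /= s00; rewrite s00 ltxx in s0.
  apply: open_continuous_measurable_fun.
    by rewrite openC; exact: closed_eq.
  move=> s; rewrite inE/= => /eqP s0; apply: (@continuousV _ _ (fun s : R => s ^+ m)).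
    by rewrite expf_neq0.
  exact: exprn_continuous.
have mg : measurable_fun setT g.
  apply/(measurable_restrictT _ mD); apply: emeasurable_funM => //.
  by apply/measurable_EFinP; exact: measurable_funM.
pose b (p : 'rV[R]_k * measurableTypeR R) : bool :=
  [&& enorm (p.1 - c) < p.2, p.2 < 2 * enorm (p.1 - c) & enorm (p.1 - c) < d].
pose E : set ('rV[R]_k * measurableTypeR R) := b @^-1` [set true].
have mE : measurable E.
  rewrite -[E]setTI.
  have m1 : measurable_fun setT (fun p : 'rV[R]_k * measurableTypeR R => enorm (p.1 - c)).
    exact: (measurableT_comp (measurable_enormB c) measurable_fst).
  suff : measurable_fun setT b by move=> /(_ measurableT [set true]); apply.
  apply: measurable_and; first by apply: measurable_fun_ltr => //; exact: measurable_snd.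
  apply: measurable_and; last exact: measurable_fun_ltr.
  apply: measurable_fun_ltr; first exact: measurable_snd.
  exact: measurable_funM.
pose h p : \bar R := ((\1_E p)%:E * g p.2)%E.
have h0 p : (0 <= h p)%E by rewrite mule_ge0// lee_fin.
have mh : measurable_fun setT h.
  apply: emeasurable_funM; first by apply/measurable_EFinP; exact: measurable_indic.
  exact: measurableT_comp mg measurable_snd.
have fh x : eball c d x -> (f x <= \int[leb]_s h (x, s))%E.
  move=> xd.
  have [->|xc] := eqVneq x c; first by rewrite fc integral_ge0.
  have r0 : 0 < enorm (x - c) by rewrite enorm_gt0 subr_eq0.
  set r := enorm (x - c) in r0 *.
  have rd : r < d by exact: xd.
  (* The interval of radii has length r, so dividing by r makes this an average. *)
  have -> : (f x = \int[leb]_(s in `]r, (2 * r)%R[%classic) (f x * (r^-1)%:E))%E.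
    rewrite integral_cst//= lebesgue_measure_itv/= lte_fin ltr_pMl// ltr1n.
    rewrite -EFinB -muleA -EFinM.
    have -> : r^-1 * (2 * r - r) = 1 by field; rewrite gt_eqF.
    by rewrite mule1.
  rewrite integral_mkcond; apply: ge0_le_integral => //.
  - move=> s _; rewrite patchE; case: ifPn => // _.
    by rewrite mule_ge0// lee_fin invr_ge0 ltW.
  - have mr : measurable (`]r, (2 * r)%R[%classic : set (measurableTypeR R)) by exact: measurable_itv.
    by apply/(measurable_restrictT _ mr); exact: measurable_cst.
  - exact: measurableT_comp mh (pair1_measurable x).
  move=> s _; rewrite patchE; case: ifPn => [|_]; last exact: h0.
  rewrite inE/= in_itv/= => /andP[rs s2r].
  have s0 : 0 < s by exact: lt_trans rs.
  have sD : 0 < s < 2 * d by rewrite s0/= (lt_trans s2r)// ltr_pM2l.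
  rewrite /h indicE mem_set; last by rewrite /E/= /b/= rs s2r.
  rewrite mul1e /g patchE mem_set; last exact/DE.
  apply: (@le_trans _ _ (w s * (r ^- k)%:E * (r^-1)%:E)%E).
    rewrite lee_wpmul2r// ?lee_fin ?invr_ge0 ?(ltW r0)//.
    by apply: hf; [rewrite r0|rewrite rs].
  rewrite -muleA -EFinM lee_wpmul2l ?w0// lee_fin.
  rewrite -invfM -exprSr -lef_pV2 ?posrE ?mulr_gt0 ?invr_gt0 ?exprn_gt0//.
  rewrite invfM !invrK -exprVn -exprMn lerXn2r ?nnegrE ?ltW//.
    by rewrite mulr_gt0// invr_gt0.
  by rewrite mulrC ltr_pdivrMr// mulrC.
apply: (@le_trans _ _ (\int[muV R k]_x \int[leb]_s h (x, s))%E).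
  rewrite integral_mkcond; apply: ge0_le_integral => //.
  - by move=> x _; rewrite patchE; case: ifP.
  - by apply/(measurable_restrictT _ (measurable_eball _ _)).
  - exact: (measurable_fun_fubini_tonelli_F (m2 := leb) h).
  move=> x _; rewrite patchE; case: ifPn => [/set_mem|_]; first exact: fh.
  exact: integral_ge0.
rewrite (fubini_tonelli (m1 := muV R k) (m2 := leb) h)//.
pose q : measurableTypeR R -> \bar R := (fun s => w s * (s^-1)%:E)%E \_ D.
have q0 s : (0 <= q s)%E.
  rewrite /q patchE; case: ifPn => // /set_mem/DE sD.
  by rewrite mule_ge0// ?w0// lee_fin invr_ge0; case/andP: sD => /ltW.
have mq : measurable_fun setT q.
  apply/(measurable_restrictT _ mD); apply: emeasurable_funM => //.
  apply/measurable_EFinP.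
  by have := minv 1; under eq_fun do rewrite expr1.
apply: (@le_trans _ _ (\int[leb]_s ((2 ^+ k.+1 * uvol R k)%:E * q s)))%E; last first.
  rewrite ge0_integralZl//.
  - by rewrite /q -integral_mkcond.
  - by rewrite lee_fin mulr_ge0// uvol_ge0.
apply: ge0_le_integral => //.
- by move=> s _; apply: integral_ge0.
- exact: (measurable_fun_fubini_tonelli_G (m1 := muV R k) h).
- exact: measurable_funeM.
move=> s _.
have mEs : measurable (ysection E s) by exact: measurable_ysection.
have mE1 : measurable_fun setT (fun x : 'rV[R]_k => (\1_E (x, s))%:E : \bar R).
  apply/measurable_EFinP.
  have mI : measurable_fun setT (\1_E : _ -> R) by exact: measurable_indic.
  exact: (measurableT_comp mI (pair2_measurable s)).
rewrite /h/= ge0_integralZr//.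
rewrite /g /q !patchE; case: ifPn => [/set_mem/DE sD|_]; last by rewrite !mule0.
have s0 : 0 < s by case/andP: sD.
(* For fixed s the admissible x lie in the ball of radius s; its volume cancels all but one of the
   k+1 powers of 1/s. *)
have le1 : (\int[muV R k]_x (\1_E (x, s))%:E <= (s ^+ k * uvol R k)%:E)%E.
  rewrite -(muV_eball c s0) -[eball c s](setIT _) -integral_indic//; last exact: measurable_eball.
  apply: ge0_le_integral => //.
    by apply/measurable_EFinP; apply: measurable_indic; exact: measurable_eball.
  move=> x _; rewrite lee_fin !indicE ler_nat.
  case: (boolP ((x, s) \in E)) => // /set_mem; rewrite /E/= => /and3P[xs _ _].
  by rewrite mem_set.
apply: (@le_trans _ _ ((s ^+ k * uvol R k)%:E * (w s * (2 ^+ k.+1 * s ^- k.+1)%:E))%E).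
  apply: lee_wpmul2r => //.
  by rewrite mule_ge0// ?w0// lee_fin mulr_ge0// invr_ge0 exprn_ge0// ltW.
rewrite muleCA -!EFinM [leRHS]muleCA -EFinM lee_wpmul2l ?w0// lee_fin.
rewrite exprS le_eqVlt; apply/orP; left; apply/eqP; rewrite !exprS; field.
by rewrite gt_eqF// expf_neq0// gt_eqF.
Qed.

End Radial.

(** * Uniform continuity over compact parameters, and derivatives along lines *)

Section CalculusHelpers.
Variable R : realType.

(* Tube lemma: continuity is uniform over a compact parameter set. *)
Lemma compact_unif_continuous (T X : topologicalType) (K : set X) (g : T * X -> R) (t0 : T) :
  compact K -> (forall x, K x -> {for (t0, x), continuous g}) ->
  forall e, 0 < e -> \forall t \near t0, forall x, K x -> `|g (t0, x) - g (t, x)| < e.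
Proof.
move=> /compact_near_coveringP cK cg e e0.
apply: (cK T (nbhs t0) (fun t x => `|g (t0, x) - g (t, x)| < e)) => x Kx.
have e20 : 0 < e / 2 by rewrite divr_gt0.
have [[A B] /= [nA nB] AB] := (cvgrPdist_lt _ _).1 (cg x Kx) (e / 2) e20.
exists (B, A); first by [].
move=> [x' t] /= [Bx' At].
have h1 := AB (t, x') (conj At Bx').
have h2 := AB (t0, x') (conj (nbhs_singleton nA) Bx').
rewrite /= in h1 h2; rewrite distrC in h2.
by rewrite (splitr e) (le_lt_trans (ler_distD (g (t0, x)) _ _))// ltrD.
Qed.

(** Turns directional derivatives into derivatives of functions of one real variable, to which the
    chain rule, the mean value theorem and differentiation under the integral apply. *)
Lemma is_derive_line n (f : 'rV[R]_n -> R) (x v : 'rV[R]_n) (l : R) :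
  is_derive x v f l <-> is_derive (0 : R) 1 (fun h => f (x + h *: v)) l.
Proof.
have E : (fun h => h^-1 *: ((f \o shift x) (h *: v) - f x)) =
   (fun h => h^-1 *: (((fun h => f (x + h *: v)) \o shift 0) (h *: (1 : R)) - f (x + 0 *: v))).
  apply/funext => h /=; rewrite [h%:A]mulr1 scale0r !addr0.
  by rewrite (addrC (h *: v)).
split => -[d1 d2]; split.
- by rewrite /derivable -E.
- by rewrite -d2 /derive -E.
- by rewrite /derivable E.
- by rewrite -d2 /derive E.
Qed.

Lemma is_derive_line_at n (f : 'rV[R]_n -> R) (x v : 'rV[R]_n) (t l : R) :
  is_derive (x + t *: v) v f l -> is_derive t 1 (fun h => f (x + h *: v)) l.
Proof.
move=> /is_derive_line h.
have -> : (fun h => f (x + h *: v)) = (fun h => f (x + t *: v + h *: v)) \o (fun h => h - t).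
  by apply/funext => s /=; rewrite -addrA -scalerDl addrCA subrr addr0.
rewrite -[l]mulr1; apply: is_derive1_comp.
  by rewrite subrr.
by apply: is_derive_eq; rewrite subr0.
Qed.

Lemma is_derive_mulr (c t : R) : is_derive t 1 (fun h => h * c) c.
Proof.
have -> : (fun h => h * c) = c \*: id by apply/funext => h; rewrite mulrC.
by apply: is_derive_eq; rewrite [_%:A]mulr1.
Qed.

Lemma continuous_enorm n : continuous (@enorm R n).
Proof.
rewrite (_ : @enorm R n = (fun x => enorm (x - 0))); first exact: continuous_enormB.
by apply/funext => x; rewrite subr0.
Qed.

Lemma enorm_evec n (j : 'I_n) : enorm (evec R j) = 1.
Proof.
rewrite /enorm (bigD1 j)//= big1 ?addr0; last first.
  by move=> i ij; rewrite mxE eqxx (negbTE ij) expr0n.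
by rewrite mxE !eqxx expr1n sqrtr1.
Qed.

End CalculusHelpers.

(** * The kernel and its derivatives *)

Section Kernel.
Variables (R : realType) (n : nat).
Local Notation V := 'rV[R]_n.
Local Notation leb := (@lebesgue_measure R).
Implicit Types (phi : V -> R) (x y : V).

(** The exponent [m] is free because differentiating phi(y + a(x-y)) in x brings out a factor a;
    [Nker psi i] is x_i - y_i times [Akern psi n.-1]. *)
Definition Akern phi (m : nat) x y : R :=
  \int[leb]_(a in `[1, +oo[%classic) (phi (y + a *: (x - y)) * a ^+ m).

Lemma continuous_supp_bounded phi : continuous phi ->
  (forall x, 1 <= enorm x -> phi x = 0) -> exists2 L : R, 0 <= L & forall x, `|phi x| <= L.
Proof.
move=> cphi sphi.
have [|||z _ hz] := @EVT_max_rV R n (fun x => `|phi x|) (ceball 0 1).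
- by exists 0; rewrite /ceball/= subrr enorm0.
- exact: compact_ceball.
- apply: continuous_subspaceT => x.
  by apply: continuous_comp; [exact: cphi|exact: norm_continuous].
exists `|phi z| => // x.
have [x1|/ltW/sphi ->] := leP (enorm x) 1; last by rewrite normr0.
by apply: hz; rewrite /ceball inE/= subr0.
Qed.

Lemma leb_itv1 (L : R) : fine (leb `[1, L]%classic) <= Num.max L 0.
Proof.
rewrite lebesgue_measure_itv/= lte_fin; case: ifPn => [L1|_] /=.
  by rewrite le_max lerBlDr lerDl ler01.
by rewrite le_max lexx orbT.
Qed.

Lemma continuous_ray phi m x y : continuous phi ->
  continuous (fun a : R => phi (y + a *: (x - y)) * a ^+ m).
Proof.
move=> cphi a; apply: cvgM; last exact: exprn_continuous.
apply: (@continuous_comp _ _ _ (fun a : R => y + a *: (x - y)) phi); last exact: cphi.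
apply: cvgD; first exact: cvg_cst.
by apply: cvgZ; [exact: cvg_id|exact: cvg_cst].
Qed.

Lemma integrable_ray phi m x y (L : R) : continuous phi ->
  leb.-integrable `[1, L]%classic (EFin \o (fun a : R => phi (y + a *: (x - y)) * a ^+ m)).
Proof.
move=> cphi; apply: continuous_compact_integrable; first exact: segment_compact.
by apply: continuous_subspaceT; exact: continuous_ray.
Qed.

(** For a > L, |y + a(x-y)| >= L|x-y| - |y| >= 1, where phi vanishes. This replaces the half-line by
    a compact interval that can serve for all nearby pairs. *)
Lemma Akern_trunc phi m x y (L : R) : (forall x, 1 <= enorm x -> phi x = 0) ->
  1 + enorm y <= L * enorm (x - y) ->
  Akern phi m x y = \int[leb]_(a in `[1, L]%classic) (phi (y + a *: (x - y)) * a ^+ m).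
Proof.
move=> sphi hL; rewrite /Akern Rintegral_mkcond [RHS]Rintegral_mkcond.
congr (Rintegral _ _ _); apply/funext => a; rewrite !patchE.
case: (boolP (a \in `[1, L]%classic)) => [|].
  move=> I1; rewrite ifT//; move: I1.
  by rewrite !inE/= !in_itv/= andbT => /andP[].
move=> nI; case: ifPn => // I2.
have a1 : 1 <= a by move: I2; rewrite inE/= in_itv/= andbT.
have La : L < a.
  rewrite ltNge; apply/negP => aL; move/negP: nI; apply.
  by rewrite inE/= in_itv/= a1 aL.
rewrite sphi ?mul0r//.
have := enormD (y + a *: (x - y)) (- y); rewrite enormN (addrC y) addrK enormZ ger0_norm ?(le_trans _ a1)//.
have := ler_wpM2r (enorm_ge0 (x - y)) (ltW La).
by lra.
Qed.

(** After truncation at T = (1+|y|)/|x-y|, the integrand is at most L T^m on an interval of length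
    at most T. *)
Lemma Akern_bound phi m x y (L : R) : continuous phi ->
  (forall x, 1 <= enorm x -> phi x = 0) -> (forall x, `|phi x| <= L) -> x != y ->
  `|Akern phi m x y| <= L * ((1 + enorm y) / enorm (x - y)) ^+ m.+1.
Proof.
move=> cphi sphi bphi xy.
have r0 : 0 < enorm (x - y) by rewrite enorm_gt0 subr_eq0.
set r := enorm (x - y) in r0 *; set T := _ / r.
have T0 : 0 <= T by rewrite divr_ge0 ?addr_ge0 ?enorm_ge0// ltW.
have L0 : 0 <= L by exact: le_trans (bphi 0).
rewrite (@Akern_trunc _ _ _ _ T)//; last by rewrite divfK// gt_eqF.
have mT : measurable (`[1, T]%classic : set (measurableTypeR R)) by exact: measurable_itv.
have iT := integrable_ray m x y T cphi.
apply: (le_trans (le_normr_Rintegral mT iT)).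
apply: (@le_trans _ _ (\int[leb]_(a in `[1, T]%classic) (L * T ^+ m))).
  apply: le_Rintegral => //.
  - exact: integrable_norm.
  - apply: continuous_compact_integrable; first exact: segment_compact.
    by apply: continuous_subspaceT => ?; exact: cvg_cst.
  move=> a; rewrite /= in_itv/= => /andP[a1 aT]; rewrite normrM ler_pM// normrX.
  by rewrite lerXn2r ?nnegrE// ger0_norm// (le_trans _ a1).
rewrite Rintegral_cst// exprSr mulrA ler_wpM2l ?mulr_ge0 ?exprn_ge0//.
by rewrite (le_trans (leb_itv1 _))// ge_max T0 lexx.
Qed.

Lemma Akern_continuous phi m x y : continuous phi ->
  (forall x, 1 <= enorm x -> phi x = 0) -> x != y ->
  {for (x, y), continuous (fun p : V * V => Akern phi m p.1 p.2)}.
Proof.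
move=> cphi sphi xy.
have r0 : 0 < enorm (x - y) by rewrite enorm_gt0 subr_eq0.
set r := enorm (x - y) in r0.
(* One truncation for every pair (x', y') with |x'-y'| > r/2 and |y'| < |y| + 1; the final 1 ensures
   L > 1. *)
pose L := (2 + enorm y) / (r / 2) + 1.
have y0 := enorm_ge0 y.
have L1 : 1 < L by rewrite ltrDr divr_gt0 ?divr_gt0// ltr_wpDr.
pose g (q : (V * V) * R) : R := phi (q.1.2 + q.2 *: (q.1.1 - q.1.2)) * q.2 ^+ m.
have cg : continuous g.
  move=> q; apply: cvgM; last first.
    apply: (@continuous_comp _ _ _ snd (fun a : R => a ^+ m)); first exact: cvg_snd.
    exact: exprn_continuous.
  apply: (@continuous_comp _ _ _ (fun q : (V * V) * R => q.1.2 + q.2 *: (q.1.1 - q.1.2)) phi);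
    last exact: cphi.
  have c1 : q'.1 @[q' --> q] --> q.1 by exact: cvg_fst.
  have c11 : q'.1.1 @[q' --> q] --> q.1.1 by apply: cvg_comp; [exact: c1|exact: cvg_fst].
  have c12 : q'.1.2 @[q' --> q] --> q.1.2 by apply: cvg_comp; [exact: c1|exact: cvg_snd].
  apply: cvgD => //; apply: cvgZ; first exact: cvg_snd.
  exact: cvgB.
apply/cvgrPdist_lt => e e0.
have eL : 0 < e / L by rewrite divr_gt0// (lt_trans _ L1).
have U := @compact_unif_continuous R _ _ `[1, L]%classic g (x, y) (@segment_compact _ _ _)
  (fun a _ => cg ((x, y), a)) _ eL.
have c1 : p.1 @[p --> (x, y)] --> x by exact: cvg_fst.
have c2 : p.2 @[p --> (x, y)] --> y by exact: cvg_snd.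
have N1 : \forall p \near (x, y), r / 2 < enorm (p.1 - p.2).
  have : enorm (p.1 - p.2) @[p --> (x, y)] --> r.
    apply: (@cvg_comp _ _ _ (fun p : V * V => p.1 - p.2) (@enorm R n) _ (nbhs (x - y))).
      exact: cvgB.
    exact: continuous_enorm.
  move=> /cvgr_gt; apply; by rewrite ltr_pdivrMr// ltr_pMr// ltr1n.
have N2 : \forall p \near (x, y), enorm p.2 < enorm y + 1.
  have : enorm p.2 @[p --> (x, y)] --> enorm y.
    apply: (@cvg_comp _ _ _ (fun p : V * V => p.2) (@enorm R n) _ (nbhs y)); first exact: c2.
    exact: continuous_enorm.
  by move=> /cvgr_lt; apply; rewrite ltrDl.
near=> p.
have n1 : r / 2 < enorm (p.1 - p.2) by near: p.
have n2 : enorm p.2 < enorm y + 1 by near: p.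
have n3 : forall a, `[1, L]%classic a -> `|g ((x, y), a) - g (p, a)| < e / L by near: p.
have hL (z1 z2 : V) : r / 2 <= enorm (z1 - z2) -> enorm z2 <= enorm y + 1 ->
    1 + enorm z2 <= L * enorm (z1 - z2).
  move=> h1 h2; apply: (@le_trans _ _ (L * (r / 2))); last first.
    by rewrite ler_wpM2l// ltW// (lt_trans _ L1).
  rewrite /L mulrDl mul1r divfK ?gt_eqF ?divr_gt0//.
  have : 0 < r / 2 by rewrite divr_gt0.
  by lra.
have mL : measurable (`[1, L]%classic : set (measurableTypeR R)) by exact: measurable_itv.
rewrite /= (@Akern_trunc phi m x y L) ?(@Akern_trunc phi m p.1 p.2 L)//; last 2 first.
- by apply: hL; rewrite ltW.
- by apply: hL; rewrite ?lerDl// -/r ler_pdivrMr// ler_peMr// ?ler1n// ltW.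
rewrite -RintegralB//; [|exact: integrable_ray..].
have iB : leb.-integrable `[1, L]%classic
   (EFin \o (fun a : R => phi (y + a *: (x - y)) * a ^+ m - phi (p.2 + a *: (p.1 - p.2)) * a ^+ m)).
  apply: continuous_compact_integrable; first exact: segment_compact.
  by apply: continuous_subspaceT => a; apply: cvgB; exact: continuous_ray.
apply: (le_lt_trans (le_normr_Rintegral mL iB)).
apply: (@le_lt_trans _ _ (\int[leb]_(a in `[1, L]%classic) (e / L))).
  apply: le_Rintegral => //.
  - exact: integrable_norm.
  - apply: continuous_compact_integrable; first exact: segment_compact.
    by apply: continuous_subspaceT => ?; exact: cvg_cst.
  by move=> a aL; apply/ltW; exact: n3.
rewrite Rintegral_cst//= lebesgue_measure_itv/= lte_fin L1/=.
by rewrite mulrAC ltr_pdivrMr ?(lt_trans _ L1)// ltr_pM2l// ltrBlDr ltrDl.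
Unshelve. all: by end_near. Qed.

(** Moving x with speed p and y with speed q moves y + a(x-y) with speed q + a(p-q); the factor a
    raises the exponent by one. The pairs (1,0) and (0,1) give the two partial derivatives. *)
Lemma Akern_derive phi m x y (j : 'I_n) (p q : R) : continuous phi ->
  (forall x, 1 <= enorm x -> phi x = 0) ->
  (forall x, pderivable phi j x) -> continuous (pderiv phi j) ->
  (forall x, 1 <= enorm x -> pderiv phi j x = 0) -> x != y ->
  is_derive (0 : R) 1 (fun h => Akern phi m (x + (h * p) *: evec R j) (y + (h * q) *: evec R j))
    (q * Akern (pderiv phi j) m x y + (p - q) * Akern (pderiv phi j) m.+1 x y).
Proof.
move=> cphi sphi dphi cdphi sdphi xy.
have r0 : 0 < enorm (x - y) by rewrite enorm_gt0 subr_eq0.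
set r := enorm (x - y) in r0.
pose L := (2 + enorm y) / (r / 2) + 1.
have y0 := enorm_ge0 y.
have r20 : 0 < r / 2 by rewrite divr_gt0.
have L1 : 1 < L by rewrite ltrDr divr_gt0// ltr_wpDr.
have L0 : 0 <= L by rewrite ltW// (lt_trans _ L1).
pose K := `|p| + `|q| + 1.
have K0 : 0 < K by rewrite ltr_wpDl ?addr_ge0.
have mr1 : Num.min (r / 2) 1 <= 1 by rewrite ge_min lexx orbT.
have mr2 : Num.min (r / 2) 1 <= r / 2 by rewrite ge_min lexx.
(* For |h| < [de] the two points stay at distance at least r/2 and |y| grows by at most 1, so the
   same L truncates all the integrals. *)
pose de := Num.min (r / 2) 1 / K.
have de0 : 0 < de by rewrite divr_gt0// lt_min r20 ltr01.
pose e := evec R j.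
have hL h : - de < h < de ->
    1 + enorm (y + (h * q) *: e) <= L * enorm (x + (h * p) *: e - (y + (h * q) *: e)).
  rewrite -ltr_norml => hde.
  have hK : `|h| * K <= Num.min (r / 2) 1 by rewrite -ler_pdivlMr// ltW.
  have hp : `|h| * (`|p| + `|q|) <= Num.min (r / 2) 1.
    by rewrite (le_trans _ hK)// ler_wpM2l// lerDl.
  have h1 : enorm (y + (h * q) *: e) <= enorm y + 1.
    rewrite (le_trans (enormD _ _))// lerD2l enormZ enorm_evec mulr1 normrM.
    by rewrite (le_trans _ (le_trans hp mr1))// ler_wpM2l// lerDr.
  have h2 : r / 2 <= enorm (x + (h * p) *: e - (y + (h * q) *: e)).
    have -> : x + (h * p) *: e - (y + (h * q) *: e) = (x - y) + (h * (p - q)) *: e.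
      by rewrite mulrBr scalerBl opprD addrACA.
    have := enormD (x - y + (h * (p - q)) *: e) (- ((h * (p - q)) *: e)).
    rewrite addrK enormN -/r enormZ enorm_evec mulr1 normrM.
    have : `|h| * `|p - q| <= r / 2.
      by rewrite (le_trans _ (le_trans hp mr2))// ler_wpM2l// ler_normB.
    lra.
  apply: (@le_trans _ _ (L * (r / 2))); last by rewrite ler_wpM2l.
  rewrite /L mulrDl mul1r divfK ?gt_eqF//; lra.
have mL : measurable (`[1, L]%classic : set (measurableTypeR R)) by exact: measurable_itv.
pose f (h : R) (a : measurableTypeR R) : R :=
  phi (y + (h * q) *: e + a *: (x + (h * p) *: e - (y + (h * q) *: e))) * a ^+ m.
have fE h (a : R) : f h a = phi (y + a *: (x - y) + (h * (q + a * (p - q))) *: e) * a ^+ m.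
  rewrite /f; congr (phi _ * _).
  apply/rowP => i; rewrite !mxE; ring.
pose df (h : R) (a : measurableTypeR R) : R := (q + a * (p - q)) *
  pderiv phi j (y + a *: (x - y) + (h * (q + a * (p - q))) *: e) * a ^+ m.
have fd (h : R) (a : measurableTypeR R) : is_derive h (1 : R) (f ^~ a : R -> R) (df h a : R).
  have H1 : is_derive h 1 ((fun t => phi (y + a *: (x - y) + t *: e)) \o
      (fun h => h * (q + a * (p - q))))
      (pderiv phi j (y + a *: (x - y) + (h * (q + a * (p - q))) *: e) * (q + a * (p - q))).
    apply: is_derive1_comp; last exact: is_derive_mulr.
    by apply: is_derive_line_at; split => //; exact: dphi.
  have -> : f ^~ a = (a ^+ m) \*: ((fun t => phi (y + a *: (x - y) + t *: e)) \o
      (fun h => h * (q + a * (p - q)))).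
    by apply/funext => h'; rewrite fE mulrC.
  by apply: is_derive_eq; rewrite /df /GRing.scale/=; ring.
have [Lam Lam0 bLam] := continuous_supp_bounded cdphi sdphi.
have I0 : (`]- de, de[%classic : set R) 0 by rewrite /= in_itv/= oppr_lt0 de0.
have intf h : (`]- de, de[%classic : set R) h -> leb.-integrable `[1, L]%classic (EFin \o f h).
  by move=> _; exact: integrable_ray.
have d1f h a : partial1of2 f h a = df h a.
  by rewrite partial1of2E; apply: derive_val.
have intG : leb.-integrable `[1, L]%classic
    (EFin \o (fun _ : measurableTypeR R => (`|q| + L * `|p - q|) * Lam * L ^+ m)).
  apply: continuous_compact_integrable; first exact: segment_compact.
  by apply: continuous_subspaceT => ?; exact: cvg_cst.
have G0 (a : measurableTypeR R) : 0 <= (`|q| + L * `|p - q|) * Lam * L ^+ m.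
  by rewrite !mulr_ge0 ?addr_ge0 ?mulr_ge0 ?exprn_ge0.
have GB h (a : measurableTypeR R) : (`]- de, de[%classic : set R) h -> (`[1, L]%classic : set R) a ->
   `|partial1of2 f h a| <= (`|q| + L * `|p - q|) * Lam * L ^+ m.
  move=> _; rewrite /= in_itv/= => /andP[a1 aL]; rewrite d1f /df !normrM.
  have a0 : 0 <= a by rewrite (le_trans _ a1).
  rewrite ler_pM ?mulr_ge0//; last by rewrite normrX lerXn2r ?nnegrE// ger0_norm.
  rewrite ler_pM// (le_trans (ler_normD _ _))// lerD2l normrM ler_wpM2r// ger0_norm//.
have D1 := derivable_under_integral mL I0 intf (fun h a _ _ => @ex_derive _ _ _ _ _ _ _ (fd h a)) G0 intG GB.
have D2 := differentiation_under_integral mL I0 intf (fun h a _ _ => @ex_derive _ _ _ _ _ _ _ (fd h a)) G0 intG GB.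
have main : is_derive (0 : R) 1 (fun h => \int[leb]_(a in `[1, L]%classic) f h a)
    (q * Akern (pderiv phi j) m x y + (p - q) * Akern (pderiv phi j) m.+1 x y).
  split => //; rewrite -derive1E D2.
  have hL0 : 1 + enorm y <= L * enorm (x - y).
    by have := hL 0; rewrite oppr_lt0 de0 !mul0r !scale0r !addr0; exact.
  rewrite !(Akern_trunc _ sdphi hL0).
  rewrite -!RintegralZl//; [|exact: integrable_ray..].
  rewrite -RintegralD//.
  - by apply: eq_Rintegral => a _; rewrite d1f /df mul0r scale0r addr0 exprS; ring.
  - apply: continuous_compact_integrable; first exact: segment_compact.
    by apply: continuous_subspaceT => a; apply: cvgM; [exact: cvg_cst|exact: continuous_ray].
  - apply: continuous_compact_integrable; first exact: segment_compact.
    by apply: continuous_subspaceT => a; apply: cvgM; [exact: cvg_cst|exact: continuous_ray].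
apply: near_eq_is_derive main.
have nde : \forall h \near (0 : R), `|h| < de.
  by apply/nbhs_ballP; exists de => //= t; rewrite /ball/= sub0r normrN.
near=> h; rewrite (@Akern_trunc _ _ _ _ L)//; apply: hL.
rewrite -ltr_norml; near: h.
Unshelve. all: by end_near. Qed.

End Kernel.

(** * Integrability on balls, change of variables, difference quotients *)

Section IntegralHelpers.
Variables (R : realType) (n : nat).
Local Notation V := 'rV[R]_n.
Local Notation mu := (muV R n).

Lemma compact_continuous_bounded (f : V -> R) (K : set V) : compact K -> continuous f ->
  exists2 M : R, 0 <= M & forall x, K x -> `|f x| <= M.
Proof.
move=> cK cf; have [->|/set0P K0] := eqVneq K set0; first by exists 0.
have [|z _ hz] := @EVT_max_rV R n (fun x => `|f x|) K K0 cK.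
  apply: continuous_subspaceT => x.
  by apply: continuous_comp; [exact: cf|exact: norm_continuous].
by exists `|f z| => // x Kx; apply: hz; rewrite inE.
Qed.

Lemma continuous_measurableT (f : V -> R) : continuous f -> measurable_fun setT f.
Proof. by move=> cf; apply: continuous_measurableV; [exact: openT|move=> x _; exact: cf]. Qed.

Lemma closed_set1V (a : V) : closed [set a].
Proof.
rewrite (_ : [set a] = ceball a 0); first exact: closed_ceball.
apply/seteqP; split => x; rewrite /ceball /=; first by move=> ->; rewrite subrr enorm0.
by rewrite le_eqVlt ltNge enorm_ge0 orbF enorm_eq0 subr_eq0 => /eqP.
Qed.

Lemma measurable_set1V (a : V) : measurable [set a].
Proof. by apply: closed_measurableV; exact: closed_set1V. Qed.

(** The kernels are continuous off the diagonal; on the remaining singleton any function is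
    measurable. *)
Lemma measurable_off_pt (f : V -> R) (a : V) :
  (forall x, x != a -> {for x, continuous f}) -> measurable_fun setT f.
Proof.
move=> cf; rewrite -(setvU [set a]).
apply/(measurable_funU _ (measurableC (measurable_set1V a)) (measurable_set1V a)).
split; last exact: measurable_fun_set1.
apply: continuous_measurableV; first by rewrite openC; exact: closed_set1V.
by move=> x; rewrite inE /= => /eqP xa; exact: cf.
Qed.

Lemma integrable_bounded_ball (f : V -> R) (A : set V) (c : V) (r M : R) :
  measurable A -> A `<=` ceball c r -> measurable_fun A f ->
  (forall x, A x -> `|f x| <= M) -> mu.-integrable A (EFin \o f).
Proof.
move=> mA Ac mf fM; apply: measurable_bounded_integrable => //.
  apply: (le_lt_trans _ (muV_ceball_fin c r)).
  by apply: le_measure; rewrite ?inE//; exact: measurable_ceball.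
exists M; split; first exact: num_real.
by move=> N MN x Ax; apply: (le_trans (fM x Ax)); exact: ltW.
Qed.

Lemma norm_Rintegral_ball (f : V -> R) (A : set V) (M v : R) :
  measurable A -> mu.-integrable A (EFin \o f) -> mu A = v%:E ->
  (forall x, A x -> `|f x| <= M) -> `|\int[mu]_(x in A) f x| <= M * v.
Proof.
move=> mA iF Av fM; apply: (le_trans (le_normr_Rintegral mA iF)).
have -> : M * v = \int[mu]_(x in A) M.
  by rewrite (Rintegral_cst mu mA) -[v]/(fine v%:E) -Av.
apply: le_Rintegral => //; first exact: integrable_norm.
have Afin : (mu A < +oo)%E by rewrite Av ltry.
apply: measurable_bounded_integrable => //.
exists `|M|; split; first exact: num_real.
by move=> N MN x Ax; exact: ltW.
Qed.

Lemma Rintegral_affineV (s : R) (a : V) (f : V -> R) : 0 < s ->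
  mu.-integrable setT (EFin \o f) ->
  \int[mu]_x f (s *: x + a) = s ^- n * \int[mu]_x f x.
Proof.
move=> s0 iF.
have mf : measurable_fun setT f by case/integrableP : iF => /measurable_EFinP.
have mfE : measurable_fun setT (EFin \o f) by exact/measurable_EFinP.
rewrite /Rintegral -[s ^- n]/(fine (s ^- n)%:E) -fineM//; last exact: integrable_fin_num.
congr fine; rewrite [in RHS]integralE muleBr//; last first.
  apply: fin_num_adde_defr.
  exact: integrable_pos_fin_num.
rewrite -!(ge0_integral_affineV a)//; [|exact: measurable_funeneg|exact: measurable_funepos].
by rewrite integralE; congr (_ - _)%E; apply: eq_integral => x _; rewrite ?funeposE ?funenegE.
Qed.

Lemma Rintegral_shiftV (a : V) (f : V -> R) : mu.-integrable setT (EFin \o f) ->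
  \int[mu]_x f (x + a) = \int[mu]_x f x.
Proof.
move=> iF; rewrite -[RHS]mul1r -[X in X * _](invr1) -[X in X^-1](expr1n R n).
rewrite -(Rintegral_affineV a ltr01 iF).
by apply: eq_Rintegral => x _; rewrite scale1r.
Qed.

Lemma enorm_shift_sqr (z : V) (j : 'I_n) (h : R) :
  enorm (z + h *: evec R j) ^+ 2 = enorm z ^+ 2 + 2 * h * z ord0 j + h ^+ 2.
Proof.
rewrite !sqr_enorm (bigD1 j)//= [in RHS](bigD1 j)//= !mxE !eqxx mulr1.
rewrite (eq_bigr (fun i => z ord0 i ^+ 2)); last first.
  by move=> i ij; rewrite !mxE eqxx (negbTE ij) mulr0 addr0.
by ring.
Qed.

Lemma enorm_shift_le (z : V) (j : 'I_n) (h : R) : enorm (z + h *: evec R j) <= enorm z + `|h|.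
Proof. by rewrite (le_trans (enormD _ _))// enormZ enorm_evec mulr1. Qed.

(** A sequence of increments is what dominated convergence needs. *)
Lemma is_derive_seq (f : R -> R) (l : R) : is_derive (0 : R) 1 f l ->
  (f k.+1%:R^-1 - f 0) / k.+1%:R^-1 @[k --> \oo] --> l.
Proof.
move=> [/cvg_ex[/= l' fl] dl].
have ll' : l = l' by rewrite -dl; apply/cvg_lim.
rewrite -ll' in fl.
move/(cvgr_dnbhsP _ _ _).1 : fl => /(_ (fun k => k.+1%:R^-1)) H.
have : h.+1%:R^-1^-1 *: (f (h.+1%:R^-1 *: (1 : R) + 0) - f 0) @[h --> \oo] --> l.
  by apply: H; split => [k|]; [rewrite invr_eq0|exact: cvg_harmonic].
apply: cvg_trans; apply: near_eq_cvg; apply: nearW => k.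
by rewrite addr0 [_%:A]mulr1 mulrC.
Qed.

End IntegralHelpers.

(** * The divergence theorem on a ball *)

Section Divergence.
Variables (R : realType) (n : nat).
Local Notation V := 'rV[R]_n.
Local Notation mu := (muV R n).

Lemma integrable_supp_ball (f : V -> R) (c : V) (r M : R) : measurable_fun setT f ->
  (forall x, r < enorm (x - c) -> f x = 0) -> (forall x, enorm (x - c) <= r -> `|f x| <= M) ->
  mu.-integrable setT (EFin \o f).
Proof.
move=> mf f0 fM.
have -> : EFin \o f = (EFin \o f) \_ (ceball c r).
  apply/funext => x; rewrite patchE; case: ifPn => // /negP; rewrite inE /ceball /= => /negP.
  by rewrite -ltNge => /f0 ->.
apply/(integrable_mkcond _ (measurable_ceball c r)).
apply: (@integrable_bounded_ball _ _ _ _ c r M) => //; first exact: measurable_ceball.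
exact: measurable_funTS.
Qed.

Lemma ler_norm_maxB (a b : R) : `|Num.max a 0 - Num.max b 0| <= `|a - b|.
Proof.
case: (leP a 0) => a0; case: (leP b 0) => b0; rewrite ?subrr ?normr0 ?subr0 ?sub0r//.
- by rewrite normrN (gtr0_norm b0) distrC; have := ler_norm (b - a); lra.
- by rewrite (gtr0_norm a0); have := ler_norm (a - b); lra.
Qed.

Variables (j : 'I_n) (G : V -> R).
Hypotheses (cG : continuous G) (dG : forall x, pderivable G j x)
  (cD : continuous (pderiv G j)).
Local Notation D := (pderiv G j).
Local Notation e := (evec R j).

Lemma pderiv_MVT (y : V) (h M : R) : 0 <= h ->
  (forall t, 0 <= t <= h -> `|D (y + t *: e)| <= M) ->
  `|G (y + h *: e) - G y| <= M * h.
Proof.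
move=> h0 bM.
have dl t : is_derive t (1 : R) (fun s : R => G (y + s *: e)) (D (y + t *: e)).
  by apply: is_derive_line_at; split => //; exact: dG.
have [|c c0h] := @MVT_segment R (fun s : R => G (y + s *: e)) (fun t => D (y + t *: e)) 0 h h0 (fun t _ => dl t).
  apply: derivable_within_continuous => t _; exact: ex_derive.
rewrite scale0r addr0 subr0 => ->; rewrite normrM (ger0_norm h0) ler_wpM2r//.
by apply: bM; move: c0h; rewrite in_itv.
Qed.

(* Translation invariance makes the integral of the directional derivative of the compactly supported
   Lipschitz function [G * (rho^2 - |y - c|^2)_+] vanish. *)
Lemma ball_weighted_divergence (c : V) (rho : R) : 0 < rho ->
  \int[mu]_(x in eball c rho)
    (D x * (rho ^+ 2 - enorm (x - c) ^+ 2) - 2 * (x ord0 j - c ord0 j) * G x) = 0.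
Proof.
move=> rho0.
pose m (y : V) := Num.max (rho ^+ 2 - enorm (y - c) ^+ 2) 0.
pose H (y : V) := G y * m y.
pose h_ (k : nat) : R := k.+1%:R^-1.
have h0 k : 0 < h_ k by rewrite invr_gt0.
have h1 k : h_ k <= 1 by rewrite invf_le1// ler1n.
pose q k (y : V) := (H (y + h_ k *: e) - H y) / h_ k.
have [MG MG0 bG] := compact_continuous_bounded (@compact_ceball R n c (rho + 2)) cG.
have [MD MD0 bD] := compact_continuous_bounded (@compact_ceball R n c (rho + 2)) cD.
have m0 y : 0 <= m y by rewrite /m le_max lexx orbT.
have m_le y : m y <= rho ^+ 2.
  by rewrite /m ge_max sqr_ge0 andbT lerBlDr lerDl sqr_ge0.
have m_out y : rho <= enorm (y - c) -> m y = 0.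
  move=> h; rewrite /m max_r// subr_le0 lerXn2r// ?nnegrE ?enorm_ge0// ltW//.
have mH : measurable_fun setT H.
  apply: measurable_funM; first exact: continuous_measurableT.
  apply: measurable_maxr => //; apply: measurable_funB => //.
  by apply: measurable_funX; exact: measurable_enormB.
have mHs k : measurable_fun setT (fun y : V => H (y + h_ k *: e)).
  have := measurableT_comp mH (measurable_affineV 1 (h_ k *: e)).
  by apply: eq_measurable_fun => y _ /=; rewrite scale1r.
have mq k : measurable_fun setT (q k).
  by apply: measurable_funM => //; exact: measurable_funB.
have sh y k : enorm (y + h_ k *: e - c) <= enorm (y - c) + h_ k.
  by rewrite addrAC (le_trans (enorm_shift_le _ _ _))// ger0_norm// ltW.
have sh' y k : enorm (y - c) - h_ k <= enorm (y + h_ k *: e - c).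
  have := enormD (y + h_ k *: e - c) (- (h_ k *: e)).
  rewrite enormN enormZ enorm_evec mulr1 (gtr0_norm (h0 k)).
  have -> : y + h_ k *: e - c - h_ k *: e = y - c.
    by apply/rowP => i; rewrite !mxE; ring.
  by lra.
have iH : mu.-integrable setT (EFin \o H).
  apply: (@integrable_supp_ball H c rho (MG * rho ^+ 2)) => // x xr.
    by rewrite /H m_out ?mulr0// ltW.
  rewrite normrM ler_pM ?(ger0_norm (m0 _))// bG// /ceball/=; lra.
have iHs k : mu.-integrable setT (EFin \o (fun y : V => H (y + h_ k *: e))).
  apply: (@integrable_supp_ball _ c (rho + 1) (MG * rho ^+ 2)) => // x xr.
    rewrite /H m_out ?mulr0//; have := sh' x k; have := h1 k; lra.
  rewrite /H normrM ler_pM ?(ger0_norm (m0 _))// bG// /ceball/=; have := sh x k; have := h1 k; lra.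
(* Translating [H] does not change its integral, so each difference quotient integrates to 0. *)
have int_q k : \int[mu]_y q k y = 0.
  rewrite /q RintegralZr//; last first.
    by have := integrableB measurableT (iHs k) iH; apply: eq_integrable => // y _.
  by rewrite RintegralB// (@Rintegral_shiftV _ _ (h_ k *: e) H)// subrr mul0r.
(* The first term bounds the increment of [G] times the weight; the second uses that the weight
   changes by at most h |2(y-c)_j + h| with |y-c| <= rho + 1 and h <= 1. *)
pose C := MD * rho ^+ 2 + MG * (2 * rho + 3).
have C0 : 0 <= C by rewrite addr_ge0// mulr_ge0// ?sqr_ge0//; lra.
have q_out k y : rho + 1 < enorm (y - c) -> q k y = 0.
  move=> yr; rewrite /q /H !m_out ?mulr0 ?subrr ?mul0r//; first lra.
  by have := sh' y k; have := h1 k; lra.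
have q_bd k y : enorm (y - c) <= rho + 1 -> `|q k y| <= C.
  move=> yr; rewrite /q normrM normfV (gtr0_norm (h0 k)) ler_pdivrMr//.
  have -> : H (y + h_ k *: e) - H y = (G (y + h_ k *: e) - G y) * m (y + h_ k *: e) +
      G y * (m (y + h_ k *: e) - m y) by rewrite /H; ring.
  rewrite (le_trans (ler_normD _ _))// /C [leRHS]mulrDl lerD// normrM.
    rewrite mulrAC ler_pM// ?(ger0_norm (m0 _))//.
    apply: pderiv_MVT; first exact: ltW.
    move=> t /andP[t0 th]; apply: bD; rewrite /ceball/= addrAC.
    by rewrite (le_trans (enorm_shift_le _ _ _))// (ger0_norm t0); have := h1 k; lra.
  rewrite -mulrA ler_pM//; first by apply: bG; rewrite /ceball/=; lra.
  apply: (le_trans (ler_norm_maxB _ _)).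
  rewrite (addrAC y) enorm_shift_sqr.
  have -> : rho ^+ 2 - (enorm (y - c) ^+ 2 + 2 * h_ k * (y - c) ord0 j + h_ k ^+ 2) -
    (rho ^+ 2 - enorm (y - c) ^+ 2) = - (h_ k * (2 * (y - c) ord0 j + h_ k)) by ring.
  rewrite normrN normrM (gtr0_norm (h0 k)) mulrC ler_wpM2r ?(ltW (h0 k))//.
  rewrite (le_trans (ler_normD _ _))// normrM (gtr0_norm (h0 k)) ger0_norm//.
  by have := coord_le_enorm (y - c) j; have := h1 k; lra.
pose ql := (fun x => D x * (rho ^+ 2 - enorm (x - c) ^+ 2) -
   2 * (x ord0 j - c ord0 j) * G x) \_ (eball c rho).
(* The positive part may have a corner on the sphere of radius rho, which is a null set; elsewhere
   it agrees near y with a polynomial or with 0. *)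
have q_cvg (y : V) : enorm (y - c) != rho -> q k y @[k --> \oo] --> ql y.
  rewrite /ql patchE; have [yr _|yr _|//] := ltgtP (enorm (y - c)) rho.
  - rewrite mem_set//.
    pose w (h : R) := G (y + h *: e) * (rho ^+ 2 - enorm (y - c) ^+ 2 -
      (2 * (y - c) ord0 j) * h - h * h).
    have dw : is_derive (0 : R) 1 w (D y * (rho ^+ 2 - enorm (y - c) ^+ 2) -
        2 * (y ord0 j - c ord0 j) * G y).
      have dG0 : is_derive (0 : R) 1 (fun h : R => G (y + h *: e)) (D y).
        by apply/is_derive_line; split => //; exact: dG.
      have dm : is_derive (0 : R) 1 (fun h : R => rho ^+ 2 - enorm (y - c) ^+ 2 -
          (2 * (y - c) ord0 j) * h - h * h) (- (2 * (y - c) ord0 j)).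
        have -> : (fun h : R => rho ^+ 2 - enorm (y - c) ^+ 2 - (2 * (y - c) ord0 j) * h - h * h)
          = cst (rho ^+ 2 - enorm (y - c) ^+ 2) - (2 * (y - c) ord0 j) \*: id - id * id by [].
        by apply: is_derive_eq; rewrite /GRing.scale/=; ring.
      apply: (is_derive_eq (is_deriveM dG0 dm)).
      by rewrite !scale0r !addr0 !mxE /GRing.scale/=; ring.
    apply: cvg_trans (is_derive_seq dw); apply: near_eq_cvg.
    near=> k; rewrite /q /w scale0r addr0.
    have yk : enorm (y + h_ k *: e - c) < rho.
      apply: (le_lt_trans (sh y k)); rewrite -ltrBrDl; near: k.
      have := @cvg_harmonic R => /cvgr_lt; apply; by rewrite subr_gt0.
    have mE z : enorm (z - c) < rho -> m z = rho ^+ 2 - enorm (z - c) ^+ 2.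
      move=> zr; rewrite /m max_l// subr_ge0 lerXn2r// ?nnegrE ?enorm_ge0// ltW//.
    rewrite /H !mE// (addrAC y) enorm_shift_sqr -/(h_ k).
    congr (_ / _); ring.
  - rewrite memNset; last by rewrite /eball/=; move/ltW; rewrite leNgt yr.
    apply: (@cvg_trans _ ((fun _ : nat => 0 : R) @ \oo)); last exact: cvg_cst.
    apply: near_eq_cvg.
    have m1 : m y = 0 by apply: m_out; exact: ltW.
    near=> k; rewrite /q /H m1 m_out ?mulr0 ?subrr ?mul0r//.
    apply: le_trans (sh' y k); rewrite lerBrDl -lerBrDr; near: k.
    have := @cvg_harmonic R => /cvgr_le; apply; by rewrite subr_gt0.
have mql : measurable_fun setT ql.
  apply/(measurable_restrictT _ (measurable_eball c rho)); apply: measurable_funTS.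
  have m1 : measurable_fun setT (fun x : V => rho ^+ 2 - enorm (x - c) ^+ 2).
    by apply: measurable_funB => //; apply: measurable_funX; exact: measurable_enormB.
  have m2 : measurable_fun setT (fun x : V => 2 * (x ord0 j - c ord0 j)).
    by apply: measurable_funM => //; apply: measurable_funB => //; exact: coord_measurable.
  apply: measurable_funB; apply: measurable_funM => //; exact: continuous_measurableT.
have mqE k : measurable_fun setT (fun y : V => (q k y)%:E) by exact/measurable_EFinP.
have mqlE : measurable_fun setT (fun y : V => (ql y)%:E) by exact/measurable_EFinP.
have q_ae : {ae mu, forall y : V, setT y -> (q k y)%:E @[k --> \oo] --> (ql y)%:E}.
  exists [set y | enorm (y - c) = rho]; split.
  - rewrite (_ : [set _ | _] = ceball c rho `\` eball c rho).
      by apply: measurableD; [exact: measurable_ceball|exact: measurable_eball].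
    apply/seteqP; split => x; rewrite /ceball/eball/=; first by move=> ->; rewrite lexx ltxx.
    by move=> [x1 /negP]; rewrite -leNgt => x2; apply/eqP; rewrite eq_le x1.
  - exact: muV_sphere.
  - move=> y /= nP; apply/eqP; apply: contrapT => /negP yr; apply: nP => _.
    by apply: cvg_EFin; [exact: nearW|exact: q_cvg].
have ig : mu.-integrable setT (fun y : V => (C * \1_(ceball c (rho + 1)) y)%:E).
  apply: (@integrable_supp_ball _ c (rho + 1) C).
  - by apply: measurable_funM => //; apply: measurable_indic; exact: measurable_ceball.
  - by move=> x xr; rewrite indicE memNset ?mulr0//= /ceball/= leNgt xr.
  - by move=> x xr; rewrite indicE mem_set// mulr1 ger0_norm.
have q_dom : {ae mu, forall (y : V) k, setT y ->
    (`|(q k y)%:E| <= (C * \1_(ceball c (rho + 1)) y)%:E)%E}.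
  apply: aeW => y k _; rewrite lee_fin indicE.
  have [yr|yr] := leP (enorm (y - c)) (rho + 1); first by rewrite mem_set// mulr1 q_bd.
  by rewrite q_out// normr0 mulr_ge0.
have [iql _ lim_q] := dominated_convergence measurableT mqE mqlE q_ae ig q_dom.
have iq k : mu.-integrable setT (fun y : V => (q k y)%:E).
  apply: (le_integrable measurableT (mqE k) _ ig) => y _.
  rewrite [leRHS]gee0_abs ?lee_fin ?mulr_ge0// indicE.
  have [yr|yr] := leP (enorm (y - c)) (rho + 1); first by rewrite mem_set// mulr1 q_bd.
  by rewrite q_out// normr0 mulr_ge0.
have : (\int[mu]_y (ql y)%:E = 0)%E.
  rewrite -(cvg_lim _ lim_q)//; apply: cvg_lim => //.
  rewrite (_ : [sequence _]_n = fun _ => 0%E); first exact: cvg_cst.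
  apply/funext => k; have := int_q k; rewrite /Rintegral => qk0.
  by rewrite -[LHS]fineK ?qk0//; exact: integrable_fin_num.
by rewrite Rintegral_mkcond /Rintegral => ->.
Unshelve. all: by end_near. Qed.

(** [G] on the sphere of radius r times the j-th component of the outward normal, extended
    constantly along rays: the integrand of the cone formula for the flux. *)
Definition cone_pull (c : V) (r : R) (z : V) : R :=
  G (c + (r / enorm z) *: z) * (z ord0 j / enorm z).

Lemma measurable_cone_pull (c : V) (r : R) : measurable_fun setT (cone_pull c r).
Proof.
apply: (@measurable_off_pt _ _ _ 0) => z z0.
have cV : {for z, continuous (fun z : V => (enorm z)^-1)}.
  by apply: continuousV; [rewrite enorm_eq0|exact: continuous_enorm].
apply: continuousM; last by apply: continuousM => //; exact: coord_continuous.
apply: (@continuous_comp _ _ _ (fun z : V => c + (r / enorm z) *: z) G); last exact: cG.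
apply: continuousD; first exact: cst_continuous.
apply: continuousZ; last by [].
by apply: continuousM => //; exact: cst_continuous.
Qed.

Lemma cone_pull_scale (c : V) (r s : R) (z : V) : 0 < s ->
  cone_pull c r (s *: z) = cone_pull c r z.
Proof.
move=> s0; rewrite /cone_pull enormZ gtr0_norm// scalerA mxE.
have [->|z0] := eqVneq z 0; first by rewrite !scaler0 mxE !mulr0 !mul0r.
have z1 : enorm z != 0 by rewrite enorm_eq0.
have s1 : s != 0 by rewrite gt_eqF.
by congr (G (c + _ *: z) * _); field; apply/andP.
Qed.

Lemma cone_pull_bound (c : V) (r M : R) : 0 < r -> (forall x, ceball c r x -> `|G x| <= M) ->
  forall z, `|cone_pull c r z| <= M.
Proof.
move=> r0 bM z; rewrite /cone_pull.
have [->|z0] := eqVneq z 0.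
  rewrite mxE mul0r mulr0 normr0; apply: le_trans (bM c _); first exact: normr_ge0.
  by rewrite /ceball/= subrr enorm0 ltW.
have z1 : 0 < enorm z by rewrite enorm_gt0.
rewrite normrM -[leRHS]mulr1 ler_pM//.
  apply: bM; rewrite /ceball/= addrAC subrr add0r enormZ normrM normfV (gtr0_norm z1) divfK ?gt_eqF//.
  by rewrite gtr0_norm.
by rewrite normrM normfV (gtr0_norm z1) ler_pdivrMr// mul1r coord_le_enorm.
Qed.

(** [cone_pull] is homogeneous of degree 0, so rescaling the ball changes only the volume
    element. *)
Lemma int_cone_pull (c : V) (r rho : R) : 0 < r -> 0 < rho ->
  \int[mu]_(x in eball c rho) cone_pull c r (x - c) =
  rho ^+ n * \int[mu]_(z in eball 0 1) cone_pull c r z.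
Proof.
move=> r0 rho0.
have [M M0 bM] := compact_continuous_bounded (@compact_ceball R n c r) cG.
have mf : measurable_fun setT (fun x : V => cone_pull c r (x - c)).
  have := measurableT_comp (measurable_cone_pull c r) (measurable_affineV 1 (- c)).
  by apply: eq_measurable_fun => y _ /=; rewrite scale1r.
pose f := (fun x : V => cone_pull c r (x - c)) \_ (eball c rho).
have iF : mu.-integrable setT (EFin \o f).
  apply: (@integrable_supp_ball f c rho M).
  - by apply/(measurable_restrictT _ (measurable_eball c rho)); exact: measurable_funTS.
  - by move=> x xr; rewrite /f patchE memNset// /eball/= => /ltW; rewrite leNgt xr.
  - move=> x xr; rewrite /f patchE; case: ifPn => _; last by rewrite normr0.
    exact: cone_pull_bound.
have E := Rintegral_affineV c rho0 iF.
rewrite [X in X = _]Rintegral_mkcond -/f.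
have rn : rho ^+ n != 0 by rewrite expf_neq0// gt_eqF.
apply: (mulfI (invr_neq0 rn)); rewrite -E mulrA mulVf// mul1r [RHS]Rintegral_mkcond /f.
apply: eq_Rintegral => x _; rewrite !patchE addrK cone_pull_scale//.
have -> : (rho *: x + c \in eball c rho) = (x \in eball 0 1).
  by apply/idP/idP; rewrite !inE /eball/= addrK subr0 enormZ gtr0_norm// gtr_pMr.
by [].
Qed.

Lemma muV_shell (c : V) (rho r : R) : 0 < rho -> rho < r ->
  mu (eball c r `\` eball c rho) = ((r ^+ n - rho ^+ n) * uvol R n)%:E.
Proof.
move=> rho0 rhor; have r0 := lt_trans rho0 rhor.
have E : eball c r `&` eball c rho = eball c rho.
  by apply/seteqP; split => x; rewrite /eball/=; [case|move=> xr; split => //; exact: lt_trans rhor].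
have fr : (mu (eball c r) < +oo)%E by rewrite muV_eball// ltry.
rewrite mulrBl EFinB -(muV_eball c r0) -(muV_eball c rho0) -[X in (_ - mu X)%E]E.
by apply: measureD => //; exact: measurable_eball.
Qed.

(** The weighted identities for r and rho combine into an integral over the shell between them.
    There x is close to its projection onto the sphere of radius r, so 2(x_j-c_j)G(x) is close to 2r
    times the flux density. The hypothesis on [G] measures this with t = r/|z|, so that c + tz is
    the projection of c + z. *)
Lemma shell_divergence (c : V) (rho r M e0 : R) : 0 < rho -> rho < r ->
  (forall x, ceball c r x -> `|D x| <= M) ->
  (forall z t, enorm z <= r -> 1 <= t <= r / rho -> `|G (c + z) - t * G (c + t *: z)| <= e0) ->
  `|(r ^+ 2 - rho ^+ 2) * \int[mu]_(x in eball c r) D x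
     - 2 * r * (r ^+ n - rho ^+ n) * \int[mu]_(z in eball 0 1) cone_pull c r z| <=
  ((r ^+ 2 - rho ^+ 2) * M + 2 * r * e0) * ((r ^+ n - rho ^+ n) * uvol R n).
Proof.
move=> rho0 rhor bM be; have r0 := lt_trans rho0 rhor.
have [MG MG0 bG] := compact_continuous_bounded (@compact_ceball R n c r) cG.
have M0 : 0 <= M by apply: le_trans (bM c _); rewrite ?normr_ge0// /ceball/= subrr enorm0 ltW.
pose s := r ^+ 2 - rho ^+ 2; rewrite -/s.
have s0 : 0 < s by rewrite subr_gt0 ltrXn2r// ltW.
pose A := eball c r `\` eball c rho.
have mr := measurable_eball c r; have mrho := measurable_eball c rho.
have mA : measurable A by exact: measurableD.
have UA : eball c r = eball c rho `|` A.
  apply/seteqP; split => x; rewrite /A /eball/=; last by move=> [/lt_trans|[]//]; apply.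
  by case: (ltP (enorm (x - c)) rho) => [|h]; [left|right; split => //; apply/negP; rewrite -leNgt].
have dA : [disjoint eball c rho & A] by rewrite disj_set2E /A setDIK.
have subr : eball c r `<=` ceball c r by move=> x; exact: ltW.
pose w (x : V) := 2 * (x ord0 j - c ord0 j) * G x.
pose f (t : R) (x : V) := D x * (t ^+ 2 - enorm (x - c) ^+ 2) - w x.
pose g (x : V) := cone_pull c r (x - c).
have mD : measurable_fun setT D by exact: continuous_measurableT.
have iZ (k : R) (h : V -> R) B : measurable B -> mu.-integrable B (EFin \o h) ->
    mu.-integrable B (EFin \o (fun x => k * h x)).
  by move=> mB /(integrableZl mB k); apply: eq_integrable.
have iB (h1 h2 : V -> R) B : measurable B -> mu.-integrable B (EFin \o h1) ->
    mu.-integrable B (EFin \o h2) -> mu.-integrable B (EFin \o (fun x => h1 x - h2 x)).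
  by move=> mB i1 i2; have := integrableB mB i1 i2; apply: eq_integrable.
have mw : measurable_fun setT w.
  apply: measurable_funM; last exact: continuous_measurableT.
  by apply: measurable_funM => //; apply: measurable_funB => //; exact: coord_measurable.
have mf t : measurable_fun setT (f t).
  apply: measurable_funB => //; apply: measurable_funM => //; apply: measurable_funB => //.
  by apply: measurable_funX; exact: measurable_enormB.
have mg : measurable_fun setT g.
  have := measurableT_comp (measurable_cone_pull c r) (measurable_affineV 1 (- c)).
  by apply: eq_measurable_fun => y _ /=; rewrite scale1r.
have iD : mu.-integrable (eball c r) (EFin \o D).
  apply: (@integrable_bounded_ball _ _ _ _ c r M) => //; first exact: measurable_funTS.
  by move=> x /subr; exact: bM.
have ifr : mu.-integrable (eball c r) (EFin \o f r).
  apply: (@integrable_bounded_ball _ _ _ _ c r (M * r ^+ 2 + 2 * r * MG)) => //.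
    exact: measurable_funTS.
  move=> x /subr xr; have xr' : enorm (x - c) <= r by exact: xr.
  rewrite (le_trans (ler_normB _ _))// lerD// normrM ler_pM//.
  - exact: bM.
  - have p0 : 0 <= r ^+ 2 - enorm (x - c) ^+ 2.
      by rewrite subr_ge0 lerXn2r// ?nnegrE ?enorm_ge0// ltW.
    by rewrite (ger0_norm p0) lerBlDr lerDl sqr_ge0.
  - rewrite normrM ger0_norm// ler_wpM2l// (le_trans _ xr')//.
    by have := coord_le_enorm (x - c) j; rewrite !mxE.
  - exact: bG.
have ig : mu.-integrable (eball c r) (EFin \o g).
  apply: (@integrable_bounded_ball _ _ _ _ c r MG) => //; first exact: measurable_funTS.
  by move=> x _; exact: cone_pull_bound.
have split_int (h : V -> R) : mu.-integrable (eball c r) (EFin \o h) ->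
    \int[mu]_(x in eball c r) h x = \int[mu]_(x in eball c rho) h x + \int[mu]_(x in A) h x.
  by move=> ih; rewrite {1}UA Rintegral_setU// -UA.
have Asub : A `<=` eball c r by move=> x [].
have rsub : eball c rho `<=` eball c r by move=> x /lt_trans; apply.
have iA (h : V -> R) : mu.-integrable (eball c r) (EFin \o h) -> mu.-integrable A (EFin \o h).
  by move=> ih; exact: integrableS ih.
have irho (h : V -> R) : mu.-integrable (eball c r) (EFin \o h) -> mu.-integrable (eball c rho) (EFin \o h).
  by move=> ih; exact: integrableS ih.
have Pr := ball_weighted_divergence c r0; have Prho := ball_weighted_divergence c rho0.
have Gr := int_cone_pull c r0 r0; have Grho := int_cone_pull c r0 rho0.
have ifrho : mu.-integrable (eball c rho) (EFin \o f rho).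
  rewrite (_ : f rho = (fun x => f r x - s * D x)); last first.
    by apply/funext => x; rewrite /f /s; ring.
  apply: (@iB _ _ _) => //; first exact: irho.
  by apply: iZ => //; exact: irho.
(* On the ball of radius rho, [f r] exceeds [f rho], whose integral is 0, by s times [D]. *)
have Efr : \int[mu]_(x in eball c rho) f r x = s * \int[mu]_(x in eball c rho) D x.
  rewrite -[RHS](addr0) -[X in _ + X]Prho -RintegralZl//; last exact: irho.
  rewrite -RintegralD//.
  - by apply: eq_Rintegral => x _; rewrite /f /w /s; ring.
  - by apply: iZ => //; exact: irho.
(* As [f r] has integral 0 over the large ball, its integral over the shell is minus that over the
   small ball, which replaces the latter's share of s times the integral of [D]. *)
have EA : s * \int[mu]_(x in eball c r) D x
     - 2 * r * (r ^+ n - rho ^+ n) * \int[mu]_(z in eball 0 1) cone_pull c r z =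
   \int[mu]_(x in A) (s * D x - f r x - 2 * r * g x).
  rewrite RintegralB//; last 2 first.
  - apply: (@iB _ _ _) => //; last exact: iA.
    by apply: iZ => //; exact: iA.
  - by apply: iZ => //; exact: iA.
  rewrite RintegralB//; last 2 first.
  - by apply: iZ => //; exact: iA.
  - exact: iA.
  rewrite !RintegralZl//; [|exact: iA|exact: iA].
  have h1 := split_int _ ig; have h2 := split_int _ ifr; have h3 := split_int _ iD.
  rewrite Gr Grho in h1; rewrite Pr Efr in h2; move: h1 h2 h3.
  set ID := \int[mu]_(x in eball c r) D x; set J1 := \int[mu]_(x in A) g x.
  set J2 := \int[mu]_(x in A) f r x; set J3 := \int[mu]_(x in A) D x.
  set J4 := \int[mu]_(x in eball c rho) D x; set I0 := Rintegral _ _ _.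
  move=> h1 h2 h3.
  have -> : J1 = r ^+ n * I0 - rho ^+ n * I0 by rewrite h1; ring.
  have -> : J2 = - (s * J4) by apply/eqP; rewrite -addr_eq0 addrC -h2.
  by rewrite h3; ring.
rewrite EA; apply: norm_Rintegral_ball => //.
- apply: (@iB _ _ _) => //; last by apply: iZ => //; exact: iA.
  apply: (@iB _ _ _) => //; last exact: iA.
  by apply: iZ => //; exact: iA.
- exact: muV_shell.
move=> x [xr /negP]; rewrite -leNgt => xrho; have xr' : enorm (x - c) <= r by exact: ltW.
have -> : s * D x - f r x - 2 * r * g x =
    D x * (enorm (x - c) ^+ 2 - rho ^+ 2) + (w x - 2 * r * g x) by rewrite /f /s; ring.
rewrite (le_trans (ler_normD _ _))// lerD//.
  rewrite normrM mulrC ler_pM//; last exact: bM.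
  have p0 : 0 <= enorm (x - c) ^+ 2 - rho ^+ 2.
    by rewrite subr_ge0 lerXn2r// ?nnegrE ?enorm_ge0// ltW.
  by rewrite (ger0_norm p0) /s lerD2r lerXn2r// ?nnegrE ?enorm_ge0// ltW.
set z := x - c in xrho xr' *.
have z0 : 0 < enorm z by exact: lt_le_trans xrho.
have -> : w x - 2 * r * g x = 2 * z ord0 j * (G (c + z) - r / enorm z * G (c + (r / enorm z) *: z)).
  have Gx : G x = G (c + z) by rewrite /z addrC subrK.
  have zj : x ord0 j - c ord0 j = z ord0 j by rewrite !mxE.
  by rewrite /w /g -/z /cone_pull zj Gx; ring.
rewrite !normrM (ger0_norm (_ : 0 <= 2))// ler_pM ?mulr_ge0//.
  by rewrite ler_pM2l// (le_trans (coord_le_enorm _ _)).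
apply: be => //; rewrite ler_pdivlMr// mul1r xr'/=.
by rewrite ler_pM2l// lef_pV2.
Qed.

(** The shell estimate is divided by r - rho. As rho tends to r, the term with [M] vanishes and the
    one with [e0] stays bounded by a multiple of the arbitrary [e0]. *)
Theorem ball_divergence (c : V) (r : R) : 0 < r ->
  \int[mu]_(x in eball c r) D x =
  n%:R * r ^+ n.-1 * \int[mu]_(z in eball 0 1) cone_pull c r z.
Proof.
move=> r0.
set ID := \int[mu]_(x in eball c r) D x; set I0 := \int[mu]_(z in eball 0 1) _.
have [M M0 bM] := compact_continuous_bounded (@compact_ceball R n c r) cD.
(* The quotient (r^n - rho^n)/(r - rho) as a polynomial, hence continuous at rho = r, where it
   equals n r^(n-1). *)
pose Q (rho : R) : R := (\poly_(i < n) r ^+ (n.-1 - i)).[rho].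
have QE rho : r ^+ n - rho ^+ n = (r - rho) * Q rho by rewrite subrXX /Q horner_poly.
have Qr : Q r = n%:R * r ^+ n.-1.
  rewrite /Q horner_poly (eq_bigr (fun=> r ^+ n.-1)).
    by rewrite sumr_const card_ord mulr_natl.
  move=> i _; rewrite -exprD subnK//; have := ltn_ord i; by case: (n) i => // m i; rewrite ltnS.
have key e0 : 0 < e0 -> \forall rho \near r^'-,
    `|(r + rho) * ID - 2 * r * Q rho * I0| <=
    (r ^+ 2 - rho ^+ 2) * (M * Q rho * uvol R n) + 2 * r * e0 * Q rho * uvol R n.
  move=> e00.
  pose g (p : R * V) := p.1 * G (c + p.1 *: p.2).
  have cg : continuous g.
    move=> p; apply: cvgM; first exact: cvg_fst.
    apply: (@continuous_comp _ _ _ (fun p : R * V => c + p.1 *: p.2) G); last exact: cG.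
    apply: cvgD; first exact: cvg_cst.
    by apply: cvgZ; [exact: cvg_fst|exact: cvg_snd].
  have := @compact_unif_continuous R _ _ (ceball 0 r) g 1 (@compact_ceball R n 0 r)
    (fun z _ => cg (1, z)) e0 e00.
  move=> /nbhs_ballP[d /= d0 hd].
  (* For rho > r/(1+d), every dilation factor t in [1, r/rho] is within d of 1. *)
  have rd : r / (1 + d) < r by rewrite ltr_pdivrMr ?addr_gt0// ltr_pMr// ltrDl.
  near=> rho.
  have rho0 : 0 < rho by near: rho; exact: nbhs_left_gt.
  have rhor : rho < r by near: rho; exact: nbhs_left_lt.
  have rhod : r / (1 + d) < rho by near: rho; exact: nbhs_left_gt.
  have d1 : 0 < 1 + d by rewrite addr_gt0.
  have := @shell_divergence c rho r M e0 rho0 rhor bM.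
  have rr : 0 < r - rho by rewrite subr_gt0.
  rewrite QE => H.
  rewrite -(ler_pM2l rr) -{1}(gtr0_norm rr) -normrM.
  apply: le_trans (le_trans (H _) _).
  - rewrite le_eqVlt; apply/orP; left; apply/eqP; congr (`|_|); rewrite -/ID -/I0; ring.
  - move=> z t zr /andP[t1 tr].
    have bt : ball (1 : R) d t.
      rewrite /ball/= distrC ger0_norm ?subr_ge0// ltrBlDl (le_lt_trans tr)//.
      by rewrite ltr_pdivrMr// mulrC -ltr_pdivrMr.
    have zr' : ceball 0 r z by rewrite /ceball/= subr0.
    by have /ltW := hd t bt z zr'; rewrite /g/= mul1r scale1r.
  rewrite le_eqVlt; apply/orP; left; apply/eqP; ring.
have lr (f : R -> R) : continuous f -> f rho @[rho --> r^'-] --> f r.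
  by move=> cf; apply: cvg_at_left_filter; exact: cf.
have cQ : continuous Q by move=> x; exact: continuous_horner.
have lim_le e0 : 0 < e0 -> `|(r + r) * ID - 2 * r * Q r * I0| <=
    2 * r * e0 * Q r * uvol R n.
  move=> e00.
  have -> : 2 * r * e0 * Q r * uvol R n =
     (r ^+ 2 - r ^+ 2) * (M * Q r * uvol R n) + 2 * r * e0 * Q r * uvol R n.
    by rewrite subrr mul0r add0r.
  apply: (ler_cvg_to _ _ (key _ e00)).
  - apply: (lr (fun rho => `|(r + rho) * ID - 2 * r * Q rho * I0|)) => x.
    apply: cvg_norm; apply: cvgB.
      by apply: cvgM; [apply: cvgD; [exact: cvg_cst|exact: cvg_id]|exact: cvg_cst].
    apply: cvgM; last exact: cvg_cst.
    by apply: cvgM; [exact: cvg_cst|exact: cQ].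
  - apply: (lr (fun rho => (r ^+ 2 - rho ^+ 2) * (M * Q rho * uvol R n) +
      2 * r * e0 * Q rho * uvol R n)) => x.
    apply: cvgD; apply: cvgM; try exact: cvg_cst.
    + by apply: cvgB; [exact: cvg_cst|exact: exprn_continuous].
    + by apply: cvgM; [apply: cvgM; [exact: cvg_cst|exact: cQ]|exact: cvg_cst].
    + by apply: cvgM; [exact: cvg_cst|exact: cQ].
have : `|(r + r) * ID - 2 * r * Q r * I0| <= 0.
  apply/ler_addgt0Pl => e e0; rewrite addr0.
  pose K := 2 * r * Q r * uvol R n.
  have K0 : 0 <= K.
    by rewrite !mulr_ge0 ?uvol_ge0// ?Qr ?mulr_ge0 ?exprn_ge0// ltW.
  have e1 : 0 < e / (K + 1) by rewrite divr_gt0// ltr_wpDl.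
  apply: (le_trans (lim_le _ e1)).
  have -> : 2 * r * (e / (K + 1)) * Q r * uvol R n = K * (e / (K + 1)) by rewrite /K; ring.
  by rewrite mulrA ler_pdivrMr ?ltr_wpDl// mulrC ler_pM2l// lerDl.
rewrite normr_le0 => /eqP h.
have r2 : 2 * r != 0 by rewrite mulf_neq0// gt_eqF.
apply: (mulfI r2); rewrite -Qr; apply/eqP; rewrite -subr_eq0 -h; apply/eqP; ring.
Unshelve. all: by end_near. Qed.

End Divergence.

(** * Dini moduli and singular integrals *)

Section Modulus.
Variables (R : realType) (n : nat) (Om : set 'rV[R]_n) (F : 'rV[R]_n -> R).
Local Notation V := 'rV[R]_n.
Local Notation leb := (@lebesgue_measure R).
Local Notation mu := (muV R n).
Local Notation w := (modcont Om F).

Lemma modcont_ge (x y : V) (rho : R) : Om x -> Om y -> enorm (x - y) < rho ->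
  (`|F x - F y|%:E <= w rho)%E.
Proof. by move=> Ox Oy xy; apply: ereal_sup_ubound; exists x, y. Qed.

Lemma modcont_nd (a b : R) : a <= b -> (w a <= w b)%E.
Proof.
move=> ab; apply: le_ereal_sup => _ [x [y [Ox Oy xy ->]]].
by exists x, y; split => //; exact: lt_le_trans ab.
Qed.

(** The modulus is monotone, so its superlevel sets are intervals. *)
Lemma modcont_measurable (D : set (measurableTypeR R)) : measurable_fun D (w : measurableTypeR R -> \bar R).
Proof.
apply: (@measurable_funS _ _ _ _ setT) => //.
move=> _; apply: (measurability _ (ErealGenCInfty.measurableE R)) => //.
move=> _ [_ [r ->] <-]; rewrite setTI.
apply: is_interval_measurable => a b /=; rewrite !in_itv/= !andbT => ra rb c /andP[ac cb].
rewrite in_itv/= andbT; apply: (le_trans ra); exact: modcont_nd.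
Qed.

(** A point of [Om] makes the supremum range over a nonempty set; otherwise it would be -oo. *)
Lemma modcont_ge0 (rho : R) : Om 0 -> 0 < rho -> (0 <= w rho)%E.
Proof.
move=> O0 r0; apply: le_trans (modcont_ge O0 O0 (_ : enorm (0 - 0) < rho)).
  by rewrite lee_fin.
by rewrite subrr enorm0.
Qed.

Definition dini_tail (d : R) : \bar R :=
  (\int[leb]_(s in `]0%R, d[%classic) (w s * (s^-1)%:E))%E.

Lemma measurable_modcont_inv (d : R) :
  measurable_fun (`]0%R, d[%classic : set (measurableTypeR R)) (fun s => w s * (s^-1)%:E)%E.
Proof.
apply: emeasurable_funM; first exact: modcont_measurable.
apply/measurable_EFinP; apply: open_continuous_measurable_fun; first exact: interval_open.
move=> s; rewrite inE/= in_itv/= => /andP[s0 _].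
by apply: (@continuousV _ _ id); rewrite ?gt_eqF.
Qed.

Lemma modcont_inv_ge0 (d s : R) : Om 0 -> (`]0%R, d[%classic : set R) s -> (0 <= w s * (s^-1)%:E)%E.
Proof.
move=> O0; rewrite /= in_itv/= => /andP[s0 _].
by rewrite mule_ge0 ?modcont_ge0// lee_fin invr_ge0 ltW.
Qed.

(** By monotonicity the integrand is at least w(rho)/(2 rho) on ]rho, 2 rho[, an interval of length
    rho. Hence the Dini condition forces uniform continuity. *)
Lemma modcont_le_tail (rho : R) : Om 0 -> 0 < rho ->
  (w rho * (2^-1)%:E <= dini_tail (2 * rho))%E.
Proof.
move=> O0 r0.
have -> : (w rho * (2^-1)%:E)%E = (\int[leb]_(s in `]rho, (2 * rho)%R[%classic) (w rho * ((2 * rho)^-1)%:E))%E.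
  rewrite integral_cst//= lebesgue_measure_itv/= lte_fin ltr_pMl// ltr1n.
  rewrite -EFinB -muleA -EFinM; congr (_ * _%:E)%E; field; by rewrite gt_eqF.
have sub : `]rho, (2 * rho)%R[%classic `<=` (`]0%R, (2 * rho)%R[%classic : set R).
  by move=> s /=; rewrite !in_itv/= => /andP[s1 ->]; rewrite (lt_trans r0).
have mI : measurable (`]rho, (2 * rho)%R[%classic : set (measurableTypeR R)) by exact: measurable_itv.
have mJ : measurable (`]0%R, (2 * rho)%R[%classic : set (measurableTypeR R)) by exact: measurable_itv.
apply: (@le_trans _ _ (\int[leb]_(s in `]rho, (2 * rho)%R[%classic) (w s * (s^-1)%:E))%E).
  apply: ge0_le_integral => //.
  - move=> s _; rewrite mule_ge0 ?modcont_ge0// lee_fin invr_ge0 mulr_ge0// ltW//.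
  - by apply: (measurable_funS mJ sub); exact: measurable_modcont_inv.
  - move=> s; rewrite /= in_itv/= => /andP[s1 s2].
    have s0 : 0 < s by exact: lt_trans s1.
    apply: lee_pmul => //.
    + exact: modcont_ge0.
    + by rewrite lee_fin invr_ge0 mulr_ge0// ltW.
    + by apply: modcont_nd; exact: ltW.
    + by rewrite lee_fin lef_pV2 ?posrE ?mulr_gt0// ltW.
apply: ge0_subset_integral => //; first exact: measurable_modcont_inv.
by move=> s; exact: modcont_inv_ge0.
Qed.

Hypotheses (O0 : Om 0) (dF : Dini Om F).

(** Dominated convergence: the integrand restricted to ]0, de/(k+1)[ tends to 0 pointwise below the
    integrable one on ]0, de[. *)
Lemma dini_tail_small (e : R) : 0 < e -> exists2 d : R, 0 < d & (dini_tail d < e%:E)%E.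
Proof.
move=> e0; have [de [de0 hde]] := dF.
pose g (s : measurableTypeR R) := (w s * (s^-1)%:E)%E.
pose J (d : R) : set (measurableTypeR R) := `]0%R, d[%classic.
have mJ d : measurable (J d) by exact: measurable_itv.
have ig : leb.-integrable (J de) g.
  apply/integrableP; split; first exact: measurable_modcont_inv.
  apply: le_lt_trans hde; rewrite le_eqVlt; apply/orP; left; apply/eqP.
  rewrite (_ : [set rho | 0 < rho < de] = J de); last first.
    by apply/seteqP; split => s; rewrite /J/= in_itv.
  apply: eq_integral => s /set_mem sJ; rewrite gee0_abs//; exact: modcont_inv_ge0 sJ.
pose dk (k : nat) := de / k.+1%:R.
have dk0 k : 0 < dk k by rewrite divr_gt0.
have dkde k : dk k <= de by rewrite ler_pdivrMr// ler_peMr ?ler1n// ltW.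
pose f k := g \_ (J (dk k)).
have mf k : measurable_fun (J de) (f k).
  apply: (@measurable_funS _ _ _ _ setT) => //.
  apply/(measurable_restrictT _ (mJ _)); exact: measurable_modcont_inv.
have f0 : {ae leb, forall s : measurableTypeR R, J de s -> f k s @[k --> \oo] --> (cst 0%E : _ -> \bar R) s}.
  apply: aeW => s sJ.
  have s0 : 0 < s by move: sJ; rewrite /J/= in_itv/= => /andP[].
  apply: (@cvg_trans _ ((fun _ : nat => 0%E : \bar R) @ \oo)); last exact: cvg_cst.
  apply: near_eq_cvg; near=> k; rewrite /f patchE memNset// /J/= in_itv/=.
  move=> /andP[_]; apply/negP; rewrite -leNgt.
  have : harmonic k <= s / de.
    near: k; have := @cvg_harmonic R => /cvgr_le; apply; by rewrite divr_gt0.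
  by rewrite /harmonic/= ler_pdivlMr// /dk mulrC.
have fg : {ae leb, forall s k, J de s -> (`|f k s| <= g s)%E}.
  apply: aeW => s k sJ; rewrite /f patchE; case: ifPn => _.
    by rewrite gee0_abs//; exact: modcont_inv_ge0 sJ.
  by rewrite abse0; exact: modcont_inv_ge0 sJ.
have [_ _] := dominated_convergence (mJ de) mf (measurable_cst _) f0 ig fg.
rewrite integral0 => /fine_cvgP[_ /cvgr_lt /(_ e e0)] H.
have E k : (\int[leb]_(s in J de) f k s = dini_tail (dk k))%E.
  rewrite /f -integral_mkcondr /dini_tail; congr integral.
  apply/seteqP; split => s; rewrite /J/= !in_itv/=; first by case.
  by move=> /andP[s0 sk]; rewrite s0 sk (lt_le_trans sk).
have fin k : (dini_tail (dk k) \is a fin_num)%E.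
  rewrite -E; apply: integrable_fin_num => //.
  apply: (le_integrable (mJ de) (mf k) _ ig) => s sJ.
  rewrite /f patchE; case: ifPn => // _; rewrite abse0; exact: abse_ge0.
near \oo => k.
exists (dk k) => //; rewrite -(fineK (fin k)) lte_fin.
by rewrite -E; near: k; exact: H.
Unshelve. all: by end_near. Qed.

Lemma modcont_small (e : R) : 0 < e -> exists2 d : R, 0 < d & (w d < e%:E)%E.
Proof.
move=> e0; have e20 : 0 < e / 2 by rewrite divr_gt0.
have [d d0 hd] := dini_tail_small e20.
exists (d / 2); first by rewrite divr_gt0.
have d20 : 0 < d / 2 by rewrite divr_gt0.
have := modcont_le_tail O0 d20; rewrite mulrCA divff ?mulr1// => h.
have := le_lt_trans h hd; rewrite EFinM lte_pmul2r// ?lte_fin ?invr_gt0//.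
Qed.

Lemma Dini_unif_continuous (e : R) : 0 < e -> exists2 d : R, 0 < d &
  forall x y, Om x -> Om y -> enorm (x - y) < d -> `|F x - F y| < e.
Proof.
move=> e0; have [d d0 hd] := modcont_small e0; exists d => // x y Ox Oy xy.
by rewrite -lte_fin; apply: le_lt_trans hd; exact: modcont_ge.
Qed.

(** The segment from 0 to x is cut into N steps, with N independent of x and each step shorter than
    d; F changes by less than 1 along each. *)
Lemma Dini_bounded (M : R) : (forall x, Om x -> enorm x <= M) ->
  (forall x t, Om x -> 0 <= t <= 1 -> Om (t *: x)) ->
  exists2 K : R, 0 <= K & forall x, Om x -> `|F x| <= K.
Proof.
move=> OM star; have [d d0 hd] := Dini_unif_continuous ltr01.
pose N := (Num.truncn (M / d)).+1.
have N0 : 0 < (N%:R : R) by rewrite ltr0n.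
have MN : M < N%:R * d by rewrite -ltr_pdivrMr//; exact: truncnS_gt.
exists (`|F 0| + N%:R); first by rewrite addr_ge0.
move=> x Ox.
have H k : (k <= N)%N -> Om ((k%:R / N%:R) *: x) /\ `|F ((k%:R / N%:R) *: x)| <= `|F 0| + k%:R.
  elim: k => [|k IH] kN; first by rewrite mul0r scale0r addr0; split.
  have [Ok Fk] := IH (ltnW kN).
  have Ok1 : Om ((k.+1%:R / N%:R) *: x).
    apply: star => //; rewrite divr_ge0//= ler_pdivrMr// mul1r ler_nat//.
  split => //.
  have : `|F ((k.+1%:R / N%:R) *: x) - F ((k%:R / N%:R) *: x)| < 1.
    apply: hd => //; rewrite -scalerBl -mulrBl -natr1 addrAC subrr add0r enormZ.
    rewrite normrM normr1 mul1r normfV (gtr0_norm N0) mulrC ltr_pdivrMr// mulrC.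
    by apply: le_lt_trans MN; exact: OM.
  have := ler_normD (F ((k.+1%:R / N%:R) *: x) - F ((k%:R / N%:R) *: x)) (F ((k%:R / N%:R) *: x)).
  rewrite subrK -natr1; lra.
by have [_] := H N (leqnn N); rewrite divff ?gt_eqF// scale1r.
Qed.

End Modulus.

Section SingularIntegrals.
Variables (R : realType) (n : nat).
Local Notation V := 'rV[R]_n.
Local Notation leb := (@lebesgue_measure R).
Local Notation mu := (muV R n).

Lemma integrable_of_bound (A : set V) (f : V -> R) (b : R) : measurable A -> measurable_fun A f ->
  (\int[mu]_(x in A) (`|f x|%:E) <= b%:E)%E ->
  mu.-integrable A (EFin \o f) /\ `|\int[mu]_(x in A) f x| <= b.
Proof.
move=> mA mf h.
have iF : mu.-integrable A (EFin \o f).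
  apply/integrableP; split; first exact/measurable_EFinP.
  by apply: (le_lt_trans h); rewrite ltry.
split => //; apply: (le_trans (le_normr_Rintegral mA iF)).
have iN := integrable_norm iF.
rewrite -lee_fin /Rintegral fineK//; exact: integrable_fin_num iN.
Qed.

Definition radial_const : R := 2 ^+ n.+1 * uvol R n.

Lemma radial_const_ge0 : 0 <= radial_const.
Proof. by rewrite mulr_ge0// uvol_ge0. Qed.

(** [radial_bound] with weight w(s) = C s; the order 1-n is written as a product to fit the form
    w(s) |y-x|^(-n). *)
Lemma weak_singularity_bound (x : V) (d C : R) (f : V -> R) : 0 < d -> 0 <= C ->
  measurable_fun (eball x d) f -> f x = 0 ->
  (forall y, 0 < enorm (y - x) < d -> `|f y| <= C * (enorm (y - x) * enorm (y - x) ^- n)) ->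
  mu.-integrable (eball x d) (EFin \o f) /\
  `|\int[mu]_(y in eball x d) f y| <= C * (radial_const * (2 * d)).
Proof.
move=> d0 C0 mf fx hf; apply: integrable_of_bound => //; first exact: measurable_eball.
have d20 : 0 < 2 * d by rewrite mulr_gt0.
have := @radial_bound R n x d (fun y => `|f y|%:E) (fun s => (C * s)%:E) d0 _ _ _ _ _ _.
move=> H; apply: (le_trans (H _ _ _ _ _ _)).
- by apply/measurable_EFinP; exact: measurableT_comp.
- by move=> y; rewrite lee_fin.
- by rewrite fx normr0.
- by apply/measurable_EFinP; exact: measurable_funM.
- by move=> s /andP[s0 _]; rewrite lee_fin mulr_ge0// ltW.
- move=> y s yd /andP[ys _]; rewrite -EFinM lee_fin (le_trans (hf y yd))//.
  rewrite mulrA ler_wpM2r ?invr_ge0 ?exprn_ge0 ?enorm_ge0//.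
  by rewrite ler_wpM2l// ltW.
rewrite (_ : (\int[leb]_(s in _) _)%E = (C * (2 * d))%:E); last first.
  transitivity (\int[leb]_(s in `]0%R, (2 * d)%R[%classic) C%:E)%E.
    apply: eq_integral => s; rewrite inE/= in_itv/= => /andP[s0 _].
    by rewrite -EFinM mulfK// gt_eqF.
  by rewrite integral_cst//= lebesgue_measure_itv/= lte_fin d20 sube0 -EFinM.
by rewrite -EFinM lee_fin /radial_const mulrCA.
Qed.

(** [radial_bound] with weight C times the modulus of F at s: any s > |y-x| gives |F(y) - F(x)| <=
    [modcont Om F s], as both points lie in [Om]. *)
Lemma dini_singularity_bound (Om : set V) (F : V -> R) (x : V) (d C : R) (f : V -> R) :
  Om 0 -> 0 < d -> 0 <= C -> eball x d `<=` Om ->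
  measurable_fun (eball x d) f -> f x = 0 ->
  (forall y, 0 < enorm (y - x) < d -> `|f y| <= C * (`|F y - F x| * enorm (y - x) ^- n)) ->
  (\int[mu]_(y in eball x d) (`|f y|%:E) <=
   (C * radial_const)%:E * dini_tail Om F (2 * d))%E.
Proof.
move=> O0 d0 C0 xOm mf fx hf.
have := @radial_bound R n x d (fun y => `|f y|%:E) (fun s => C%:E * modcont Om F s)%E d0 _ _ _ _ _ _.
move=> H; apply: (le_trans (H _ _ _ _ _ _)).
- by apply/measurable_EFinP; exact: measurableT_comp.
- by move=> y; rewrite lee_fin.
- by rewrite fx normr0.
- by apply: measurable_funeM; exact: modcont_measurable.
- by move=> s /andP[s0 _]; rewrite mule_ge0 ?modcont_ge0.
- move=> y s /[dup] yd /andP[y0 yd'] /andP[ys _].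
  apply: (@le_trans _ _ (C%:E * `|F y - F x|%:E * (enorm (y - x) ^- n)%:E)%E).
    by rewrite -!EFinM lee_fin -mulrA; exact: hf.
  rewrite lee_wpmul2r ?lee_fin ?invr_ge0 ?exprn_ge0 ?enorm_ge0//.
  rewrite lee_wpmul2l ?lee_fin//; apply: modcont_ge => //; first exact: xOm.
  by apply: xOm; rewrite /eball/= subrr enorm0.
under eq_integral do rewrite -muleA.
rewrite ge0_integralZl//; last 2 first.
- exact: measurable_modcont_inv.
- by move=> s; exact: modcont_inv_ge0.
by rewrite muleA -EFinM /dini_tail (mulrC C).
Qed.

End SingularIntegrals.

(** * The cut-off kernel *)

Section CutoffKernel.
Variables (R : realType) (n : nat).
Local Notation V := 'rV[R]_n.
Variables (psi : V -> R) (i j : 'I_n) (eta : R -> R).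
Hypotheses (n0 : (0 < n)%N).
Hypotheses (cpsi : continuous psi) (spsi : forall x, 1 <= enorm x -> psi x = 0)
  (dpsi : forall x, pderivable psi j x) (cdpsi : continuous (pderiv psi j))
  (sdpsi : forall x, 1 <= enorm x -> pderiv psi j x = 0).
Hypotheses (ceta : forall t, 0 < t -> {for t, continuous eta})
  (deta : forall t, 0 < t -> derivable eta t 1)
  (cdeta : forall t, 0 < t -> {for t, continuous (derive1 eta)})
  (eta0 : forall t, 0 <= t <= 1 -> eta t = 0)
  (eta1 : forall t, 2 <= t -> eta t = 1)
  (deta2 : forall t, 0 < t -> `|derive1 eta t| <= 2).
Local Notation N := (Nker psi i).
Local Notation e := (evec R j).
Local Notation A := (Akern psi n.-1).
Local Notation B := (Akern (pderiv psi j)).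

Lemma NkerE x y : N x y = (x ord0 i - y ord0 i) * A x y.
Proof. by []. Qed.

Lemma Nker_diag x : N x x = 0.
Proof. by rewrite NkerE subrr mul0r. Qed.

(** The derivative of N_i when x moves along p e_j and y along q e_j. The singular terms carry the
    factor p - q, so they cancel when the (1,0) and (0,1) derivatives are added. *)
Definition Nker_dir (p q : R) (x y : V) : R :=
  (p - q) * (j == i)%:R * A x y +
  (x ord0 i - y ord0 i) * (q * B n.-1 x y + (p - q) * B n x y).

Lemma Nker_is_derive (p q : R) x y : x != y ->
  is_derive (0 : R) 1 (fun h => N (x + (h * p) *: e) (y + (h * q) *: e)) (Nker_dir p q x y).
Proof.
move=> xy.
have dA := @Akern_derive R n psi n.-1 x y j p q cpsi spsi dpsi cdpsi sdpsi xy.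
rewrite prednK// in dA.
have dl : is_derive (0 : R) 1 (fun h : R => (x ord0 i - y ord0 i) + h * ((p - q) * (j == i)%:R))
    ((p - q) * (j == i)%:R).
  have H := is_derive_mulr ((p - q) * (j == i)%:R) 0.
  have := is_deriveD (is_derive_cst (x ord0 i - y ord0 i) (0 : R) (1 : R)) H.
  by rewrite add0r.
have -> : (fun h => N (x + (h * p) *: e) (y + (h * q) *: e)) =
    (fun h : R => (x ord0 i - y ord0 i) + h * ((p - q) * (j == i)%:R)) *
    (fun h => A (x + (h * p) *: e) (y + (h * q) *: e)).
  apply/funext => h; rewrite /= NkerE !mxE eqxx eq_sym; congr (_ * _); ring.
apply: (is_derive_eq (is_deriveM dl dA)).
by rewrite /Nker_dir !mul0r !scale0r !addr0 /GRing.scale/=; ring.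
Qed.

Lemma Nker_pderivable x y : x != y -> is_derive x e (fun x' => N x' y) (Nker_dir 1 0 x y).
Proof.
move=> xy; apply/is_derive_line.
have := Nker_is_derive 1 0 xy.
by under eq_fun do rewrite mulr1 mulr0 scale0r addr0.
Qed.

Lemma continuous_coordB (p : V * V) : {for p, continuous (fun p : V * V => p.1 ord0 i - p.2 ord0 i)}.
Proof.
apply: cvgB.
  apply: (@cvg_comp _ _ _ fst (fun x : V => x ord0 i) _ (nbhs p.1)); first exact: cvg_fst.
  exact: coord_continuous.
apply: (@cvg_comp _ _ _ snd (fun x : V => x ord0 i) _ (nbhs p.2)); first exact: cvg_snd.
exact: coord_continuous.
Qed.

Lemma Nker_continuous (p : V * V) : p.1 != p.2 -> {for p, continuous (fun p => N p.1 p.2)}.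
Proof.
move: p => [x y] /= xy.
by apply: cvgM; [exact: continuous_coordB|exact: Akern_continuous].
Qed.

Lemma Nker_dir_continuous (s t : R) (p : V * V) : p.1 != p.2 ->
  {for p, continuous (fun p => Nker_dir s t p.1 p.2)}.
Proof.
move: p => [x y] /= xy.
apply: cvgD; apply: cvgM.
- exact: cvg_cst.
- exact: Akern_continuous.
- exact: continuous_coordB.
by apply: cvgD; apply: cvgM; [exact: cvg_cst|exact: Akern_continuous|exact: cvg_cst|exact: Akern_continuous].
Qed.

Definition Kcut (eps : R) (x y : V) : R := N x y * eta (enorm (x - y) / eps).

Definition Kcut_dir (eps p q : R) (x y : V) : R :=
  Nker_dir p q x y * eta (enorm (x - y) / eps) +
  N x y * ((p - q) * ((x ord0 j - y ord0 j) / enorm (x - y) / eps) * derive1 eta (enorm (x - y) / eps)).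

Lemma Kcut_near0 (eps : R) x y : 0 < eps -> enorm (x - y) <= eps -> Kcut eps x y = 0.
Proof.
move=> eps0 xy; rewrite /Kcut eta0 ?mulr0//.
by rewrite divr_ge0 ?enorm_ge0 ?(ltW eps0)//= ler_pdivrMr// mul1r.
Qed.

Lemma deta_near0 t : 0 < t < 1 -> derive1 eta t = 0.
Proof.
move=> /andP[t0 t1]; rewrite derive1E (@near_eq_derive _ _ _ eta (cst 0)); first exact: derive_cst.
near=> s; rewrite eta0//; apply/andP; split.
  by apply/ltW; near: s; exact: lt_nbhsr.
by apply/ltW; near: s; exact: lt_nbhsl.
Unshelve. all: by end_near. Qed.

Lemma deta_far t : 2 < t -> derive1 eta t = 0.
Proof.
move=> t2; rewrite derive1E (@near_eq_derive _ _ _ eta (cst 1)); first exact: derive_cst.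
near=> s; rewrite eta1//.
by apply/ltW; near: s; exact: lt_nbhsr.
Unshelve. all: by end_near. Qed.

Lemma Kcut_dir_near0 (eps p q : R) x y : 0 < eps -> enorm (x - y) < eps -> Kcut_dir eps p q x y = 0.
Proof.
move=> eps0 xy; rewrite /Kcut_dir eta0 ?mulr0 ?add0r; last first.
  by rewrite divr_ge0 ?enorm_ge0 ?(ltW eps0)//= ler_pdivrMr// mul1r ltW.
have [->|xy0] := eqVneq x y; first by rewrite Nker_diag mul0r.
rewrite deta_near0 ?mulr0//; apply/andP; split.
  by rewrite divr_gt0// enorm_gt0 subr_eq0.
by rewrite ltr_pdivrMr// mul1r.
Qed.

Lemma enorm_is_derive (z : V) (c : R) : z != 0 ->
  is_derive (0 : R) 1 (fun h => enorm (z + (h * c) *: e)) (c * (z ord0 j / enorm z)).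
Proof.
move=> z0; have z1 : 0 < enorm z by rewrite enorm_gt0.
pose m (h : R) : R := enorm z ^+ 2 + (2 * c * z ord0 j) * h + (c ^+ 2) * (h * h).
have -> : (fun h => enorm (z + (h * c) *: e)) = Num.sqrt \o m.
  apply/funext => h /=; rewrite -[LHS]ger0_norm ?enorm_ge0// -sqrtr_sqr enorm_shift_sqr.
  by congr Num.sqrt; rewrite /m; ring.
have dm : is_derive (0 : R) 1 m (2 * c * z ord0 j).
  have -> : m = cst (enorm z ^+ 2) + (2 * c * z ord0 j) \*: id + (c ^+ 2) \*: (id * id) by [].
  by apply: is_derive_eq; rewrite /GRing.scale/=; ring.
have ds : is_derive (m 0) (1 : R) Num.sqrt (2 * enorm z)^-1.
  rewrite /m !mulr0 !addr0.
  have := @is_derive1_sqrt R (enorm z ^+ 2) (exprn_gt0 2 z1).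
  by rewrite sqrtr_sqr gtr0_norm.
have H := is_derive1_comp ds dm.
apply: is_derive_eq.
by field; rewrite gt_eqF.
Qed.

(** Off the diagonal this is the product rule. On it, the cut kernel vanishes along the line for
    small h, since the two points stay within eps of each other. *)
Lemma Kcut_is_derive (eps p q : R) x y : 0 < eps ->
  is_derive (0 : R) 1 (fun h => Kcut eps (x + (h * p) *: e) (y + (h * q) *: e)) (Kcut_dir eps p q x y).
Proof.
move=> eps0.
have shift h : x + (h * p) *: e - (y + (h * q) *: e) = (x - y) + (h * (p - q)) *: e.
  by rewrite mulrBr scalerBl opprD addrACA.
have [xy|xy] := eqVneq x y.
  rewrite Kcut_dir_near0//; last by rewrite xy subrr enorm0.
  have := is_derive_cst (0 : R) (0 : R) (1 : R); apply: near_eq_is_derive.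
  have d0 : 0 < eps / (`|p - q| + 1) by rewrite divr_gt0// ltr_wpDl.
  have nde : \forall h \near (0 : R), `|h| < eps / (`|p - q| + 1).
    by apply/nbhs_ballP; exists (eps / (`|p - q| + 1)) => //= t; rewrite /ball/= sub0r normrN.
  near=> h; rewrite Kcut_near0// shift xy subrr add0r enormZ enorm_evec mulr1 normrM.
  have h1 : `|h| < eps / (`|p - q| + 1) by near: h.
  move: h1; rewrite ltr_pdivlMr ?ltr_wpDl// => h1.
  by rewrite (le_trans _ (ltW h1))// ler_wpM2l// lerDl.
have z0 : x - y != 0 by rewrite subr_eq0.
have r0 : 0 < enorm (x - y) by rewrite enorm_gt0.
have dN := Nker_is_derive p q xy.
have dr : is_derive (0 : R) 1 (fun h => enorm (x - y + (h * (p - q)) *: e) * eps^-1)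
    ((p - q) * ((x ord0 j - y ord0 j) / enorm (x - y)) * eps^-1).
  have -> : (fun h => enorm (x - y + (h * (p - q)) *: e) * eps^-1) =
     eps^-1 \*: (fun h => enorm (x - y + (h * (p - q)) *: e)).
    by apply/funext => h; rewrite mulrC.
  have := enorm_is_derive (p - q) z0 => H.
  by apply: is_derive_eq; rewrite !mxE /GRing.scale/= mulrC.
pose rho (h : R) := enorm (x - y + (h * (p - q)) *: e) * eps^-1.
have de : is_derive (rho 0) (1 : R) eta (derive1 eta (enorm (x - y) / eps)).
  rewrite /rho mul0r scale0r addr0; split; last by rewrite derive1E.
  by apply: deta; rewrite divr_gt0.
have dc := is_derive1_comp de dr.
have -> : (fun h => Kcut eps (x + (h * p) *: e) (y + (h * q) *: e)) =
   (fun h => N (x + (h * p) *: e) (y + (h * q) *: e)) *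
   (eta \o rho).
  by apply/funext => h; rewrite /Kcut shift.
apply: (is_derive_eq (is_deriveM dN dc)).
by rewrite /Kcut_dir /rho /= !mul0r !scale0r !addr0 /GRing.scale/=; ring.
Unshelve. all: by end_near. Qed.

Lemma continuous_dist (p : V * V) : {for p, continuous (fun p : V * V => enorm (p.1 - p.2))}.
Proof.
apply: (@cvg_comp _ _ _ (fun p : V * V => p.1 - p.2) (@enorm R n) _ (nbhs (p.1 - p.2))).
  by apply: cvgB; [exact: cvg_fst|exact: cvg_snd].
exact: continuous_enorm.
Qed.

Lemma near_diag0_continuous (f : V * V -> R) (eps : R) (p : V * V) : 0 < eps ->
  (forall q, enorm (q.1 - q.2) < eps -> f q = 0) -> p.1 = p.2 -> {for p, continuous f}.
Proof.
move=> eps0 f0 p12.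
have fp : f p = 0 by apply: f0; rewrite p12 subrr enorm0.
have cv : f q @[q --> p] --> (0 : R).
  apply: cvg_near_cst; near=> q; rewrite f0//; near: q.
  have := @continuous_dist p => /cvgr_lt; apply.
  by rewrite p12 subrr enorm0.
by rewrite -fp in cv; exact: cv.
Unshelve. all: by end_near. Qed.

Lemma continuous_eta_dist (f : R -> R) (eps : R) (p : V * V) : 0 < eps ->
  (forall t, 0 < t -> {for t, continuous f}) -> p.1 != p.2 ->
  {for p, continuous (fun p : V * V => f (enorm (p.1 - p.2) / eps))}.
Proof.
move=> eps0 cf p12.
apply: (@continuous_comp _ _ _ (fun p : V * V => enorm (p.1 - p.2) / eps) f).
  by apply: cvgM; [exact: continuous_dist|exact: cvg_cst].
by apply: cf; rewrite divr_gt0// enorm_gt0 subr_eq0.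
Qed.

Lemma Kcut_continuous (eps : R) : 0 < eps -> continuous (fun p : V * V => Kcut eps p.1 p.2).
Proof.
move=> eps0 p; have [p12|p12] := eqVneq p.1 p.2.
  by apply: (near_diag0_continuous eps0) => // q /ltW; exact: Kcut_near0.
by apply: cvgM; [exact: Nker_continuous|exact: continuous_eta_dist].
Qed.

Lemma Kcut_dir_continuous (eps s t : R) : 0 < eps ->
  continuous (fun p : V * V => Kcut_dir eps s t p.1 p.2).
Proof.
move=> eps0 p; have [p12|p12] := eqVneq p.1 p.2.
  by apply: (near_diag0_continuous eps0) => // q; exact: Kcut_dir_near0.
apply: cvgD; apply: cvgM.
- exact: Nker_dir_continuous.
- exact: continuous_eta_dist.
- exact: Nker_continuous.
apply: cvgM; last exact: continuous_eta_dist.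
apply: cvgM; first exact: cvg_cst.
apply: cvgM; last exact: cvg_cst.
apply: cvgM.
  apply: cvgB.
    apply: (@cvg_comp _ _ _ fst (fun x : V => x ord0 j) _ (nbhs p.1)); first exact: cvg_fst.
    exact: coord_continuous.
  apply: (@cvg_comp _ _ _ snd (fun x : V => x ord0 j) _ (nbhs p.2)); first exact: cvg_snd.
  exact: coord_continuous.
apply: cvgV; first by rewrite enorm_eq0 subr_eq0.
exact: continuous_dist.
Qed.

(** On [1,2] this is the mean value theorem starting from eta(1) = 0, over a length at most 1. *)
Lemma eta_bound t : 0 <= t -> `|eta t| <= 2.
Proof.
move=> t0; have [t2|t2] := leP 2 t; first by rewrite eta1// normr1 ler1n.
have [t1|t1] := leP t 1; first by rewrite eta0 ?normr0// t0.
have de s : s \in `]1, t[ -> is_derive s (1 : R) eta (derive1 eta s).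
  rewrite in_itv/= => /andP[s1 _]; split; last by rewrite derive1E.
  by apply: deta; exact: lt_trans s1.
have [|s] := @MVT_segment R eta (derive1 eta) 1 t (ltW t1) de.
  apply: derivable_within_continuous => s; rewrite in_itv/= => /andP[s1 _].
  by apply: deta; exact: lt_le_trans s1.
have e1 : eta 1 = 0 by apply: eta0; rewrite ler01 lexx.
rewrite in_itv/= e1 subr0 => /andP[s1 _] ->.
rewrite normrM -[leRHS]mulr1 ler_pM//; first by apply: deta2; exact: lt_le_trans s1.
by rewrite gtr0_norm ?subr_gt0//; lra.
Qed.

(** The truncation in [Akern_bound] depends on |y| but not on |x|, hence the restriction on y alone.
    The factor x_i - y_i gains one power of |x-y|, which in the derivative offsets the extra power
    of a. *)
Lemma kernel_bounds (Bd : R) : 0 <= Bd -> exists2 C : R, 0 <= C &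
  forall x y, enorm y <= Bd -> x != y ->
  [/\ `|N x y| <= C * (enorm (y - x) * enorm (y - x) ^- n),
      `|Nker_dir 1 0 x y| <= C * enorm (y - x) ^- n &
      `|(x ord0 i - y ord0 i) * B n.-1 x y| <= C * (enorm (y - x) * enorm (y - x) ^- n)].
Proof.
move=> Bd0.
have [L1 L10 bL1] := continuous_supp_bounded cpsi spsi.
have [L2 L20 bL2] := continuous_supp_bounded cdpsi sdpsi.
pose b := 1 + Bd; have b0 : 0 <= b by rewrite addr_ge0.
pose C := L1 * b ^+ n + L2 * b ^+ n + L2 * b ^+ n.+1.
have C10 : 0 <= L1 * b ^+ n by rewrite mulr_ge0 ?exprn_ge0.
have C20 : 0 <= L2 * b ^+ n by rewrite mulr_ge0 ?exprn_ge0.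
have C30 : 0 <= L2 * b ^+ n.+1 by rewrite mulr_ge0 ?exprn_ge0.
exists C => [|x y yBd xy]; first by rewrite !addr_ge0.
rewrite enormB; set r := enorm (x - y).
have r0 : 0 < r by rewrite enorm_gt0 subr_eq0.
have T m : ((1 + enorm y) / r) ^+ m <= b ^+ m * r ^- m.
  rewrite exprMn exprVn ler_wpM2r ?invr_ge0 ?exprn_ge0 ?(ltW r0)//.
  by rewrite lerXn2r ?nnegrE ?addr_ge0 ?enorm_ge0// lerD2l.
have xi : `|x ord0 i - y ord0 i| <= r by have := coord_le_enorm (x - y) i; rewrite !mxE.
have A1 : `|A x y| <= L1 * b ^+ n * r ^- n.
  have := @Akern_bound R n psi n.-1 x y L1 cpsi spsi bL1 xy; rewrite prednK// => h.
  by rewrite (le_trans h)// -mulrA ler_wpM2l.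
have B1 : `|B n.-1 x y| <= L2 * b ^+ n * r ^- n.
  have := @Akern_bound R n _ n.-1 x y L2 cdpsi sdpsi bL2 xy; rewrite prednK// => h.
  by rewrite (le_trans h)// -mulrA ler_wpM2l.
have B2 : `|B n x y| <= L2 * b ^+ n.+1 * r ^- n.+1.
  by rewrite (le_trans (@Akern_bound R n _ n x y L2 cdpsi sdpsi bL2 xy))// -mulrA ler_wpM2l.
have rn0 : 0 <= r ^- n by rewrite invr_ge0 exprn_ge0// ltW.
split.
- rewrite NkerE normrM mulrCA ler_pM// (le_trans A1)// ler_wpM2r// /C.
  by rewrite -addrA lerDl addr_ge0.
- rewrite /Nker_dir subr0 !mul1r mul0r add0r (le_trans (ler_normD _ _))//.
  apply: (@le_trans _ _ (L1 * b ^+ n * r ^- n + L2 * b ^+ n.+1 * r ^- n)).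
    apply: lerD; rewrite normrM.
      rewrite -[leRHS]mul1r ler_pM//.
      by case: (j == i); rewrite ?normr1 ?normr0.
    rewrite (_ : _ * _ * r ^- n = r * (L2 * b ^+ n.+1 * r ^- n.+1)); first exact: ler_pM.
    by rewrite [r ^+ n.+1]exprS; field; rewrite expf_neq0 gt_eqF.
  by rewrite -mulrDl ler_wpM2r// /C addrAC lerDl.
- rewrite normrM mulrCA ler_pM// (le_trans B1)// ler_wpM2r// /C.
  by rewrite -addrA addrCA lerDl addr_ge0.
Qed.

(** The point is that C does not depend on eps. In the constant 7, the 3 bounds |eta - 1| and the 4
    comes from differentiating the cut-off. *)
Lemma Kcut_dir_bounds (Bd : R) : 0 <= Bd -> exists2 C : R, 0 <= C &
  forall eps x y, 0 < eps -> enorm y <= Bd -> x != y ->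
  [/\ `|Kcut eps x y - N x y| <= C * (enorm (y - x) * enorm (y - x) ^- n),
      `|Kcut_dir eps 1 0 x y| <= C * enorm (y - x) ^- n,
      `|Kcut_dir eps 1 0 x y - Nker_dir 1 0 x y| <= C * enorm (y - x) ^- n &
      `|(x ord0 i - y ord0 i) * B n.-1 x y * eta (enorm (x - y) / eps)
         - (x ord0 i - y ord0 i) * B n.-1 x y| <= C * (enorm (y - x) * enorm (y - x) ^- n)].
Proof.
move=> Bd0; have [C C0 hC] := kernel_bounds Bd0.
exists (7 * C) => [|eps x y eps0 yBd xy]; first by rewrite mulr_ge0.
have [h1 h2 h3] := hC x y yBd xy; move: h1 h2 h3.
rewrite (enormB y); set r := enorm (x - y) => h1 h2 h3.
have r0 : 0 < r by rewrite enorm_gt0 subr_eq0.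
have t0 : 0 < r / eps by rewrite divr_gt0.
have e2 := eta_bound (ltW t0).
have e3 : `|eta (r / eps) - 1| <= 3.
  by rewrite (le_trans (ler_normB _ _))// normr1; lra.
have rn0 : 0 <= r ^- n by rewrite invr_ge0 exprn_ge0// ltW.
have cut_le a b : 0 <= b -> `|a| <= C * b -> `|a * eta (r / eps) - a| <= 7 * C * b.
  move=> b0 ab; rewrite -[X in _ - X]mulr1 -mulrBr normrM.
  apply: (@le_trans _ _ (C * b * 3)); first exact: ler_pM.
  by have := mulr_ge0 C0 b0; lra.
pose E := N x y * ((1 - 0) * ((x ord0 j - y ord0 j) / r / eps) * derive1 eta (r / eps)).
have hE : `|E| <= 4 * C * r ^- n.
  (* The derivative of eta is nonzero only for eps <= r <= 2 eps, where 1/eps <= 2/r; with |eta'| <=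
     2 this gives 4/r. *)
  have hB : `|(x ord0 j - y ord0 j) / r / eps * derive1 eta (r / eps)| <= 4 / r.
    have [re|re] := ltP r eps.
      by rewrite deta_near0 ?mulr0 ?normr0 ?divr_ge0 ?(ltW r0)// t0 ltr_pdivrMr// mul1r.
    have [re2|re2] := ltP (2 * eps) r.
      by rewrite deta_far ?mulr0 ?normr0 ?divr_ge0 ?(ltW r0)// ltr_pdivlMr.
    rewrite !normrM !normfV (gtr0_norm r0) (gtr0_norm eps0).
    apply: (@le_trans _ _ (1 * (2 / r) * 2)); last by rewrite mul1r mulrAC -natrM.
    apply: ler_pM => //; last exact: deta2.
      by rewrite !mulr_ge0 ?invr_ge0 ?(ltW r0) ?(ltW eps0).
    apply: ler_pM; rewrite ?mulr_ge0 ?invr_ge0 ?(ltW r0) ?(ltW eps0)//.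
      rewrite ler_pdivrMr// mul1r.
      by have := coord_le_enorm (x - y) j; rewrite !mxE.
    by rewrite ler_pdivlMr// mulrC ler_pdivrMr.
  rewrite /E subr0 mul1r normrM.
  apply: (@le_trans _ _ (C * (r * r ^- n) * (4 / r))); first exact: ler_pM.
  rewrite le_eqVlt; apply/orP; left; apply/eqP; field.
  by rewrite (gt_eqF r0) expf_neq0 ?gt_eqF.
split.
- by apply: cut_le; rewrite ?mulr_ge0// ltW.
- rewrite /Kcut_dir -/r -/E (le_trans (ler_normD _ _))//.
  have : `|Nker_dir 1 0 x y * eta (r / eps)| <= C * r ^- n * 2 by rewrite normrM ler_pM.
  by have := mulr_ge0 C0 rn0; lra.
- rewrite /Kcut_dir -/r -/E addrAC (le_trans (ler_normD _ _))//.
  have : `|Nker_dir 1 0 x y * eta (r / eps) - Nker_dir 1 0 x y| <= C * r ^- n * 3.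
    by rewrite -[X in _ - X]mulr1 -mulrBr normrM ler_pM.
  by lra.
- by apply: cut_le; rewrite ?mulr_ge0// ltW.
Qed.

Lemma Kcut_far (eps : R) x y : 0 < eps -> 2 * eps <= enorm (x - y) -> Kcut eps x y = N x y.
Proof. by move=> eps0 h; rewrite /Kcut eta1 ?mulr1// ler_pdivlMr. Qed.

Lemma Kcut_dir_far (eps p q : R) x y : 0 < eps -> 2 * eps < enorm (x - y) ->
  Kcut_dir eps p q x y = Nker_dir p q x y.
Proof.
move=> eps0 h; rewrite /Kcut_dir eta1 ?ler_pdivlMr ?ltW// mulr1.
by rewrite deta_far ?mulr0 ?addr0// ltr_pdivlMr.
Qed.

(* The dependence on the direction (1, 1) is through the argument of [psi] only. *)
Lemma Kcut_dir_sum (eps : R) x y :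
  Kcut_dir eps 1 0 x y + Kcut_dir eps 0 1 x y =
  (x ord0 i - y ord0 i) * B n.-1 x y * eta (enorm (x - y) / eps).
Proof. by rewrite /Kcut_dir /Nker_dir; ring. Qed.

End CutoffKernel.

(** * Changing domains of integration, derivatives from increments, uniform radii *)

Section AssemblyHelpers.
Variables (R : realType) (n : nat).
Local Notation V := 'rV[R]_n.
Local Notation mu := (muV R n).

Lemma Rintegral_supp (A B : set V) (f : V -> R) :
  (forall x, A x -> ~ B x -> f x = 0) -> (forall x, B x -> ~ A x -> f x = 0) ->
  \int[mu]_(x in A) f x = \int[mu]_(x in B) f x.
Proof.
move=> AB BA; rewrite Rintegral_mkcond [RHS]Rintegral_mkcond.
congr (Rintegral _ _ _); apply/funext => x; rewrite !patchE.
case: ifPn => [/set_mem Ax|/negP Ax]; case: ifPn => [/set_mem Bx|/negP Bx] //.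
- by apply: AB => // Bx'; apply: Bx; rewrite inE.
- by rewrite BA// => Ax'; apply: Ax; rewrite inE.
Qed.

Lemma integrable_setU_bounded (f : V -> R) (x c : V) (d r M : R) :
  measurable_fun setT f -> mu.-integrable (eball x d) (EFin \o f) ->
  (forall y, eball c r y -> d <= enorm (y - x) -> `|f y| <= M) ->
  mu.-integrable (eball c r) (EFin \o f).
Proof.
move=> mf ix fM.
have mx := measurable_eball x d; have mc := measurable_eball c r.
have -> : eball c r = (eball c r `&` eball x d) `|` (eball c r `\` eball x d).
  by rewrite setUIDK.
have i1 : mu.-integrable (eball c r `&` eball x d) (EFin \o f).
  by apply: integrableS ix => //; exact: measurableI.
have i2 : mu.-integrable (eball c r `\` eball x d) (EFin \o f).
  apply: (@integrable_bounded_ball _ _ _ _ c r M).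
  - exact: measurableD.
  - by move=> y [yc _]; exact: ltW.
  - exact: measurable_funTS.
  - by move=> y [yc /negP]; rewrite -leNgt; exact: fM.
apply/integrableP; split; first exact/measurable_EFinP/measurable_funTS.
rewrite ge0_integral_setU//.
- have /integrableP[_ h1] := i1; have /integrableP[_ h2] := i2.
  exact: lte_add_pinfty.
- exact: measurableI.
- exact: measurableD.
- by apply/measurable_EFinP; apply: measurableT_comp => //; exact: measurable_funTS.
- by rewrite disj_set2E; apply/eqP/seteqP; split => // y [[_ ?] [_]].
Qed.

Lemma is_derive_of_bound (f : R -> R) (l : R) :
  (forall e, 0 < e -> exists2 d : R, 0 < d &
     forall h, `|h| < d -> `|f h - f 0 - h * l| <= e * `|h|) ->
  is_derive (0 : R) 1 f l.
Proof.
move=> H.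
have cv : h^-1 *: ((f \o shift 0) (h *: (1 : R)) - f 0) @[h --> 0^'] --> l.
  apply/cvgrPdist_le => e e0; have [d d0 hd] := H e e0.
  near=> h.
  have h0 : h != 0 by near: h; exact: nbhs_dnbhs_neq.
  have hd' : `|h| < d by near: h; exact: dnbhs0_lt.
  rewrite /= addr0 [_%:A]mulr1 /GRing.scale/=.
  have -> : l - h^-1 * (f h - f 0) = - ((f h - f 0 - h * l) / h) by field.
  rewrite normrN normrM normfV ler_pdivrMr ?normr_gt0//; exact: hd.
by split; [apply/cvg_ex; exists l|apply/cvg_lim].
Unshelve. all: by end_near. Qed.

(** The form of the mean value inequality that survives a limit in g: only the increment of g
    appears in the conclusion. *)
Lemma MVT_bound (g dg : R -> R) (h l e : R) :
  (forall t : R, is_derive t (1 : R) g (dg t)) ->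
  (forall t : R, `|t| <= `|h| -> `|dg t - l| <= e) ->
  `|g h - g 0 - h * l| <= e * `|h|.
Proof.
move=> dgt bd.
have main : exists2 t, `|t| <= `|h| & g h - g 0 = dg t * h.
  have cg a b : {within `[a, b], continuous g}.
    by apply: derivable_within_continuous => t _; exact: ex_derive.
  have [h0|h0] := leP 0 h.
    have [t th ->] := @MVT_segment R g dg 0 h h0 (fun t _ => dgt t) (cg _ _).
    rewrite in_itv/= in th; case/andP: th => t0 th.
    by exists t; [rewrite !ger0_norm|rewrite subr0].
  have [t th E] := @MVT_segment R g dg h 0 (ltW h0) (fun t _ => dgt t) (cg _ _).
  rewrite in_itv/= in th; case/andP: th => t0 th.
  exists t; first by rewrite !ler0_norm ?lerN2// ltW.
  by rewrite -opprB E sub0r mulrN opprK.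
have [t th ->] := main.
by rewrite mulrC -mulrBr normrM mulrC ler_wpM2r//; exact: bd.
Qed.

(** Each x has a ball of some radius s in [Om]; radius s/2 then works for all points within s/2 of
    x, and compactness makes the radius common. *)
Lemma compact_unif_ball (K Om : set V) : compact K -> open Om -> K `<=` Om ->
  exists2 d : R, 0 < d & forall x, K x -> eball x d `<=` Om.
Proof.
move=> /compact_near_coveringP cK oOm KOm.
have H : \forall d \near (0 : R)^'+, K `<=` (fun x => eball x d `<=` Om).
  apply: (cK R ((0 : R)^'+) (fun d x => eball x d `<=` Om)) => x Kx.
  have [s s0 xs] : exists2 s : R, 0 < s & eball x s `<=` Om.
    by apply/(nbhs_eball x); apply: open_nbhs_nbhs; split => //; exact: KOm.
  have s20 : 0 < s / 2 by rewrite divr_gt0.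
  exists (eball x (s / 2), [set d : R | d < s / 2]).
    split; first exact: eball_nbhs.
    exact: nbhs_right_lt.
  move=> [x' d] [/= xx' ds] y yd; apply: xs; rewrite /eball/=.
  rewrite /eball/= in xx' yd.
  by rewrite (splitr s) (le_lt_trans (enorm_tri y x' x))// ltrD// (lt_trans yd).
near (0 : R)^'+ => d.
exists d; first by near: d; exact: nbhs_right_gt.
by near: d.
Unshelve. all: by end_near. Qed.

Lemma dini_tail_le (Om : set V) (F : V -> R) (a b : R) : Om 0 -> a <= b ->
  (dini_tail Om F a <= dini_tail Om F b)%E.
Proof.
move=> O0 ab; apply: ge0_subset_integral => //.
- exact: measurable_modcont_inv.
- by move=> s; exact: modcont_inv_ge0.
- by move=> s; rewrite /= !in_itv/= => /andP[-> sa]; exact: lt_le_trans ab.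
Qed.

End AssemblyHelpers.

(** * Triangle inequalities for approximations of real numbers *)

Section DistanceHelpers.
Variable R : realType.

Lemma dist_via2 (a b a' b' t : R) : `|a - b| < t / 3 -> `|a' - b'| < t / 3 ->
  `|a - a'| < t / 3 -> `|b - b'| < t.
Proof.
rewrite !ltr_norml => /andP[? ?] /andP[? ?] /andP[? ?].
by apply/andP; split; lra.
Qed.

Lemma dist_via1 (a b c t : R) : `|a - b| < t / 2 -> `|c - b| < t / 2 -> `|a - c| <= t.
Proof.
rewrite !ltr_norml ler_norml => /andP[? ?] /andP[? ?].
by apply/andP; split; lra.
Qed.

Lemma dist_increment (a b a' b' l m t : R) : `|a - a'| <= t -> `|b - b'| <= t ->
  `|a - b - l| <= m -> `|a' - b' - l| <= m + (t + t).
Proof.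
rewrite !ler_norml => /andP[? ?] /andP[? ?] /andP[? ?].
by apply/andP; split; lra.
Qed.

End DistanceHelpers.

Lemma continuous_pairl (R : realType) (n : nat) (x : 'rV[R]_n) :
  continuous (fun y : 'rV[R]_n => (x, y)).
Proof.
move=> y.
have h1 : cst x @ y --> x by exact: (@cvg_cst _ x _ (nbhs y)).
have h2 : id @ y --> y by exact: cvg_id.
exact: (cvg_pair h1 h2).
Qed.

(** * The potential and its gradient *)

Section Potential.
Variables (R : realType) (n : nat).
Local Notation V := 'rV[R]_n.
Local Notation mu := (muV R n).
Variables (psi : V -> R) (i j : 'I_n) (eta : R -> R).
Hypotheses (n0 : (0 < n)%N).
Hypotheses (cpsi : continuous psi) (spsi : forall x, 1 <= enorm x -> psi x = 0)
  (dpsi : forall x, pderivable psi j x) (cdpsi : continuous (pderiv psi j))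
  (sdpsi : forall x, 1 <= enorm x -> pderiv psi j x = 0).
Hypotheses (ceta : forall t, 0 < t -> {for t, continuous eta})
  (deta : forall t, 0 < t -> derivable eta t 1)
  (cdeta : forall t, 0 < t -> {for t, continuous (derive1 eta)})
  (eta0 : forall t, 0 <= t <= 1 -> eta t = 0)
  (eta1 : forall t, 2 <= t -> eta t = 1)
  (deta2 : forall t, 0 < t -> `|derive1 eta t| <= 2).
Variables (Om : set V) (F : V -> R) (c : V) (r K d : R).
(** [gap] is the quantitative form of the inclusion of the closure of [Om] in the ball: once 2 eps
    <= d, the cut-off is invisible on the sphere. *)
Hypotheses (oOm : open Om) (O0 : Om 0) (dF : Dini Om F)
  (K0 : 0 <= K) (bF : forall x, Om x -> `|F x| <= K)
  (r0 : 0 < r) (d0 : 0 < d)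
  (gap : forall x y, Om x -> r <= enorm (y - c) -> d <= enorm (x - y)).
Local Notation N := (Nker psi i).
Local Notation e := (evec R j).
Local Notation B := (Akern (pderiv psi j)).
Local Notation Nd := (Nker_dir psi i j).
Local Notation k := (Kcut psi i eta).
Local Notation kd := (Kcut_dir psi i j eta).
Local Notation Fe := (ext0 Om F).
Local Notation Bd := (r + enorm c).
Local Notation u := (ufun Om F psi c r i j).

Let Bd0 : 0 <= Bd.
Proof. by rewrite addr_ge0 ?enorm_ge0// ltW. Qed.

Lemma Om_sub_ball : Om `<=` eball c r.
Proof.
move=> x Ox; rewrite /eball/= ltNge; apply/negP => xr.
by have := gap Ox xr; rewrite subrr enorm0 leNgt d0.
Qed.

Lemma enorm_ceball_le y : ceball c r y -> enorm y <= Bd.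
Proof.
move=> yr; have := enormD (y - c) c; rewrite subrK => h.
by rewrite (le_trans h)// lerD2r.
Qed.

Lemma enorm_eball_le y : eball c r y -> enorm y <= Bd.
Proof. by move=> yr; apply: enorm_ceball_le; exact: ltW. Qed.

Lemma measurable_Om : measurable Om. Proof. exact: open_measurableV. Qed.

(** Measurability of F comes from the continuity that the Dini condition provides. *)
Lemma measurable_F : measurable_fun Om F.
Proof.
apply: continuous_measurableV => // x; rewrite inE => Ox.
apply/continuousVP => t t0.
have [s s0 hs] := Dini_unif_continuous O0 dF t0.
have [q q0 xq] : exists2 q : R, 0 < q & eball x q `<=` Om.
  by apply/(nbhs_eball x); apply: open_nbhs_nbhs; split.
exists (Num.min s q); first by rewrite lt_min s0.
move=> y; rewrite lt_min => /andP[ys yq].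
by apply: hs => //; [exact: xq|rewrite enormB].
Qed.

Lemma measurable_ext0F : measurable_fun setT Fe.
Proof. by rewrite ext0_patch; apply/(measurable_restrictT _ measurable_Om); exact: measurable_F. Qed.

Lemma ext0F_in x : Om x -> Fe x = F x.
Proof. by move=> Ox; rewrite /ext0 mem_set. Qed.

Lemma ext0F_notin x : ~ Om x -> Fe x = 0.
Proof. by move=> Ox; rewrite /ext0 memNset. Qed.

Lemma ext0F_bound x : `|Fe x| <= K.
Proof.
rewrite /ext0; case: ifPn => [/set_mem|_]; first exact: bF.
by rewrite normr0.
Qed.

Lemma Nker_dir_measurable (s t : R) x : measurable_fun setT (Nd s t x).
Proof.
apply: (@measurable_off_pt _ _ _ x) => y yx.
apply: (@continuous_comp _ _ _ (fun y : V => (x, y)) (fun p : V * V => Nd s t p.1 p.2)).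
  exact: continuous_pairl.
by apply: Nker_dir_continuous => //; rewrite eq_sym.
Qed.

Lemma Nker_measurable x : measurable_fun setT (N x).
Proof.
apply: (@measurable_off_pt _ _ _ x) => y yx.
apply: (@continuous_comp _ _ _ (fun y : V => (x, y)) (fun p : V * V => N p.1 p.2)).
  exact: continuous_pairl.
by apply: Nker_continuous => //; rewrite eq_sym.
Qed.

Lemma dpsi_kernel_measurable (x : V) : measurable_fun setT (fun y : V => (x ord0 i - y ord0 i) * B n.-1 x y).
Proof.
apply: measurable_funM.
  by apply: measurable_funB => //; exact: coord_measurable.
apply: (@measurable_off_pt _ _ _ x) => y yx.
apply: (@continuous_comp _ _ _ (fun y : V => (x, y)) (fun p : V * V => B n.-1 p.1 p.2)).
  exact: continuous_pairl.
by apply: Akern_continuous => //; rewrite eq_sym.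
Qed.

Lemma Kcut_continuous2 eps x : 0 < eps -> continuous (k eps x).
Proof.
move=> eps0 y.
apply: (@continuous_comp _ _ _ (fun y : V => (x, y)) (fun p : V * V => k eps p.1 p.2)).
  exact: continuous_pairl.
exact: Kcut_continuous.
Qed.

Lemma Kcut_dir_continuous2 eps s t x : 0 < eps -> continuous (kd eps s t x).
Proof.
move=> eps0 y.
apply: (@continuous_comp _ _ _ (fun y : V => (x, y)) (fun p : V * V => kd eps s t p.1 p.2)).
  exact: continuous_pairl.
exact: Kcut_dir_continuous.
Qed.

Definition dveps (eps : R) (x : V) : R := \int[mu]_(y in Om) (F y * kd eps 1 0 x y).

Lemma integrable_F_continuous (g : V -> R) : continuous g -> mu.-integrable Om (EFin \o (fun y => F y * g y)).
Proof.
move=> cg; have [M M0 bM] := compact_continuous_bounded (@compact_ceball R n c r) cg.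
apply: (@integrable_bounded_ball _ _ _ _ c r (K * M)).
- exact: measurable_Om.
- by move=> y /Om_sub_ball; exact: ltW.
- apply: measurable_funM; first exact: measurable_F.
  by apply: measurable_funTS; exact: continuous_measurableT.
- move=> y Oy; rewrite normrM ler_pM//; first exact: bF.
  by apply: bM; apply: ltW; exact: Om_sub_ball.
Qed.

Lemma vepsE eps x : 0 < eps ->
  veps Om F psi eta eps i x = \int[mu]_(y in Om) (F y * k eps x y).
Proof.
move=> eps0; rewrite /veps.
have -> : (fun y => F y * N x y * eta (enorm (x - y) / eps)) = (fun y => F y * k eps x y).
  by apply/funext => y; rewrite /Kcut mulrA.
have := integrable_F_continuous (@Kcut_continuous2 eps x eps0) => /integrableP[/measurable_EFinP mf _].
by rewrite LintE//; exact: measurable_Om.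
Qed.

(** The derivative vanishes for |x-y| < eps, so |x-y|^(-n) may be replaced by eps^(-n). The bound is
    uniform in x, as domination under the integral requires. *)
Lemma Kcut_dir_bounded eps : 0 < eps -> exists2 C : R, 0 <= C &
  forall x y, enorm y <= Bd -> `|kd eps 1 0 x y| <= C.
Proof.
move=> eps0.
have [C C0 hC] := Kcut_dir_bounds i n0 cpsi spsi cdpsi sdpsi deta eta0 eta1 deta2 Bd0.
exists (C * eps ^- n) => [|x y yB]; first by rewrite mulr_ge0// invr_ge0 exprn_ge0// ltW.
have [xy|xy] := ltP (enorm (x - y)) eps.
  by rewrite Kcut_dir_near0// normr0 mulr_ge0// invr_ge0 exprn_ge0// ltW.
have xy0 : x != y by rewrite -subr_eq0 -enorm_gt0 (lt_le_trans eps0).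
have [_ h _ _] := hC eps x y eps0 yB xy0.
rewrite (le_trans h)// ler_wpM2l// enormB lef_pV2 ?posrE ?exprn_gt0//.
  by rewrite lerXn2r ?nnegrE ?enorm_ge0 ?(ltW eps0).
by rewrite (lt_le_trans eps0).
Qed.

Lemma veps_is_derive eps x : 0 < eps -> is_derive x e (veps Om F psi eta eps i) (dveps eps x).
Proof.
move=> eps0; apply/is_derive_line.
have [C C0 hC] := Kcut_dir_bounded eps0.
have I0 : (`]- 1, 1[%classic : set R) 0 by rewrite /= in_itv/= oppr_lt0 ltr01.
pose f (h : R) (y : V) : R := F y * k eps (x + h *: e) y.
have fd (h : R) (y : V) : is_derive h (1 : R) (f ^~ y : R -> R) (F y * kd eps 1 0 (x + h *: e) y : R).
  have H : is_derive (x + h *: e) e (fun x => k eps x y) (kd eps 1 0 (x + h *: e) y).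
    apply/is_derive_line.
    have := @Kcut_is_derive R n psi i j eta n0 cpsi spsi dpsi cdpsi sdpsi deta eta0 eps 1 0 (x + h *: e) y eps0.
    by under eq_fun do rewrite mulr1 mulr0 scale0r addr0.
  have H2 := is_derive_line_at H.
  have -> : f ^~ y = F y \*: (fun h => k eps (x + h *: e) y) by [].
  exact: is_deriveZ.
have d1f h y : partial1of2 f h y = F y * kd eps 1 0 (x + h *: e) y.
  by rewrite partial1of2E; have [] := fd h y.
have intf h : (`]- 1, 1[%classic : set R) h -> mu.-integrable Om (EFin \o f h).
  by move=> _; apply: integrable_F_continuous; exact: Kcut_continuous2.
have intG : mu.-integrable Om (EFin \o (fun _ : V => K * C)).
  apply: (@integrable_bounded_ball _ _ _ _ c r (K * C)) => //; first exact: measurable_Om.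
    by move=> y /Om_sub_ball; exact: ltW.
  by move=> y _; rewrite ger0_norm// mulr_ge0.
have G0 (y : V) : 0 <= K * C by rewrite mulr_ge0.
have GB h (y : V) : (`]- 1, 1[%classic : set R) h -> Om y -> `|partial1of2 f h y| <= K * C.
  move=> _ Oy; rewrite d1f normrM ler_pM//; first exact: bF.
  by apply: hC; apply: enorm_eball_le; exact: Om_sub_ball.
have D1 := derivable_under_integral measurable_Om I0 intf (fun h y _ _ => @ex_derive _ _ _ _ _ _ _ (fd h y)) G0 intG GB.
have D2 := differentiation_under_integral measurable_Om I0 intf (fun h y _ _ => @ex_derive _ _ _ _ _ _ _ (fd h y)) G0 intG GB.
have -> : (fun h => veps Om F psi eta eps i (x + h *: e)) = (fun h => \int[mu]_(y in Om) f h y).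
  by apply/funext => h; rewrite vepsE.
split => //; rewrite -derive1E D2 /dveps.
by apply: eq_Rintegral => y _; rewrite d1f scale0r addr0.
Qed.

Lemma dveps_continuous eps : 0 < eps -> continuous (dveps eps).
Proof.
move=> eps0 x.
have [v vE] : exists v : R, mu Om = v%:E.
  have fin : (mu Om < +oo)%E.
    apply: (le_lt_trans _ (muV_ceball_fin c r)); apply: le_measure; rewrite ?inE.
    - exact: measurable_Om.
    - exact: measurable_ceball.
    - by move=> y /Om_sub_ball; exact: ltW.
  by exists (fine (mu Om)); rewrite fineK// ge0_fin_numE.
have v0 : 0 <= v by rewrite -lee_fin -vE.
apply/continuousVP => t t0; apply/(nbhs_eball x).
(* The added 1 covers the case K v = 0 and makes the final inequality strict. *)
have t1 : 0 < t / (K * v + 1) by rewrite divr_gt0// ltr_wpDl// mulr_ge0.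
have ck y : ceball c r y -> {for (x, y), continuous (fun p : V * V => kd eps 1 0 p.1 p.2)}.
  by move=> _; exact: Kcut_dir_continuous.
have := compact_unif_continuous (@compact_ceball R n c r) ck t1.
apply: filterS => x' hx'.
rewrite /dveps -RintegralB; [|exact: measurable_Om|exact: integrable_F_continuous (@Kcut_dir_continuous2 _ _ _ _ eps0)|
  exact: integrable_F_continuous (@Kcut_dir_continuous2 _ _ _ _ eps0)].
have E : (fun y => F y * kd eps 1 0 x y - F y * kd eps 1 0 x' y) =
   (fun y => F y * (kd eps 1 0 x y - kd eps 1 0 x' y)) by apply/funext => y; rewrite mulrBr.
rewrite E.
apply: (@le_lt_trans _ _ (K * (t / (K * v + 1)) * v)).
  apply: norm_Rintegral_ball => //; first exact: measurable_Om.
    by apply: (@integrable_F_continuous (fun y => kd eps 1 0 x y - kd eps 1 0 x' y)) => y;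
      apply: (@continuousB _ _ _ (kd eps 1 0 x) (kd eps 1 0 x') y); exact: Kcut_dir_continuous2.
  move=> y Oy; rewrite normrM ler_pM//; first exact: bF.
  by apply/ltW; apply: hx'; apply: ltW; exact: Om_sub_ball.
have -> : K * (t / (K * v + 1)) * v = t * (K * v / (K * v + 1)) by ring.
rewrite gtr_pMr// ltr_pdivrMr ?ltr_wpDl ?mulr_ge0// mul1r ltrDl//.
Qed.

Lemma eball_sub_shift (x : V) : Om x -> eball c r `<=` eball x (2 * r).
Proof.
move=> /Om_sub_ball xr y yr; rewrite /eball/= in xr yr *.
by rewrite (le_lt_trans (enorm_tri y c x))// (enormB c) mulr2n mulrDl mul1r ltrD.
Qed.

Lemma enorm_shift_ball_le (x y : V) : eball x (2 * r) y -> enorm y <= 2 * r + enorm x.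
Proof.
move=> yr; have := enormD (y - x) x; rewrite subrK => h.
by rewrite (le_trans h)// lerD2r ltW.
Qed.

Lemma neq_of_enorm (x y : V) : 0 < enorm (y - x) -> x != y.
Proof. by rewrite enorm_gt0 subr_eq0 eq_sym. Qed.

Definition dini_kernel (x y : V) : R := (Fe y - Fe x) * Nd 1 0 x y.
Definition dpsi_kernel (x y : V) : R := (x ord0 i - y ord0 i) * B n.-1 x y.

(** On the diagonal the factor F(y) - F(x) vanishes, so the value of [pderiv] there does not
    matter. *)
Lemma u_int1E x : u_int1 Fe psi i j x = dini_kernel x.
Proof.
apply/funext => y; rewrite /u_int1 /dini_kernel.
have [->|xy] := eqVneq x y; first by rewrite subrr !mul0r.
by congr (_ * _); have [_ <-] := @Nker_pderivable R n psi i j n0 cpsi spsi dpsi cdpsi sdpsi x y xy.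
Qed.

Lemma u_int2E x : u_int2 psi i j x = dpsi_kernel x. Proof. by []. Qed.

Lemma dini_kernel_measurable x : measurable_fun setT (dini_kernel x).
Proof.
apply: measurable_funM; last exact: Nker_dir_measurable.
by apply: measurable_funB => //; exact: measurable_ext0F.
Qed.

Lemma dini_kernel_integrable x : Om x -> mu.-integrable (eball c r) (EFin \o dini_kernel x).
Proof.
move=> Ox; have [C C0 hC] := kernel_bounds i n0 cpsi spsi cdpsi sdpsi Bd0.
have [q q0 xq] : exists2 q : R, 0 < q & eball x q `<=` Om.
  by apply/(nbhs_eball x); apply: open_nbhs_nbhs; split.
have [s s0 hs] := dini_tail_small O0 dF ltr01.
(* Inside radius t the Dini bound applies: the ball lies in [Om], and the tail is taken at 2t <= s.
   Outside, the kernel is bounded by C t^(-n). *)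
pose t := Num.min q (s / 2).
have t0 : 0 < t by rewrite lt_min q0 divr_gt0.
have xt : eball x t `<=` Om.
  by move=> y yt; apply: xq; rewrite /eball/= (lt_le_trans yt)// ge_min lexx.
have mt := measurable_eball x t.
have mw : measurable_fun (eball x t) (dini_kernel x) by apply: measurable_funTS; exact: dini_kernel_measurable.
have wx : dini_kernel x x = 0 by rewrite /dini_kernel subrr mul0r.
have hb y : 0 < enorm (y - x) < t -> `|dini_kernel x y| <= C * (`|F y - F x| * enorm (y - x) ^- n).
  move=> /andP[y0 yt]; have Oy : Om y by apply: xt.
  have [_ h _] := hC x y (enorm_eball_le (Om_sub_ball Oy)) (neq_of_enorm y0).
  by rewrite /dini_kernel !ext0F_in// normrM mulrCA ler_wpM2l.
have h := dini_singularity_bound O0 t0 C0 xt mw wx hb.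
have h2 : (\int[mu]_(y in eball x t) `|dini_kernel x y|%:E <= (C * radial_const R n)%:E)%E.
  apply: (le_trans h); rewrite -[leRHS]mule1; apply: lee_wpmul2l.
    by rewrite lee_fin mulr_ge0// radial_const_ge0.
  apply: (le_trans _ (ltW hs)); apply: dini_tail_le => //.
  by rewrite mulrC -ler_pdivlMr// ge_min lexx orbT.
have [iw _] := integrable_of_bound mt mw h2.
apply: (@integrable_setU_bounded _ _ _ x c t r (K * 2 * (C * t ^- n))) => //.
  exact: dini_kernel_measurable.
move=> y yr ty; have y0 : 0 < enorm (y - x) by exact: lt_le_trans ty.
have [_ h3 _] := hC x y (enorm_eball_le yr) (neq_of_enorm y0).
rewrite /dini_kernel normrM ler_pM//.
  by rewrite (le_trans (ler_normB _ _))//; have := ext0F_bound x; have := ext0F_bound y; lra.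
rewrite (le_trans h3)// ler_wpM2l// lef_pV2 ?posrE ?exprn_gt0//.
by rewrite lerXn2r ?nnegrE ?(ltW t0) ?(ltW y0).
Qed.

(** The ball is enclosed in one of radius 2r centred at x, so that the weak singularity sits at the
    centre. *)
Lemma dpsi_kernel_integrable x : Om x -> mu.-integrable (eball c r) (EFin \o dpsi_kernel x).
Proof.
move=> Ox; have b0 : 0 <= 2 * r + enorm x by rewrite addr_ge0 ?enorm_ge0// mulr_ge0// ltW.
have [C C0 hC] := kernel_bounds i n0 cpsi spsi cdpsi sdpsi b0.
apply: (@integrableS _ _ _ _ (eball x (2 * r))); [exact: measurable_eball|
  exact: measurable_eball|exact: eball_sub_shift|].
have r2 : 0 < 2 * r by rewrite mulr_gt0.
have mw : measurable_fun (eball x (2 * r)) (dpsi_kernel x) by apply: measurable_funTS; exact: dpsi_kernel_measurable.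
have wx : dpsi_kernel x x = 0 by rewrite /dpsi_kernel subrr mul0r.
have hb y : 0 < enorm (y - x) < 2 * r -> `|dpsi_kernel x y| <= C * (enorm (y - x) * enorm (y - x) ^- n).
  move=> /andP[y0 yt].
  by have [_ _ h] := hC x y (enorm_shift_ball_le yt) (neq_of_enorm y0).
by have [] := weak_singularity_bound r2 C0 mw wx hb.
Qed.

Lemma F_Nker_integrable x : Om x -> mu.-integrable Om (EFin \o (fun y => F y * N x y)).
Proof.
move=> Ox; have b0 : 0 <= 2 * r + enorm x by rewrite addr_ge0 ?enorm_ge0// mulr_ge0// ltW.
have [C C0 hC] := kernel_bounds i n0 cpsi spsi cdpsi sdpsi b0.
have r2 : 0 < 2 * r by rewrite mulr_gt0.
have H : mu.-integrable Om (EFin \o (fun y => Fe y * N x y)).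
  apply: (@integrableS _ _ _ _ (eball x (2 * r))); [exact: measurable_eball|exact: measurable_Om| |].
    by move=> y Oy; apply: eball_sub_shift => //; exact: Om_sub_ball.
  have mw : measurable_fun (eball x (2 * r)) (fun y => Fe y * N x y).
    by apply: measurable_funTS; apply: measurable_funM; [exact: measurable_ext0F|exact: Nker_measurable].
  have wx : Fe x * N x x = 0 by rewrite Nker_diag mulr0.
  have hb y : 0 < enorm (y - x) < 2 * r -> `|Fe y * N x y| <= K * C * (enorm (y - x) * enorm (y - x) ^- n).
    move=> /andP[y0 yt]; have [h _ _] := hC x y (enorm_shift_ball_le yt) (neq_of_enorm y0).
    by rewrite normrM -mulrA ler_pM// ext0F_bound.
  by have [] := weak_singularity_bound r2 (mulr_ge0 K0 C0) mw wx hb.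
apply: eq_integrable H; first exact: measurable_Om.
by move=> y /set_mem Oy; rewrite /= ext0F_in.
Qed.

(** Points of the sphere are at distance at least d >= 2 eps from x, where the cut kernel equals
    N_i. At z = 0 both sides vanish through the normal component. *)
Lemma sphere_pullE eps x : 0 < eps -> 2 * eps <= d -> Om x ->
  sphere_pull c r (u_int3 psi c r i j x) = cone_pull j (k eps x) c r.
Proof.
move=> eps0 ed Ox; apply/funext => z.
rewrite /sphere_pull /cone_pull /u_int3.
have [->|z0] := eqVneq z 0; first by rewrite !mxE !(mulr0, mul0r, addr0, subrr).
have z1 : 0 < enorm z by rewrite enorm_gt0.
rewrite Kcut_far//.
  by rewrite !mxE; congr (_ * _); field; rewrite !gt_eqF.
apply: (le_trans ed); apply: gap => //.
by rewrite addrAC subrr add0r enormZ gtr0_norm ?divr_gt0// divfK// gt_eqF.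
Qed.

Lemma Kcut_bounded eps x : 0 < eps -> exists2 M : R, 0 <= M & forall y, ceball c r y -> `|k eps x y| <= M.
Proof.
by move=> eps0; apply: compact_continuous_bounded; [exact: compact_ceball|exact: Kcut_continuous2].
Qed.

Lemma cone_pull_Kcut_integrable eps x : 0 < eps ->
  mu.-integrable (eball 0 1) (EFin \o cone_pull j (k eps x) c r).
Proof.
move=> eps0; have [M M0 hM] := Kcut_bounded x eps0.
apply: (@integrable_bounded_ball _ _ _ _ 0 1 M).
- exact: measurable_eball.
- by move=> y; exact: ltW.
- by apply: measurable_funTS; apply: measurable_cone_pull; exact: Kcut_continuous2.
- by move=> y _; exact: cone_pull_bound.
Qed.

Lemma Kcut_is_derive2 eps x y : 0 < eps -> is_derive y e (k eps x) (kd eps 0 1 x y).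
Proof.
move=> eps0; apply/is_derive_line.
have := @Kcut_is_derive R n psi i j eta n0 cpsi spsi dpsi cdpsi sdpsi deta eta0 eps 0 1 x y eps0.
by under eq_fun do rewrite mulr1 mulr0 scale0r addr0.
Qed.

(** The divergence theorem applies to y -> [Kcut] because the cut-off makes it C^1 across y = x as
    well. *)
Lemma sphere_intE eps x : 0 < eps -> 2 * eps <= d -> Om x ->
  sphere_int c r (u_int3 psi c r i j x) = \int[mu]_(y in eball c r) kd eps 0 1 x y.
Proof.
move=> eps0 ed Ox; rewrite /sphere_int (sphere_pullE eps0 ed Ox).
have kdE : pderiv (k eps x) j = kd eps 0 1 x.
  by apply/funext => y; have [_ <-] := Kcut_is_derive2 x y eps0.
rewrite LintE; [|exact: measurable_eball|apply: measurable_funTS; apply: measurable_cone_pull; exact: Kcut_continuous2].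
rewrite -kdE (@ball_divergence R n j (k eps x)) //.
- exact: Kcut_continuous2.
- by move=> y; have [] := Kcut_is_derive2 x y eps0.
- by rewrite kdE; exact: Kcut_dir_continuous2.
Qed.

(** The left side does not contain eps: the boundary term is represented through any sufficiently
    small cut-off, in particular the one used in [dveps eps]. *)
Lemma ufunE eps x : 0 < eps -> 2 * eps <= d -> Om x ->
  u x = \int[mu]_(y in eball c r) dini_kernel x y + Fe x * \int[mu]_(y in eball c r) dpsi_kernel x y
    - Fe x * \int[mu]_(y in eball c r) kd eps 0 1 x y.
Proof.
move=> eps0 ed Ox; have mb := measurable_eball c r.
rewrite /ufun u_int1E u_int2E (sphere_intE eps0 ed Ox) !LintE//.
- by apply: measurable_funTS; exact: dpsi_kernel_measurable.
- by apply: measurable_funTS; exact: dini_kernel_measurable.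
Qed.

Lemma Kcut_dir_integrable eps s t x : 0 < eps -> mu.-integrable (eball c r) (EFin \o kd eps s t x).
Proof.
move=> eps0; have ck := @Kcut_dir_continuous2 eps s t x eps0.
have [M M0 bM] := compact_continuous_bounded (@compact_ceball R n c r) ck.
apply: (@integrable_bounded_ball _ _ _ _ c r M).
- exact: measurable_eball.
- by move=> y; exact: ltW.
- by apply: measurable_funTS; exact: continuous_measurableT.
- by move=> y /ltW yr; exact: bM.
Qed.

Lemma F_Kcut_dir_integrable eps x : 0 < eps ->
  mu.-integrable (eball c r) (EFin \o (fun y => (Fe y - Fe x) * kd eps 1 0 x y)).
Proof.
move=> eps0; have ck := @Kcut_dir_continuous2 eps 1 0 x eps0.
have [M M0 bM] := compact_continuous_bounded (@compact_ceball R n c r) ck.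
apply: (@integrable_bounded_ball _ _ _ _ c r (K * 2 * M)).
- exact: measurable_eball.
- by move=> y; exact: ltW.
- apply: measurable_funTS; apply: measurable_funM; last exact: continuous_measurableT.
  by apply: measurable_funB => //; exact: measurable_ext0F.
- move=> y /ltW yr; rewrite normrM ler_pM//; last exact: bM.
  by rewrite (le_trans (ler_normB _ _))//; have := ext0F_bound x; have := ext0F_bound y; lra.
Qed.

Lemma dvepsE eps x : 0 < eps -> Om x ->
  dveps eps x = \int[mu]_(y in eball c r) ((Fe y - Fe x) * kd eps 1 0 x y)
    + Fe x * \int[mu]_(y in eball c r) kd eps 1 0 x y.
Proof.
move=> eps0 Ox; have mb := measurable_eball c r.
have ik := @Kcut_dir_integrable eps 1 0 x eps0.
rewrite -RintegralZl// -RintegralD//; last 2 first.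
- exact: F_Kcut_dir_integrable.
- have -> : EFin \o (fun y => Fe x * kd eps 1 0 x y) =
      (fun y => (Fe x)%:E * (EFin \o kd eps 1 0 x) y)%E by apply/funext => y; rewrite /= EFinM.
  exact: integrableZl.
rewrite /dveps.
have -> : \int[mu]_(y in Om) (F y * kd eps 1 0 x y) = \int[mu]_(y in Om) (Fe y * kd eps 1 0 x y).
  by apply: eq_Rintegral => y /set_mem Oy; rewrite ext0F_in.
(* The extension of F by 0 allows integrating over the whole ball, where F(x) can be split off. *)
rewrite (@Rintegral_supp _ _ Om (eball c r)).
- by apply: eq_Rintegral => y _; ring.
- by move=> y /Om_sub_ball.
- by move=> y _ Oy; rewrite ext0F_notin// mul0r.
Qed.

Definition dpsi_kernel_cut (eps : R) (x y : V) : R := dpsi_kernel x y * eta (enorm (x - y) / eps).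

Lemma dpsi_kernel_cutE eps x y : dpsi_kernel_cut eps x y = kd eps 1 0 x y + kd eps 0 1 x y.
Proof. by rewrite Kcut_dir_sum. Qed.

Lemma dpsi_kernel_cut_integrable eps x : 0 < eps -> mu.-integrable (eball c r) (EFin \o dpsi_kernel_cut eps x).
Proof.
move=> eps0; have mb := measurable_eball c r.
have -> : EFin \o dpsi_kernel_cut eps x = ((EFin \o kd eps 1 0 x) \+ (EFin \o kd eps 0 1 x))%E.
  by apply/funext => y; rewrite /= dpsi_kernel_cutE EFinD.
by apply: integrableD => //; exact: Kcut_dir_integrable.
Qed.

(* The boundary term of [u] cancels against the derivative of the cut-off kernel
   in [y], so that only integrals over the ball of radius [3 eps] remain. *)
Lemma dveps_sub_ufun eps x : 0 < eps -> 2 * eps <= d -> Om x -> eball x (3 * eps) `<=` Om ->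
  dveps eps x - u x =
    \int[mu]_(y in eball x (3 * eps)) ((Fe y - Fe x) * (kd eps 1 0 x y - Nd 1 0 x y))
    + Fe x * \int[mu]_(y in eball x (3 * eps)) (dpsi_kernel_cut eps x y - dpsi_kernel x y).
Proof.
move=> eps0 ed Ox xO; have mb := measurable_eball c r.
(* Radius 3 eps gives the strict inequality under which [Kcut_dir_far] removes the derivative of
   eta. *)
have e3 y : ~ eball x (3 * eps) y -> 2 * eps < enorm (x - y).
  by move=> /negP; rewrite /eball/= -leNgt enormB => h; rewrite (lt_le_trans _ h)// ltr_pM2r// ltr_nat.
have sub : eball x (3 * eps) `<=` eball c r by move=> y /xO /Om_sub_ball.
rewrite -(@Rintegral_supp _ _ (eball c r) (eball x (3 * eps))
  (fun y => (Fe y - Fe x) * (kd eps 1 0 x y - Nd 1 0 x y))); last 2 first.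
- by move=> y _ /e3 h; rewrite Kcut_dir_far// subrr mulr0.
- by move=> y /sub.
rewrite -(@Rintegral_supp _ _ (eball c r) (eball x (3 * eps)) (fun y => dpsi_kernel_cut eps x y - dpsi_kernel x y)); last 2 first.
- by move=> y _ /e3 h; rewrite /dpsi_kernel_cut eta1 ?mulr1 ?subrr// ler_pdivlMr// ltW.
- by move=> y /sub.
rewrite (ufunE eps0 ed Ox) (dvepsE eps0 Ox).
have i1 := @F_Kcut_dir_integrable eps x eps0.
have i2 := dini_kernel_integrable Ox.
have i3 := dpsi_kernel_integrable Ox.
have i4 := @dpsi_kernel_cut_integrable eps x eps0.
have i5 := @Kcut_dir_integrable eps 1 0 x eps0.
have i6 := @Kcut_dir_integrable eps 0 1 x eps0.
have -> : \int[mu]_(y in eball c r) ((Fe y - Fe x) * (kd eps 1 0 x y - Nd 1 0 x y)) =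
   \int[mu]_(y in eball c r) ((Fe y - Fe x) * kd eps 1 0 x y) - \int[mu]_(y in eball c r) dini_kernel x y.
  by rewrite -RintegralB//; apply: eq_Rintegral => y _; rewrite mulrBr.
rewrite RintegralB//.
have -> : \int[mu]_(y in eball c r) dpsi_kernel_cut eps x y =
   \int[mu]_(y in eball c r) kd eps 1 0 x y + \int[mu]_(y in eball c r) kd eps 0 1 x y.
  by rewrite -RintegralD//; apply: eq_Rintegral => y _; rewrite dpsi_kernel_cutE.
ring.
Qed.

(** The first integral is controlled by the Dini tail at 2 * 3 eps, the second by a weak singularity
    on a ball of radius 3 eps. C depends on neither x nor eps. *)
Lemma dveps_sub_ufun_bound : exists2 C : R, 0 <= C & forall eps x tau, 0 < eps -> 2 * eps <= d -> Om x ->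
  eball x (3 * eps) `<=` Om -> (dini_tail Om F (6 * eps) <= tau%:E)%E -> 0 <= tau ->
  `|dveps eps x - u x| <= C * (tau + eps).
Proof.
have [C C0 hC] := Kcut_dir_bounds i n0 cpsi spsi cdpsi sdpsi deta eta0 eta1 deta2 Bd0.
have rc0 := @radial_const_ge0 R n.
pose D := C * radial_const R n; have D0 : 0 <= D by rewrite mulr_ge0.
exists (D * (1 + 6 * K)) => [|eps x tau eps0 ed Ox xO ht tau0].
  by rewrite mulr_ge0// addr_ge0// mulr_ge0.
rewrite (dveps_sub_ufun eps0 ed Ox xO).
have e30 : 0 < 3 * eps by rewrite mulr_gt0.
have bO y : eball x (3 * eps) y -> enorm y <= Bd by move=> /xO /Om_sub_ball; exact: enorm_eball_le.
have mt := measurable_eball x (3 * eps).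
have h1 : `|\int[mu]_(y in eball x (3 * eps)) ((Fe y - Fe x) * (kd eps 1 0 x y - Nd 1 0 x y))| <= D * tau.
  set f := fun y => (Fe y - Fe x) * (kd eps 1 0 x y - Nd 1 0 x y).
  have mf : measurable_fun (eball x (3 * eps)) f.
    apply: measurable_funTS; apply: measurable_funM.
      by apply: measurable_funB => //; exact: measurable_ext0F.
    apply: measurable_funB; last exact: Nker_dir_measurable.
    by apply: continuous_measurableT; exact: Kcut_dir_continuous2.
  have fx : f x = 0 by rewrite /f subrr mul0r.
  have hb y : 0 < enorm (y - x) < 3 * eps -> `|f y| <= C * (`|F y - F x| * enorm (y - x) ^- n).
    move=> /andP[y0 yt]; have Oy := xO _ yt.
    have [_ _ h _] := hC eps x y eps0 (bO _ yt) (neq_of_enorm y0).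
    by rewrite /f !ext0F_in// normrM mulrCA ler_wpM2l.
  have h := dini_singularity_bound O0 e30 C0 xO mf fx hb.
  apply: (integrable_of_bound mt mf _).2; apply: (le_trans h); rewrite [(_ * tau)%:E]EFinM.
  apply: lee_wpmul2l; first by rewrite lee_fin.
  by rewrite mulrA -natrM.
have h2 : `|\int[mu]_(y in eball x (3 * eps)) (dpsi_kernel_cut eps x y - dpsi_kernel x y)| <= D * (6 * eps).
  set f := fun y => dpsi_kernel_cut eps x y - dpsi_kernel x y.
  have mf : measurable_fun (eball x (3 * eps)) f.
    apply: measurable_funTS; apply: measurable_funB; last exact: dpsi_kernel_measurable.
    have -> : dpsi_kernel_cut eps x = kd eps 1 0 x \+ kd eps 0 1 x by apply/funext => y; rewrite dpsi_kernel_cutE.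
    by apply: measurable_funD; apply: continuous_measurableT; exact: Kcut_dir_continuous2.
  have fx : f x = 0 by rewrite /f /dpsi_kernel_cut /dpsi_kernel subrr !mul0r subrr.
  have hb y : 0 < enorm (y - x) < 3 * eps -> `|f y| <= C * (enorm (y - x) * enorm (y - x) ^- n).
    move=> /andP[y0 yt].
    by have [_ _ _ h] := hC eps x y eps0 (bO _ yt) (neq_of_enorm y0).
  have [_ h] := weak_singularity_bound e30 C0 mf fx hb.
  by apply: (le_trans h); rewrite le_eqVlt; apply/orP; left; apply/eqP; rewrite /D; ring.
rewrite (le_trans (ler_normD _ _))//.
apply: (@le_trans _ _ (D * tau + K * (D * (6 * eps)))).
  by apply: lerD => //; rewrite normrM ler_pM// ext0F_bound.
rewrite -subr_ge0 (_ : _ - _ = D * eps + D * (6 * K) * tau); last by ring.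
apply: addr_ge0; first by rewrite mulr_ge0// ltW.
by do 2 apply: mulr_ge0 => //; rewrite mulr_ge0.
Qed.

Lemma dveps_unif_cvg (q t : R) : 0 < q -> 0 < t -> exists2 D : R, 0 < D &
  forall eps x, 0 < eps < D -> Om x -> eball x q `<=` Om -> `|dveps eps x - u x| < t.
Proof.
move=> q0 t0; have [C C0 hC] := dveps_sub_ufun_bound.
have C1 : 0 < C + 1 by rewrite ltr_wpDl.
(* With eps <= tau the bound C(tau + eps) is at most t C/(C+1) < t. *)
pose tau := t / (2 * (C + 1)); have tau0 : 0 < tau by rewrite divr_gt0// mulr_gt0.
have [s s0 hs] := dini_tail_small O0 dF tau0.
(* In turn: 3 eps < q, so the ball stays in [Om]; 2 eps < d; 6 eps < s for the Dini tail; eps <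
   tau. *)
exists (Num.min (Num.min (q / 3) (d / 2)) (Num.min (s / 6) tau)).
  by rewrite !lt_min tau0 ?andbT; apply/andP; split; [apply/andP; split|]; rewrite divr_gt0.
move=> eps x /andP[eps0]; rewrite !lt_min => /andP[/andP[e1 e2] /andP[e3 e4]] Ox xq.
have h := hC eps x tau eps0 _ Ox _ _ (ltW tau0).
apply: (le_lt_trans (h _ _ _)).
- by rewrite mulrC -ler_pdivlMr// ltW.
- move=> y yt; apply: xq; rewrite /eball/= (lt_trans yt)// mulrC -ltr_pdivlMr//.
- apply: (le_trans _ (ltW hs)); apply: dini_tail_le => //.
  by rewrite mulrC -ler_pdivlMr// ltW.
- apply: (@le_lt_trans _ _ (C * (tau + tau))); first by rewrite ler_wpM2l// lerD2l ltW.
  rewrite (_ : C * (tau + tau) = C / (C + 1) * t); last by rewrite /tau; field; rewrite gt_eqF.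
  by rewrite gtr_pMl// ltr_pdivrMr// mul1r ltrDl.
Qed.

Lemma Om_ball x : Om x -> exists2 q : R, 0 < q & forall y, enorm (y - x) < q -> eball y q `<=` Om.
Proof.
move=> Ox; have [q q0 xq] : exists2 q : R, 0 < q & eball x q `<=` Om.
  by apply/(nbhs_eball x); apply: open_nbhs_nbhs; split.
exists (q / 2) => [|y yx z]; first by rewrite divr_gt0.
rewrite /eball/= => zy; apply: xq; rewrite /eball/= (le_lt_trans (enorm_tri z y x))//.
by rewrite (splitr q) ltrD.
Qed.

(** A locally uniform limit of the continuous [dveps eps]; one fixed eps = D/2 is enough for a given
    precision t. *)
Lemma ufun_continuous x : Om x -> {for x, continuous u}.
Proof.
move=> Ox; apply/continuousVP => t t0; have [q q0 hq] := Om_ball Ox.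
have t3 : 0 < t / 3 by rewrite divr_gt0.
have [D D0 hD] := dveps_unif_cvg q0 t3.
have D2 : 0 < D / 2 by rewrite divr_gt0.
have D2D : 0 < D / 2 < D by rewrite D2 ltr_pdivrMr// ltr_pMr// ltr1n.
have [s s0 hs] := (continuousVP _ _).1 (@dveps_continuous _ D2 x) _ t3.
have OmOf y : enorm (y - x) < q -> Om y.
  by move=> yq; apply: (hq y yq); rewrite /eball/= subrr enorm0.
exists (Num.min q s); first by rewrite lt_min q0.
move=> y; rewrite lt_min => /andP[yq ys].
apply: (dist_via2 _ (hD _ _ D2D (OmOf y yq) (hq y yq)) (hs y ys)).
by apply: hD => //; apply: hq; rewrite subrr enorm0.
Qed.

Lemma vfunE x : Om x -> vfun Om F psi i x = \int[mu]_(y in Om) (F y * N x y).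
Proof.
move=> Ox; rewrite /vfun LintE//; first exact: measurable_Om.
apply: measurable_funM; first exact: measurable_F.
by apply: measurable_funTS; exact: Nker_measurable.
Qed.

(** Only the bound on F and the weak singularity of N_i enter, so the rate holds on all of [Om], up
    to the boundary. *)
Lemma veps_sub_vfun : exists2 C : R, 0 <= C & forall eps x, 0 < eps -> Om x ->
  `|veps Om F psi eta eps i x - vfun Om F psi i x| <= C * eps.
Proof.
have [C C0 hC] := Kcut_dir_bounds i n0 cpsi spsi cdpsi sdpsi deta eta0 eta1 deta2 Bd0.
have rc0 := @radial_const_ge0 R n.
have KC0 : 0 <= K * C by rewrite mulr_ge0.
exists (K * C * (radial_const R n * 6)) => [|eps x eps0 Ox]; first by rewrite mulr_ge0// mulr_ge0.
rewrite vepsE// vfunE// -RintegralB; [|exact: measurable_Om|exact: integrable_F_continuous (@Kcut_continuous2 _ _ eps0)|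
  exact: F_Nker_integrable].
have -> : \int[mu]_(y in Om) (F y * k eps x y - F y * N x y) =
    \int[mu]_(y in Om) (Fe y * (k eps x y - N x y)).
  by apply: eq_Rintegral => y /set_mem Oy; rewrite ext0F_in// mulrBr.
rewrite (@Rintegral_supp _ _ Om (eball x (3 * eps))); last 2 first.
- move=> y _ /negP; rewrite /eball/= -leNgt enormB => h.
  by rewrite Kcut_far ?subrr ?mulr0// (le_trans _ h)// ler_wpM2r ?ler_nat// ltW.
- by move=> y _ Oy; rewrite ext0F_notin// mul0r.
have e30 : 0 < 3 * eps by rewrite mulr_gt0.
set f := fun y => Fe y * (k eps x y - N x y).
have mf : measurable_fun (eball x (3 * eps)) f.
  apply: measurable_funTS; apply: measurable_funM; first exact: measurable_ext0F.
  apply: measurable_funB; last exact: Nker_measurable.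
  by apply: continuous_measurableT; exact: Kcut_continuous2.
have fx : f x = 0 by rewrite /f /Kcut Nker_diag mul0r subrr mulr0.
have hb y : 0 < enorm (y - x) < 3 * eps -> `|f y| <= K * C * (enorm (y - x) * enorm (y - x) ^- n).
  move=> /andP[y0 _]; have [Oy|Oy] := pselect (Om y); last first.
    by rewrite /f ext0F_notin// mul0r normr0 !mulr_ge0 ?enorm_ge0// invr_ge0 exprn_ge0// enorm_ge0.
  have [h _ _ _] := hC eps x y eps0 (enorm_eball_le (Om_sub_ball Oy)) (neq_of_enorm y0).
  by rewrite /f normrM -mulrA ler_pM// ext0F_bound.
have [_ h] := weak_singularity_bound e30 KC0 mf fx hb.
by rewrite (le_trans h)// -!mulrA (mulrA 2 3) -natrM.
Qed.

(** Near x the derivative of v^eps is within t of u(x), for all eps < D at once. The admissible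
    range of h therefore does not depend on eps, and eps can tend to 0 with h fixed. *)
Lemma vfun_is_derive x : Om x -> is_derive x e (vfun Om F psi i) (u x).
Proof.
move=> Ox; apply/is_derive_line; apply: is_derive_of_bound => t t0.
rewrite scale0r addr0.
have t2 : 0 < t / 2 by rewrite divr_gt0.
have [q q0 hq] := Om_ball Ox.
have OmOf y : enorm (y - x) < q -> Om y.
  by move=> yq; apply: (hq y yq); rewrite /eball/= subrr enorm0.
have [s s0 hs] := (continuousVP _ _).1 (ufun_continuous Ox) _ t2.
have [D D0 hD] := dveps_unif_cvg q0 t2.
have [C C0 hC] := veps_sub_vfun.
exists (Num.min q s); first by rewrite lt_min q0.
move=> h; rewrite lt_min => /andP[hq' hs'].
have line (a : R) : enorm (x + a *: e - x) = `|a|.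
  by rewrite addrAC subrr add0r enormZ enorm_evec mulr1.
have Oh : Om (x + h *: e) by apply: OmOf; rewrite line.
have main eps : 0 < eps < D ->
  `|vfun Om F psi i (x + h *: e) - vfun Om F psi i x - h * u x| <= t * `|h| + (C * eps + C * eps).
  move=> /andP[eps0 eD].
  have H := @MVT_bound R (fun a => veps Om F psi eta eps i (x + a *: e)) (fun a => dveps eps (x + a *: e)) h (u x) t.
  have {H} := H (fun a => is_derive_line_at (veps_is_derive (x + a *: e) eps0)).
  rewrite scale0r addr0 => /(_ _)/wrap[].
    move=> a ah; have aq : enorm (x + a *: e - x) < q by rewrite line (le_lt_trans ah).
    have as' : enorm (x + a *: e - x) < s by rewrite line (le_lt_trans ah).
    have h1 := hD eps (x + a *: e) (introT andP (conj eps0 eD)) (OmOf _ aq) (hq _ aq).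
    exact: dist_via1 h1 (hs _ as').
  exact: dist_increment (hC eps _ eps0 Oh) (hC eps _ eps0 Ox).
apply/ler_addgt0Pr => z z0.
(* The second entry makes the two approximation errors, 2 C eps together, at most z. *)
pose eps := Num.min (D / 2) (z / (2 * (C + 1))).
have C1 : 0 < C + 1 by rewrite ltr_wpDl.
have eps0 : 0 < eps by rewrite lt_min !divr_gt0// mulr_gt0.
have eD : eps < D by rewrite gt_min ltr_pdivrMr// ltr_pMr// ltr1n.
rewrite (le_trans (main eps _)) ?eps0// lerD2l.
have : eps <= z / (2 * (C + 1)) by rewrite ge_min lexx orbT.
rewrite ler_pdivlMr ?mulr_gt0//; lra.
Qed.

End Potential.

(** * Vanishing of [psi] and its derivatives off the open unit ball *)

Section UnitBallSupport.
Variables (R : realType) (n : nat) (psi : 'rV[R]_n -> R).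
Hypothesis supp : closure [set x | psi x != 0] `<=` eball 0 1.

Lemma zero_off_unit_ball x : 1 <= enorm x -> psi x = 0.
Proof.
move=> x1; apply/eqP; apply: contraTT x1 => px; rewrite -ltNge.
by have := supp (@subset_closure _ [set x | psi x != 0] x px); rewrite /eball/= subr0.
Qed.

(** Such a point, even on the unit sphere, lies in the open complement of the support, where [psi]
    is locally 0. *)
Lemma pderiv_zero_off_unit_ball j x : 1 <= enorm x -> pderiv psi j x = 0.
Proof.
move=> x1; have ox : open (~` closure [set x | psi x != 0]).
  by apply: closed_openC; exact: closed_closure.
have nx : (~` closure [set x | psi x != 0]) x.
  by move=> /supp; rewrite /eball/= subr0 ltNge x1.
rewrite /pderiv (@near_eq_derive _ _ _ psi (cst 0)); first exact: derive_cst.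
have := open_nbhs_nbhs (conj ox nx); apply: filterS => y hy.
by apply/eqP/negPn/negP => py; apply: hy; exact: (@subset_closure _ [set x | psi x != 0]).
Qed.

End UnitBallSupport.

Theorem theorem13 (R : realType) (n : nat) (psi : 'rV[R]_n -> R)
  (Om : set 'rV[R]_n) (F : 'rV[R]_n -> R) (c : 'rV[R]_n) (r : R) (eta : R -> R) :
  (2 <= n)%N ->
  smooth psi ->
  closure [set x | psi x != 0] `<=` eball 0 1 ->
  Lint setT psi = 1 ->
  open Om -> bounded_setV Om ->
  (forall p, enorm p <= 1 -> star_shaped Om p) ->
  Dini Om F ->
  0 < r -> closure Om `<=` eball c r ->
  smooth_pos eta ->
  (forall t, 0 <= t <= 1 -> eta t = 0) ->
  (forall t, 2 <= t -> eta t = 1) ->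
  (forall t, 0 < t -> `|derive1 eta t| <= 2) ->
  forall i j : 'I_n,
    (* (i) u^i_j(x) is well defined on Om *)
    (forall x, Om x ->
       (forall y, y != x -> pderivable (fun x' => Nker psi i x' y) j x) /\
       Lintegrable (eball c r) (u_int1 (ext0 Om F) psi i j x) /\
       Lintegrable (eball c r) (u_int2 psi i j x) /\
       sphere_integrable c r (u_int3 psi c r i j x)) /\
    (* (ii) locally uniform convergence of d_j v^eps_i to u^i_j *)
    (forall Om' : set 'rV[R]_n, open Om' -> closure Om' `<=` Om ->
       forall e : R, 0 < e -> exists delta : R, 0 < delta /\
         forall eps : R, 0 < eps < delta -> forall x, Om' x ->
           pderivable (veps Om F psi eta eps i) j x /\
           `|pderiv (veps Om F psi eta eps i) j x - ufun Om F psi c r i j x| < e) /\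
    (* (iii) d_j v_i = u^i_j on Om *)
    (forall x, Om x -> pderivable (vfun Om F psi i) j x /\
                       pderiv (vfun Om F psi i) j x = ufun Om F psi c r i j x) /\
    (* (iv) v in C^1(Om): continuous partial derivatives on Om *)
    {within Om, continuous (pderiv (vfun Om F psi i) j)}.
Proof.
move=> n2 spsi supp _ oOm [M OM] star dF r0 Omr seta eta0 eta1 deta2 i j.
have n0 : (0 < n)%N by exact: ltn_trans n2.
have [cpsi /(_ j) [dpsi [cdpsi _]]] := spsi 1%N.
have [ceta [deta [cdeta _]]] := seta 1%N.
have zpsi := zero_off_unit_ball supp.
have zdpsi := fun x => @pderiv_zero_off_unit_ball R n psi supp j x.
have [z0 star0] : star_shaped Om 0 by apply: star; rewrite enorm0.
have [K K0 bF] : exists2 K : R, 0 <= K & forall x, Om x -> `|F x| <= K.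
  apply: (Dini_bounded z0 dF OM) => x t Ox t01.
  by have := star0 x Ox t t01; rewrite subr0 add0r.
have compact_cl A : closure A `<=` eball c r -> compact (closure A).
  move=> Ar; apply: (subclosed_compact _ (@compact_ceball R n c r)).
    exact: closed_closure.
  by move=> x /Ar; exact: ltW.
(* The closure of [Om] is compact inside the open ball, so it keeps a positive distance d from the
   sphere. *)
have [d d0 hd] := compact_unif_ball (compact_cl _ Omr) (@open_eball R n c r) Omr.
have gap x y : Om x -> r <= enorm (y - c) -> d <= enorm (x - y).
  move=> Ox yr; rewrite leNgt; apply/negP => xy.
  have := hd x (subset_closure Ox) y; rewrite /eball/= enormB => /(_ xy).
  by rewrite ltNge yr.
have u_cont := ufun_continuous n0 cpsi zpsi dpsi cdpsi zdpsi ceta deta cdeta eta0 eta1 deta2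
  oOm z0 dF K0 bF r0 d0 gap.
have v_der := vfun_is_derive i n0 cpsi zpsi dpsi cdpsi zdpsi ceta deta cdeta eta0 eta1 deta2
  oOm z0 dF K0 bF r0 d0 gap.
have veps_der := veps_is_derive i n0 cpsi zpsi dpsi cdpsi zdpsi ceta deta eta0 eta1 deta2
  oOm z0 dF K0 bF r0 d0 gap.
have vd_cvg := dveps_unif_cvg i n0 cpsi zpsi dpsi cdpsi zdpsi ceta deta cdeta eta0 eta1 deta2
  oOm z0 dF K0 bF r0 d0 gap.
split; [|split; [|split]].
- move=> x Ox; split; [|split; [|split]].
  + move=> y yx; rewrite eq_sym in yx.
    by have [] := Nker_pderivable i n0 cpsi zpsi dpsi cdpsi zdpsi yx.
  + rewrite (u_int1E i n0 cpsi zpsi dpsi cdpsi zdpsi).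
    apply: LintegrableE; first exact: measurable_eball.
    exact: (dini_kernel_integrable i n0 cpsi zpsi cdpsi zdpsi oOm z0 dF K0 bF r0 d0 gap Ox).
  + apply: LintegrableE; first exact: measurable_eball.
    exact: (dpsi_kernel_integrable i n0 cpsi zpsi cdpsi zdpsi r0 d0 gap Ox).
  + have d20 : 0 < d / 2 by rewrite divr_gt0.
    rewrite /sphere_integrable (sphere_pullE _ _ _ eta1 r0 gap d20 _ Ox); last first.
      by rewrite mulrC divfK.
    apply: LintegrableE; first exact: measurable_eball.
    exact: cone_pull_Kcut_integrable.
- move=> Om' _ Om'O e e0.
  (* The closure of Om' is compact, being closed in the bounded ball; q is a common radius of balls
     contained in [Om]. *)
  have [q q0 hq] := compact_unif_ball (compact_cl _ (fun x cx => Omr _ (subset_closure (Om'O x cx)))) oOm Om'O.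
  have [D D0 hD] := vd_cvg q e q0 e0.
  exists D; split => // eps eD x Ox.
  have cx := subset_closure Ox.
  have [dv Dv] := veps_der eps x (andP eD).1.
  by split => //; rewrite /pderiv Dv; apply: hD => //; [exact: Om'O|exact: hq].
- by move=> x Ox; have [dv Dv] := v_der x Ox.
(* The partial derivative equals u only on [Om]; as [Om] is open, they agree near each of its
   points. *)
- rewrite continuous_open_subspace// => x; rewrite inE => Ox.
  have Du y : Om y -> pderiv (vfun Om F psi i) j y = ufun Om F psi c r i j y.
    by move=> Oy; have [_] := v_der y Oy.
  have nO : nbhs x Om by apply: open_nbhs_nbhs; split.
  have := u_cont i x Ox; rewrite /prop_for /continuous_at Du// => cu.
  have uE : {near x, ufun Om F psi c r i j =1 pderiv (vfun Om F psi i) j}.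
    by apply: filterS nO => y /Du.
  exact: cvg_trans (near_eq_cvg uE) cu.
Qed.
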